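(* Let $\Omega\subset\mathbb{R}^n$ be a non-empty bounded open set. Let $m_1,m_2\in\mathbb{N}$ be such that $m_1,m_2\le n-1$, and let $f:\Omega\to\mathbb{R}^n$ be a bi-Sobolev homeomorphism such that $f\in W^{1,p}(\Omega,\mathbb{R}^n)$, $f^{-1}\in W^{1,q}(f(\Omega),\mathbb{R}^n)$, $f|_{\partial\Omega}=\mathrm{id}|_{\partial\Omega}$, and $\operatorname{rank}(Df)\le m_1$, $\operatorname{rank}(Df^{-1})\le m_2$ almost everywhere in $\Omega$. Suppose that there exist measurable sets $A,B\subset\Omega$ with $|A|,|B|>0$, $\operatorname{rank}(Df)=m_1$ on $A$ and $\operatorname{rank}(Df^{-1})=m_2$ on $B$. Then $$p\le\min\{m_1+1,\,n-m_2\}\quad\text{and}\quad q\le\min\{m_2+1,\,n-m_1\}.$$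
   Context: A bi-Sobolev homeomorphism $f:\Omega\to\mathbb{R}^n$ is a homeomorphism onto its image $f(\Omega)$ such that both $f$ and $f^{-1}$ are Sobolev maps (in $W^{1,1}$). The condition $f|_{\partial\Omega}=\mathrm{id}|_{\partial\Omega}$ means that $f$ extends continuously to $\overline\Omega$ with boundary values equal to the identity (so that $f(\Omega)=\Omega$). Here $p,q\ge 1$, and $|\cdot|$ denotes Lebesgue measure. *)

(* Defs.v *)
From HB Require Import structures.
From mathcomp Require Import all_boot all_order all_algebra.
From mathcomp Require Import all_classical all_reals all_analysis.

Set Implicit Arguments.
Unset Strict Implicit.
Unset Printing Implicit Defensive.
Import Order.TTheory GRing.Theory Num.Theory.
Import numFieldNormedType.Exports.

Local Open Scope classical_set_scope.
Local Open Scope ring_scope.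

Definition rV_display : measure_display. Proof. exact: default_measure_display. Qed.

Section rV_measurable.
Context {R : realType} {n : nat}.

(* Product (equivalently, Borel) sigma-algebra on R^n. *)
Definition rV_cylinders : set (set 'rV[R]_n) :=
  [set B | exists i (A : set R),
     measurable A /\ B = (fun x : 'rV[R]_n => x 0 i) @^-1` A].

Definition rV_measurable : set (set 'rV[R]_n) := <<s rV_cylinders >>.

Let rV_measurable0 : rV_measurable set0.
Proof. exact: sigma_algebra0. Qed.

Let rV_measurableC A : rV_measurable A -> rV_measurable (~` A).
Proof. exact: sigma_algebraC. Qed.

Let rV_measurable_bigcup (F : (set 'rV[R]_n)^nat) :
  (forall i, rV_measurable (F i)) -> rV_measurable (\bigcup_i F i).
Proof. exact: sigma_algebra_bigcup. Qed.

HB.instance Definition _ := @isMeasurable.Build rV_display 'rV[R]_n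
  rV_measurable rV_measurable0 rV_measurableC rV_measurable_bigcup.

End rV_measurable.

Section rV_cons.
Context {R : realType} {n : nat}.

Definition rV_cons (x : R * 'rV[R]_n) : 'rV[R]_n.+1 :=
  \row_i oapp (fun j => x.2 0 j) x.1 (unlift ord0 i).

Definition rV_uncons (x : 'rV[R]_n.+1) : R * 'rV[R]_n :=
  (x 0 ord0, \row_j x 0 (lift ord0 j)).

Lemma rV_uncons_consK : cancel rV_cons rV_uncons.
Proof.
move=> [a x]; rewrite /rV_uncons !mxE unlift_none; congr pair.
by apply/rowP => j; rewrite !mxE liftK.
Qed.

Lemma rV_cons_unconsK : cancel rV_uncons rV_cons.
Proof.
move=> x; apply/rowP => i; rewrite mxE.
by case: unliftP => [j|] -> //=; rewrite mxE.
Qed.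

Lemma measurable_rV_coord m (i : 'I_m) :
  measurable_fun [set: 'rV[R]_m] (fun x => x 0 i).
Proof.
move=> _ A mA; rewrite setTI; apply: sub_sigma_algebra.
by exists i, A.
Qed.

Lemma measurable_fun_rV d (T : measurableType d) m (f : T -> 'rV[R]_m) :
  (forall i, measurable_fun [set: T] (fun x => f x 0 i)) ->
  measurable_fun [set: T] f.
Proof.
move=> mf; apply: (@measurability _ _ _ _ _ _ (@rV_cylinders R m)) => //.
by move=> _ [_ [i [A [mA ->]]] <-]; rewrite setTI; move: (mf i measurableT A mA);
  rewrite setTI.
Qed.

Lemma measurable_rV_cons : measurable_fun setT rV_cons.
Proof.
apply: measurable_fun_rV => i.
case: (unliftP ord0 i) => [j|] ->.
- under eq_fun do rewrite mxE liftK /=.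
  exact: (measurableT_comp (measurable_rV_coord j) measurable_snd).
- under eq_fun do rewrite mxE unlift_none /=.
  exact: measurable_fst.
Qed.

HB.instance Definition _ :=
  isMeasurableFun.Build _ _ _ _ rV_cons measurable_rV_cons.

Lemma measurable_rV_uncons : measurable_fun setT rV_uncons.
Proof.
apply: measurable_fun_pair; first exact: measurable_rV_coord.
apply: measurable_fun_rV => i.
under eq_fun do rewrite mxE.
exact: measurable_rV_coord.
Qed.

End rV_cons.

Section lebesgue_rV.
Context {R : realType}.

Section step.
Variables (n : nat) (mu : {sigma_finite_measure set 'rV[R]_n -> \bar R}).

Definition lebesgue_rVS : set 'rV[R]_n.+1 -> \bar R :=
  pushforward (lebesgue_measure \x mu)%E rV_cons.

Let preimage_rV_cons A : measurable A -> measurable (@rV_cons R n @^-1` A).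
Proof. by move=> mA; rewrite -[X in measurable X]setTI; exact: measurable_rV_cons. Qed.

Let lebesgue_rVS0 : lebesgue_rVS set0 = 0%E.
Proof. by rewrite /lebesgue_rVS /pushforward preimage_set0 measure0. Qed.

Let lebesgue_rVS_ge0 A : (0 <= lebesgue_rVS A)%E.
Proof. by rewrite /lebesgue_rVS /pushforward; exact: measure_ge0. Qed.

Let lebesgue_rVS_sigma_additive : semi_sigma_additive lebesgue_rVS.
Proof.
move=> F mF tF mUF; rewrite /lebesgue_rVS /pushforward preimage_bigcup.
apply: measure_semi_sigma_additive.
- by move=> k; exact: preimage_rV_cons.
- apply/trivIsetP => /= i j _ _ ij; rewrite -preimage_setI.
  by move/trivIsetP : tF => /(_ _ _ _ _ ij) ->//; rewrite preimage_set0.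
- by rewrite -preimage_bigcup; exact: preimage_rV_cons.
Qed.

HB.instance Definition _ := isMeasure.Build _ _ _ lebesgue_rVS
  lebesgue_rVS0 lebesgue_rVS_ge0 lebesgue_rVS_sigma_additive.

Lemma lebesgue_rVS_sigma_finite : sigma_finite [set: 'rV[R]_n.+1] lebesgue_rVS.
Proof.
have /sigma_finiteP[F [TF ndF Foo]] := sigma_finiteT (@lebesgue_measure R).
have /sigma_finiteP[G [TG ndG Goo]] := sigma_finiteT mu.
exists (fun k => rV_uncons @^-1` (F k `*` G k)).
  rewrite -preimage_bigcup -(preimage_setT rV_uncons); congr (_ @^-1` _).
  apply/seteqP; split => [[x y] _|//].
  have [k _ Fkx] : (\bigcup_k F k) x by rewrite -TF.
  have [l _ Gly] : (\bigcup_k G k) y by rewrite -TG.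
  exists (maxn k l) => //; split => /=.
    by move: x Fkx; exact/subsetPset/ndF/leq_maxl.
  by move: y Gly; exact/subsetPset/ndG/leq_maxr.
move=> k; have [mFk Fkoo] := Foo k; have [mGk Gkoo] := Goo k; split.
  rewrite -[X in measurable X]setTI.
  by apply: measurable_rV_uncons => //; exact: measurableX.
rewrite /lebesgue_rVS /pushforward -comp_preimage.
rewrite (_ : _ \o _ = id); last by apply/funext => x; exact: rV_uncons_consK.
by rewrite preimage_id product_measure1E// lte_mul_pinfty// ge0_fin_numE.
Qed.

End step.

HB.instance Definition _ n (mu : {sigma_finite_measure set 'rV[R]_n -> \bar R}) :=
  Measure_isSigmaFinite.Build _ _ _ (lebesgue_rVS mu) (lebesgue_rVS_sigma_finite mu).

(* n-fold product of the one-dimensional Lebesgue measure, on Borel sets. *)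
Fixpoint lebesgue_rV n : {sigma_finite_measure set 'rV[R]_n -> \bar R} :=
  match n with
  | 0%N => (\d_(0 : 'rV[R]_0) : set 'rV[R]_0 -> \bar R)
  | n'.+1 => lebesgue_rVS (lebesgue_rV n')
  end.

Lemma lebesgue_rV_box n (a b : 'rV[R]_n) : (forall i, a 0 i <= b 0 i) ->
  lebesgue_rV n [set x | forall i, x 0 i \in `[a 0 i, b 0 i]] =
  (\prod_(i < n) (b 0 i - a 0 i))%:E.
Proof.
elim: n a b => [|n IH] a b ab.
  rewrite big_ord0 /= diracE mem_set//=; last by move=> -[].
rewrite big_ord_recl EFinM /=.
pose a' : 'rV[R]_n := \row_j a 0 (lift ord0 j); pose b' : 'rV[R]_n := \row_j b 0 (lift ord0 j).
transitivity ((lebesgue_measure \x lebesgue_rV n)%E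
    (`[a 0 ord0, b 0 ord0]%classic `*`
     [set x : 'rV[R]_n | forall i, x 0 i \in `[a' 0 i, b' 0 i]])).
  rewrite /lebesgue_rVS /pushforward; congr (_ _).
  apply/seteqP; split => [[u x]/= h|[u x]/= [h0 h] i].
    split; first by have := h ord0; rewrite mxE unlift_none.
    by move=> j; have := h (lift ord0 j); rewrite !mxE liftK.
  rewrite mxE; case: unliftP => [j|] -> //=.
  by have := h j; rewrite !mxE.
rewrite product_measure1E//; last first.
  rewrite (_ : [set x | _] = \bigcap_(i in [set: 'I_n])
     ((fun x : 'rV[R]_n => x 0 i) @^-1` `[a' 0 i, b' 0 i]%classic)); last first.
    by apply/seteqP; split => [x/= h i _|x/= h i]; [exact: h|exact: (h i I)].
  apply: fin_bigcap_measurable; first exact: finite_finset.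
  by move=> i _; rewrite -[X in measurable X]setTI; exact: measurable_rV_coord.
rewrite IH; last by move=> i; rewrite !mxE.
have -> : lebesgue_measure_lebesgue_measure__canonical__measure_function_Measure R
    `[a 0 ord0, b 0 ord0]%classic = (b 0 ord0 - a 0 ord0)%:E.
  apply: etrans (lebesgue_measure_itv _) _; rewrite /= lte_fin.
  case: ltP => // ba.
  by rewrite (le_anti (introT andP (conj ba (ab ord0)))) subrr.
have -> : \prod_(i < n) (b' 0 i - a' 0 i) =
          \prod_(i < n) (b 0 (lift ord0 i) - a 0 (lift ord0 i)).
  by apply: eq_bigr => i _; rewrite !mxE.
by [].
Qed.

End lebesgue_rV.

(* 'rV[R]_n equipped with the sigma-algebra of Lebesgue-measurable sets, and the
   (complete) Lebesgue measure: the Caratheodory completion of [lebesgue_rV]. *)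
Definition lebesgue_type (R : realType) (n : nat) : measurableType _ :=
  caratheodory_type (mu_ext (@lebesgue_rV R n)).

Definition lebesgue (R : realType) (n : nat) :
    {measure set (lebesgue_type R n) -> \bar R} :=
  @completed_measure_extension _ _ _ (@lebesgue_rV R n).

Section sobolev.
Context {R : realType} {n : nat}.
Implicit Types (Om : set 'rV[R]_n) (u v phi : 'rV[R]_n -> R) (p : R).

Definition lebesgue_measurable (A : set 'rV[R]_n) : Prop :=
  measurable (A : set (lebesgue_type R n)).

Definition partial (j : 'I_n) u : 'rV[R]_n -> R := 'D_('e_j) u.

(* u is of class C^k on the whole space. *)
Fixpoint Ck (k : nat) u : Prop :=
  continuous u /\
  if k is k'.+1 then
    forall j, (forall x, derivable u x 'e_j) /\ Ck k' (partial j u)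
  else True.

(* C_c^oo(Om), each function being extended by 0 outside Om. *)
Definition test_function Om phi : Prop :=
  [/\ forall k, Ck k phi, compact (closure [set x | phi x != 0])
    & closure [set x | phi x != 0] `<=` Om].

(* L^p(Om); [u \_ Om] is u on Om and 0 elsewhere, so only u on Om matters. *)
Definition Lp Om p u : Prop :=
  ((u \_ Om : lebesgue_type R n -> R) \in Lfun (lebesgue R n) p%:E).

Definition L1loc Om u : Prop := forall K : set 'rV[R]_n,
  compact K -> K `<=` Om ->
  (lebesgue R n).-integrable (K : set (lebesgue_type R n)) (EFin \o u).

(* v is a weak (distributional) j-th partial derivative of u in Om; v is only
   determined up to a null set. *)
Definition weak_partial Om u (j : 'I_n) v : Prop :=
  [/\ L1loc Om u, L1loc Om v &
    forall phi, test_function Om phi ->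
      \int[lebesgue R n]_(x in Om) (u x * partial j phi x) =
      - \int[lebesgue R n]_(x in Om) (v x * phi x)].

Definition weak_jacobian m Om (f : 'rV[R]_n -> 'rV[R]_m)
    (Df : 'rV[R]_n -> 'M[R]_(m, n)) : Prop :=
  forall i j, weak_partial Om (fun x => f x 0 i) j (fun x => Df x i j).

(* f belongs to W^{1,p}(Om, R^m). *)
Definition sobolev m Om p (f : 'rV[R]_n -> 'rV[R]_m) : Prop :=
  (forall i, Lp Om p (fun x => f x 0 i)) /\
  exists2 Df : 'rV[R]_n -> 'M[R]_(m, n), weak_jacobian Om f Df &
    forall i j, Lp Om p (fun x => Df x i j).

(* f restricts to a homeomorphism from Om onto f @` Om, with inverse g; values of
   f outside Om and of g outside f @` Om are irrelevant. *)
Definition homeomorphism_with_inverse Om (f g : 'rV[R]_n -> 'rV[R]_n) : Prop :=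
  [/\ {in Om, cancel f g}, {within Om, continuous f} &
      {within f @` Om, continuous g}].

Definition bisobolev_homeo Om (f g : 'rV[R]_n -> 'rV[R]_n) : Prop :=
  [/\ homeomorphism_with_inverse Om f g, sobolev Om 1 f &
      sobolev (f @` Om) 1 g].

Definition boundary Om : set 'rV[R]_n := closure Om `\` interior Om.

Definition identity_on_boundary Om (f : 'rV[R]_n -> 'rV[R]_n) : Prop :=
  exists F : 'rV[R]_n -> 'rV[R]_n,
    [/\ {within closure Om, continuous F}, {in Om, F =1 f} &
        {in boundary Om, F =1 id}].

End sobolev.

(* Main.v *)
(* Outline. By Brouwer, f maps Om onto itself. Approximate differentiability is used in a strong
   form: off sets of small measure there are compact sets K on which Df is bounded and
   |f y - f x - Df(x0)(y - x)| <= eta |y - x| for x0, x, y in K close to each other; this follows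
   from averages over shrinking cubes and a maximal function estimate. If Df is singular on such
   a K, then f(K) is null. On the other hand, if |S| = k < q and g is W^{1,q}, then the map which
   replaces the coordinates in S by k components of g sends sets of small measure to sets of small
   measure: cover by boxes that are cubes in the directions of S and much thinner in the others,
   where only the derivatives in the directions of S matter, so that the exponent q > k suffices.

   If p > m1 + 1, replacing by f the first m1 + 1 coordinates of the identity gives a map of Om onto
   itself whose image is null by these two facts. If q > n - m1, choose m1 independent rows of
   Df(x0) and complete them to an invertible matrix by unit rows; the corresponding components of
   f and coordinate functions form a map that is bi-Lipschitz on K near x0, yet maps K to a null
   set because it is obtained from f, for which f(K) is null, by inserting n - m1 components of the
   inverse g. The other two bounds follow by exchanging f and g. *)
Require Import Defs.
From mathcomp Require Import all_boot all_order all_fingroup all_algebra.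
From mathcomp Require Import all_classical all_reals all_analysis.
From mathcomp Require Import measurable_realfun ring lra zify.

Set Implicit Arguments.
Unset Strict Implicit.
Unset Printing Implicit Defensive.
Import Order.TTheory GRing.Theory Num.Theory.
Import numFieldNormedType.Exports.

Local Open Scope classical_set_scope.
Local Open Scope ring_scope.

(** * A discrete Poincare-Miranda lemma *)

(** A map in W^{1,p} with small p may send null sets to sets of positive measure, so the rank of
    [Df] alone does not bound the size of the image. The compact sets [K] fill [Om] only up to small
    measure, and the remainder needs a separate mechanism: its image is controlled when k components
    of a Sobolev map replace coordinates, since then an exponent above k suffices. This is why the
    maps used below mix coordinates and components. In the thin directions of a box nothing is
    differentiated: averages are compared by halving only the sides in the directions of [S], and
    after finitely many halvings the box is so small that continuity finishes the comparison.

    Sobolev functions are probed with products of functions of one variable. The averaging kernels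
    are derivatives of steps, so the difference of two averages pairs the function with partial
    derivatives of test functions, that is, it becomes an integral of weak derivatives.

    Brouwer's theorem comes from a mod 2 count over Kuhn's triangulation, written with cup products
    so that Stokes' formula carries no signs. *)

Section chains.
Variables (V : Type).
Local Notation F := 'F_2.
Implicit Types (cs : seq (V -> F)) (b : V -> F) (vs : seq V).

Lemma addF2 (x : F) : x + x = 0.
Proof. by rewrite (addrr_pchar2 (pchar_Fp _)). Qed.

(* Cup products over F_2: for 0-cochains [a_i] and [b], [cupd] is the product of the coboundaries
   of the [a_i], and [cupm] has the extra factor [b] between those of [as1] and of [as2]. *)
Fixpoint cupd cs vs : F :=
  match cs, vs with
  | a :: cs', v :: ((w :: _) as vs') => (a v + a w) * cupd cs' vs'
  | _, _ => 1
  end.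

Fixpoint cupm as1 b as2 vs : F :=
  match as1, vs with
  | a :: cs', v :: ((w :: _) as vs') => (a v + a w) * cupm cs' b as2 vs'
  | [::], w :: _ => b w * cupd as2 vs
  | _, _ => 0
  end.

Lemma cupdS a cs v w vs :
  cupd (a :: cs) (v :: w :: vs) = (a v + a w) * cupd cs (w :: vs).
Proof. by []. Qed.

Lemma cupmS a cs b ds v w vs :
  cupm (a :: cs) b ds (v :: w :: vs) = (a v + a w) * cupm cs b ds (w :: vs).
Proof. by []. Qed.

Lemma cupmN b ds w vs :
  cupm [::] b ds (w :: vs) = b w * cupd ds (w :: vs).
Proof. by []. Qed.

Arguments cupd : simpl never.
Arguments cupm : simpl never.

Definition face j vs := take j vs ++ drop j.+1 vs.

Lemma face0 v vs : face 0 (v :: vs) = vs.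
Proof. by rewrite /face /= drop0. Qed.

Lemma faceS j v vs : face j.+1 (v :: vs) = v :: face j vs.
Proof. by []. Qed.

(** A product of coboundaries is closed. In the induction every face from the third on keeps the
    factor [a u + a v]; by induction they add up to the same [cupd cs (w :: vs)] that the first two
    faces carry, and the three factors cancel mod 2. *)
Lemma sum_face_cupd cs vs : size vs = (size cs).+2 ->
  \sum_(j < (size cs).+2) cupd cs (face j vs) = 0.
Proof.
elim: cs vs => [|a cs IH] [|u [|v vs]] //= [sz].
  by case: vs sz => // _; rewrite !big_ord_recl big_ord0 addr0 -[RHS](addF2 1).
case: vs sz => [//|w vs] [sz].
have := IH (v :: w :: vs); rewrite /= sz => /(_ erefl).
rewrite big_ord_recl face0 => /eqP; rewrite addr_eq0 => /eqP e.
rewrite 2!big_ord_recl !lift0 !(face0, faceS) 2!cupdS.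
under eq_bigr do rewrite !lift0 !faceS cupdS -faceS -lift0.
rewrite -big_distrr /=.
have -> : \sum_(i < (size cs).+1) cupd cs (face (lift ord0 i) (v :: w :: vs))
   = cupd cs (w :: vs).
  by apply/eqP; rewrite -subr_eq0 e opprK addF2.
rewrite -!mulrDl [X in X * _](_ : _ = (a u + a u) + (a v + a v) + (a w + a w)).
  by rewrite !addF2 mul0r.
by ring.
Qed.

(** Leibniz rule: inserting [b] itself gives a primitive of the product in which [b] is
    differentiated. This is the discrete Stokes formula, which turns sums over simplices into sums
    over facets. *)
Lemma sum_face_cupm cs b ds vs : size vs = (size cs + size ds).+2 ->
  \sum_(j < (size cs + size ds).+2) cupm cs b ds (face j vs)
  = cupd (cs ++ b :: ds) vs.
Proof.
elim: cs vs => [|a cs IH] [|u [|v vs]] //= [sz].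
  have := @sum_face_cupd ds (u :: v :: vs); rewrite /= sz => /(_ erefl).
  rewrite add0n big_ord_recl face0 => /eqP; rewrite addr_eq0 => /eqP e.
  rewrite big_ord_recl face0 cupdS cupmN.
  under eq_bigr do rewrite lift0 faceS cupmN -faceS -lift0.
  rewrite -big_distrr /= mulrDl addrC; congr (_ + _); congr (_ * _).
  by apply/eqP; rewrite -subr_eq0 e opprK addF2.
case: vs sz => [|w vs] [sz]; first by rewrite addSn in sz.
have := IH (v :: w :: vs); rewrite /= sz addSn => /(_ erefl) {IH}.
rewrite big_ord_recl face0 => e.
rewrite 2!big_ord_recl !lift0 !(face0, faceS) 2!cupmS.
under eq_bigr do rewrite !lift0 !faceS cupmS -faceS -lift0.
rewrite -big_distrr /= cupdS -e.
set y := cupm _ _ _ _; set x := \sum_(_ < _) _.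
transitivity ((a u + a v) * (y + x) + (a w + a w) * y); last first.
  by rewrite !addF2 !mul0r addr0.
by ring.
Qed.

(** The length condition guarantees that the slot is reached; past the end of [vs] the product takes
    the default value 1, which is not additive. *)
Lemma cupdD cs f g ds vs : (size cs < (size vs).-1)%N ->
  cupd (cs ++ (fun v => f v + g v) :: ds) vs =
  cupd (cs ++ f :: ds) vs + cupd (cs ++ g :: ds) vs.
Proof.
elim: cs vs => [|a cs IH] [|v [|w vs]] //= sz; rewrite !cupdS; first by ring.
by rewrite IH//= mulrDr.
Qed.

Lemma cupd0 cs i vs : (i < size cs)%N -> (size vs = (size cs).+1)%N ->
  (forall v w, List.In v vs -> List.In w vs ->
     nth (fun=> 0) cs i v = nth (fun=> 0) cs i w) -> cupd cs vs = 0.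
Proof.
elim: cs i vs => [|a cs IH] i [|v [|w vs]] //= ilt [sz] h.
case: i ilt h => [|i] ilt h; last first.
  rewrite (cupdS,cupmS) (IH i) ?mulr0//=; first by rewrite sz.
  by move=> ? ? ? ?; apply: h; right.
by have /= e := h v w; rewrite (cupdS,cupmS) e ?addF2 ?mul0r//; [left|right; left].
Qed.

(** In the middle slot [b] appears undifferentiated, so constancy does not suffice there and
    vanishing is required. *)
Lemma cupm0 cs b ds i vs : (size vs = (size cs + size ds).+1)%N ->
  (i < size cs + (size ds).+1)%N ->
  (forall v w, List.In v vs -> List.In w vs ->
     nth (fun=> 0) (cs ++ b :: ds) i v = nth (fun=> 0) (cs ++ b :: ds) i w) ->
  (i = size cs -> forall v, List.In v vs -> b v = 0) -> cupm cs b ds vs = 0.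
Proof.
elim: cs i vs => [|a cs IH] i [|v vs] //= [sz] ilt h hb.
  case: i ilt h hb => [|i] ilt h hb.
    by rewrite cupmN hb ?mul0r//; left.
  by rewrite cupmN (@cupd0 ds i) ?mulr0//= sz.
case: vs sz h hb => [//|w vs] [sz] h hb.
case: i ilt h hb => [|i] ilt h hb; last first.
  rewrite (cupdS,cupmS) (IH i) ?mulr0//=; first by rewrite sz.
  - by move=> ? ? ? ?; apply: h; right.
  - by move=> e v' vin; apply: hb; [rewrite e|right].
by have /= e := h v w; rewrite (cupdS,cupmS) e ?addF2 ?mul0r//; [left|right; left].
Qed.

Lemma cupd_map (c : nat -> V -> F) (e : nat -> V) s m :
  cupd (map c (iota s m)) (map e (iota s m.+1)) =
  \prod_(s <= l < s + m) (c l (e l) + c l (e l.+1)).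
Proof.
elim: m s => [|m IH] s; first by rewrite addn0 big_geq.
rewrite big_ltn ?addnS ?ltnS ?leq_addr//.
have -> : map c (iota s m.+1) = c s :: map c (iota s.+1 m) by [].
have -> : map e (iota s m.+2) = e s :: map e (iota s.+1 m.+1) by [].
by rewrite -addSn -IH.
Qed.

End chains.

(** * Kuhn's triangulation of the cube and its mod 2 Stokes formula *)

Section kuhn.
Variables (n N : nat).
Local Notation F := 'F_2.
Local Notation V := {ffun 'I_n -> nat}.
Local Notation Q := {ffun 'I_n -> 'I_N}.
Implicit Types (q : Q) (t : {perm 'I_n}).

(* The j-th vertex of the Kuhn simplex based at q; t x is the step at which
   the coordinate x is increased. *)
Definition kvertex q t j : V := [ffun x => q x + (t x < j)%N]%N.

Definition ksimplex q t : seq V := map (kvertex q t) (iota 0 n.+1).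

Lemma size_ksimplex q t : size (ksimplex q t) = n.+1.
Proof. by rewrite size_map size_iota. Qed.

Lemma face_ksimplex q t j : face j (ksimplex q t) =
  map (kvertex q t) (iota 0 (minn j n.+1) ++ iota j.+1 (n.+1 - j.+1)).
Proof. by rewrite /face /ksimplex -map_take -map_drop -map_cat take_iota drop_iota. Qed.

(** An inner facet is shared by the two simplices whose orders of steps differ by exchanging two
    consecutive steps. *)
Lemma kvertex_swap q t (i j : 'I_n) (l : nat) : j = i.+1 :> nat -> l != j :> nat ->
  kvertex q (t * tperm i j)%g l = kvertex q t l.
Proof.
move=> ji lj; apply/ffunP => x; rewrite !ffunE permM; congr addn; congr nat_of_bool.
case: tpermP => [->|->|//]; lia.
Qed.

(** Together with [cyc_base], the neighbour across the facet that omits the base vertex: the walk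
    starts at the second vertex, and the former first step is made last. Both shifts are cyclic, so
    that they permute all pairs [(q, t)]; wrapping around in [cyc_base] happens exactly at facets on
    the boundary of the cube. *)
Definition cyc_pos t : {perm 'I_n} := (t * perm (can_inj (@ord_predK n)))%g.

Definition cyc_base q t : Q := [ffun x => if t x == 0%N :> nat then ordS (q x) else q x].

Lemma cyc_inj : injective (fun p : Q * {perm 'I_n} => (cyc_base p.1 p.2, cyc_pos p.2)).
Proof.
move=> [q t] [q' t'] /= [eq /mulIg et]; rewrite -et in eq *; congr pair.
apply/ffunP => x; move/ffunP/(_ x): eq; rewrite !ffunE.
by case: ifP => // _ /(can_inj (@ordSK N)).
Qed.

Lemma kvertex_cyc q t l : (l < n)%N ->
  (forall x, t x = 0%N :> nat -> (q x).+1 < N)%N ->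
  kvertex (cyc_base q t) (cyc_pos t) l = kvertex q t l.+1.
Proof.
move=> ln h; apply/ffunP => x; rewrite !ffunE permM permE /=.
case: ifPn => [/eqP tx0|tx0].
  rewrite /= modn_small ?h// tx0 /= add0n modn_small ?ltn_predL; lia.
congr addn; congr nat_of_bool.
have tn := ltn_ord (t x).
have -> : (t x + n).-1 = (t x).-1 + n by lia.
rewrite modnDr modn_small; lia.
Qed.

Implicit Types c : nat -> V -> F.

(** The integral over the cube of the product of all coboundaries. It plays the role of a degree mod
    2. *)
Definition ksum c : F :=
  \sum_(p : Q * {perm 'I_n}) cupd (map c (iota 0 n)) (ksimplex p.1 p.2).

Definition on_faces (x : 'I_n) (v : V) := (v x == 0%N) || (v x == N).

Definition face_constant c := forall (x : 'I_n) (v w : V),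
  on_faces x v -> v x = w x -> c x v = c x w.

(** Stokes: the sum becomes a sum over facets of the product with [c i] undifferentiated. Inner
    facets cancel in pairs. A facet on the boundary in direction [y] contributes 0: for [y] other
    than [i] the coboundary of [c y] vanishes on it, and for [y = i] the factor [c i] does. *)
Lemma ksum_eq0 c (i : 'I_n) : face_constant c ->
  (forall v, on_faces i v -> c i v = 0) -> ksum c = 0.
Proof.
move=> cc ci0.
have icat : iota 0 n = iota 0 i ++ (i : nat) :: iota i.+1 (n - i.+1).
  have {1}-> : iota 0 n = iota 0 (i + (n - i.+1).+1) by congr iota; have := ltn_ord i; lia.
  by rewrite iotaD.
set cs := map c (iota 0 i); set ds := map c (iota i.+1 (n - i.+1)).
have ecat : map c (iota 0 n) = cs ++ c i :: ds by rewrite icat map_cat.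
have szcd : (size cs + size ds).+1 = n.
  by rewrite !size_map !size_iota; have := ltn_ord i; lia.
have szcs : size cs = i by rewrite size_map size_iota.
have nthc k : (k < n)%N -> nth (fun=> 0) (cs ++ c i :: ds) k = c k.
  by move=> kn; rewrite -ecat (nth_map 0%N) ?size_iota// nth_iota.
pose G p j := cupm cs (c i) ds (face j (ksimplex p.1 p.2)).
have -> : ksum c = \sum_(j < n.+1) \sum_p G p j.
  rewrite exchange_big /=; apply: eq_bigr => p _; rewrite ecat.
  have := @sum_face_cupm _ cs (c i) ds (ksimplex p.1 p.2).
  by rewrite szcd size_ksimplex => /(_ erefl) <-.
(* The exchange of two consecutive steps reverses the parity of the permutation, so the even and the
   odd halves of the sum are equal. *)
have inner j : (0 < j < n)%N -> \sum_p G p j = 0.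
  case: j => // j /= jn; pose i0 : 'I_n := Ordinal (ltnW jn); pose j0 : 'I_n := Ordinal jn.
  rewrite (bigID (fun p => odd_perm p.2)) /=.
  rewrite (reindex_inj (h := fun p : Q * {perm 'I_n} => (p.1, (p.2 * tperm i0 j0)%g))) /=; last first.
    by move=> [q t] [q' t'] /= [-> /mulIg ->].
  under eq_bigl => p do rewrite odd_permM odd_tperm -val_eqE /= (ltn_eqF (ltnSn j)) addbT.
  rewrite (eq_bigr (fun p => G p j.+1)) ?addF2// => -[q t] _; rewrite /G /= !face_ksimplex.
  congr (cupm _ _ _ _); apply/eq_in_map => l; rewrite mem_cat !mem_iota => lj.
  by apply: kvertex_swap => //=; lia.
(* The first facet of a simplex is the last facet of its cyclic neighbour, unless the first step
   reaches the face [x = N]. In that case the neighbour has wrapped around, the two facets lie in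
   opposite faces of the cube, and both terms vanish. *)
have outer : \sum_p G p 0%N = \sum_p G p n.
  rewrite [RHS](reindex_inj cyc_inj); apply: eq_bigr => -[q t] _; rewrite /G /=.
  have n0 : (0 < n)%N by exact: leq_ltn_trans (ltn_ord i).
  pose x := (t^-1)%g (Ordinal n0).
  have tx : t x = 0%N :> nat by rewrite /x permKV.
  have txE y : t y = 0%N :> nat -> y = x.
    by move=> ty; rewrite /x; apply: (@perm_inj _ t); rewrite permKV; apply: val_inj.
  have f0 : face 0 (ksimplex q t) = map (kvertex q t) (iota 1 n) by exact: face0.
  have fn : face n (ksimplex (cyc_base q t) (cyc_pos t)) =
      map (kvertex (cyc_base q t) (cyc_pos t)) (iota 0 n).
    by rewrite face_ksimplex (minn_idPl _)// subnn cats0.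
  have sz0 : size (face 0 (ksimplex q t)) = (size cs + size ds).+1.
    by rewrite f0 size_map size_iota.
  have szn : size (face n (ksimplex (cyc_base q t) (cyc_pos t))) = (size cs + size ds).+1.
    by rewrite fn size_map size_iota.
  have cst vs y (k := val y) : size vs = (size cs + size ds).+1 -> (forall v, List.In v vs -> on_faces y v) ->
      (forall v w, List.In v vs -> List.In w vs -> v y = w y) ->
      cupm cs (c i) ds vs = 0.
    move=> szvs fy vy; apply: (@cupm0 _ cs (c i) ds k) => //.
    - by rewrite addnS szcd ltn_ord.
    - move=> v w vvs wvs; rewrite !nthc ?ltn_ord//; apply: (cc y); [exact: fy|exact: vy].
    - move=> kcs v vvs; apply: ci0; have <- : y = i by apply: val_inj; rewrite /= -szcs.
      exact: fy.
  have InE (T S : Type) (f : T -> S) (r : seq T) v : List.In v (map f r) ->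
      exists2 l, List.In l r & v = f l.
    by elim: r => //= a r IH [<-|/IH[l lr ->]]; [exists a; [left|]|exists l; [right|]].
  have InP (r : seq nat) l : List.In l r -> l \in r.
    by elim: r => //= a r IH [->|/IH]; rewrite inE ?eqxx// => ->; rewrite orbT.
  have [qxN|qxN] := ltnP (q x).+1 N.
    congr cupm; rewrite f0 fn.
    rewrite -[iota 1 n]/(iota (1 + 0) n) iotaDl -map_comp; apply/eq_in_map => l.
    by rewrite mem_iota /= add1n => ln; rewrite kvertex_cyc// => y /txE ->.
  have qxE : (q x).+1 = N by apply/eqP; rewrite eqn_leq qxN (ltn_ord (q x)).
  have c0 : G (q, t) 0%N = 0.
    apply: (cst _ x sz0) => [v|v w]; rewrite f0 => /(InE _ _ _ _ _)[l /InP].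
      by rewrite mem_iota => /andP[l0 _] ->; rewrite /on_faces !ffunE tx l0 addn1 qxE eqxx orbT.
    rewrite mem_iota => /andP[l0 _] -> /(InE _ _ _ _ _)[m /InP].
    by rewrite mem_iota => /andP[m0 _] ->; rewrite !ffunE tx l0 m0.
  have vx0 l : (l < n)%N -> kvertex (cyc_base q t) (cyc_pos t) l x = 0%N.
    move=> ln; rewrite !ffunE tx /= permM permE /= tx add0n qxE modnn modn_small; lia.
  rewrite /G /= in c0; rewrite c0; symmetry; apply: (cst _ x szn) => [v|v w]; rewrite fn => /(InE _ _ _ _ _)[l /InP].
    by rewrite mem_iota => /andP[_ ln] ->; rewrite /on_faces vx0.
  rewrite mem_iota => /andP[_ ln] -> /(InE _ _ _ _ _)[m /InP].
  by rewrite mem_iota => /andP[_ mn] ->; rewrite !vx0.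
have n0 : (0 < n)%N by exact: leq_ltn_trans (ltn_ord i).
rewrite big_ord_recr /= -(big_mkord xpredT (fun j => \sum_p G p j)) /= big_ltn// outer.
rewrite addrAC addF2 add0r big_nat_cond big1// => j /andP[/andP[j0 jn] _].
by apply: inner; rewrite j0.
Qed.

Lemma ksumD c c' (i : 'I_n) :
  (forall k, k != i :> nat -> c k = c' k) -> 
  ksum c + ksum c' = ksum (fun k v => if k == i :> nat then c i v + c' i v else c k v).
Proof.
move=> cc'; rewrite -big_split /=; apply: eq_bigr => -[q t] _ /=.
have icat : iota 0 n = iota 0 i ++ (i : nat) :: iota i.+1 (n - i.+1).
  have {1}-> : iota 0 n = iota 0 (i + (n - i.+1).+1) by congr iota; have := ltn_ord i; lia.
  by rewrite iotaD.
rewrite icat !map_cat /= eqxx.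
have e1 : map c' (iota 0 i) = map c (iota 0 i).
  by apply/eq_in_map => k; rewrite mem_iota => kn; rewrite cc'//; lia.
have e2 : map c' (iota i.+1 (n - i.+1)) = map c (iota i.+1 (n - i.+1)).
  by apply/eq_in_map => k; rewrite mem_iota => kn; rewrite cc'//; lia.
rewrite e1 e2 -cupdD; last by rewrite size_map size_iota size_ksimplex /=.
congr (cupd (_ ++ _ :: _) _); apply/eq_in_map => k; rewrite mem_iota => kn.
  by apply/funext => v; rewrite ifN//; lia.
by apply/funext => v; rewrite ifN//; lia.
Qed.

End kuhn.

(** * Sign changes in a labelled grid *)

Section kuhn_lemma.
Variables (n N : nat).
Local Notation V := {ffun 'I_n -> nat}.
Variable a : 'I_n -> V -> bool.
Hypothesis a0 : forall i (v : V), v i = 0%N -> a i v = false.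
Hypothesis aN : forall i (v : V), v i = N.+1 -> a i v = true.

(** A homotopy changing one label at a time from the given labels ([m = 0]) to the standard labels
    [0 < v i] ([m = n]). Consecutive stages differ by a cochain that vanishes on the faces in its
    direction, so [ksum] stays the same. *)
Let c (m k : nat) (v : V) : 'F_2 :=
  (if insub k is Some i then if (k < m)%N then (0 < v i)%N else a i v else false)%:R.

Let cE m (i : 'I_n) v : c m i v = (if (i < m)%N then (0 < v i)%N else a i v)%:R.
Proof. by rewrite /c insubT //= => ?; rewrite (_ : Sub _ _ = i)//; exact: val_inj. Qed.

Let c_faces m (i : 'I_n) v : on_faces N.+1 i v -> c m i v = (v i != 0%N)%:R.
Proof.
rewrite cE => /orP[/eqP|/eqP] vi; rewrite vi /=; first by rewrite a0 ?if_same.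
by rewrite aN// if_same.
Qed.

Let ksum_c m : (m <= n)%N -> @ksum n N.+1 (c 0) = @ksum n N.+1 (c m).
Proof.
elim: m => // m IH mn; rewrite IH; last exact: ltnW.
apply/eqP; rewrite -subr_eq0 oppr_pchar2 ?pchar_Fp//.
pose i : 'I_n := Ordinal mn.
rewrite (@ksumD _ _ _ _ i); last first.
  move=> k ki; apply/funext => v; rewrite /c; case: insubP => // j _ _.
  by rewrite ltnS [in RHS]leq_eqVlt (_ : (k == m) = false)//; apply/negbTE.
apply/eqP; apply: (@ksum_eq0 _ _ _ i).
  move=> x v w fv vw; have fw : on_faces N.+1 x w by rewrite /on_faces -vw.
  by case: ifP => [/eqP/val_inj <-|_]; rewrite !c_faces// vw.
by move=> v fv; rewrite eqxx !c_faces// addF2.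
Qed.

Let std_factor (q : {ffun 'I_n -> 'I_N.+1}) (t : {perm 'I_n}) (i : 'I_n) :
  c n i (kvertex q t i) + c n i (kvertex q t i.+1) =
  ((q i == 0%N :> nat) && (t i == i))%:R.
Proof.
rewrite !cE ltn_ord !ffunE.
have -> : (t i == i) = (t i == i :> nat) by [].
case: (nat_of_ord (q i)) => [|k] /=; last by rewrite addF2.
rewrite !add0n ltnS leq_eqVlt; case: ltngtP => //=; rewrite ?addF2 ?addr0 ?add0r//.
Qed.

(** The i-th factor is nonzero only if step [i] raises coordinate [i] from 0. This singles out one
    simplex: the base at the origin with the identity order. *)
Let ksum_std : @ksum n N.+1 (c n) = 1.
Proof.
rewrite /ksum (bigD1 ([ffun=> ord0], 1%g)) //= [X in _ + X]big1 ?addr0.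
  rewrite cupd_map add0n big_mkord big1// => i _.
  by rewrite std_factor ffunE perm1 !eqxx.
move=> [q t] /= qt; rewrite cupd_map add0n big_mkord.
have [/forallP h|] := boolP [forall i, (q i == 0%N :> nat) && (t i == i)].
  case/eqP: qt; congr pair; first by apply/ffunP => i; rewrite ffunE; apply/val_inj/eqP; case/andP: (h i).
  by apply/permP => i; rewrite perm1; apply/eqP; case/andP: (h i).
rewrite negb_forall => /existsP[i hi].
by rewrite (bigD1 i)//= std_factor (negbTE hi) mul0r.
Qed.

(** Since [ksum] is 1, some simplex has a nonzero product; its i-th factor compares the i-th label
    at two consecutive vertices, both in the grid cell of [q]. *)
Lemma kuhn : exists q : {ffun 'I_n -> 'I_N.+1}, forall i : 'I_n,
  exists v w : V, [/\ forall x, (q x <= v x <= (q x).+1)%N,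
    forall x, (q x <= w x <= (q x).+1)%N & a i v != a i w].
Proof.
have : @ksum n N.+1 (c 0) != 0 by rewrite (ksum_c (leqnn n)) ksum_std oner_eq0.
move=> s0; have [[q t] qt0] : exists p : {ffun 'I_n -> 'I_N.+1} * {perm 'I_n},
    cupd (map (c 0) (iota 0 n)) (ksimplex p.1 p.2) != 0.
  apply/existsP; apply: contraNT s0 => /existsPn h.
  by rewrite /ksum big1// => p _; apply/eqP; have := h p; rewrite negbK.
exists q => i; exists (kvertex q t i), (kvertex q t i.+1); split.
- by move=> x; rewrite ffunE; case: (t x < i)%N; rewrite ?addn0 ?addn1 leqnn ?leqnSn.
- by move=> x; rewrite ffunE; case: (t x < i.+1)%N; rewrite ?addn0 ?addn1 leqnn ?leqnSn.
apply: contraNneq qt0 => e /=; rewrite cupd_map add0n big_mkord.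
by rewrite (bigD1 i)//= !cE /= e addF2 mul0r.
Qed.

End kuhn_lemma.

(** * Brouwer *)

Lemma eqW d (T : porderType d) (x y : T) : x = y -> (x <= y)%O.
Proof. by move=> ->. Qed.

Section rV_basics.
Context {R : realType} {n : nat}.
Implicit Types (x y z : 'rV[R]_n) (A K : set 'rV[R]_n).

Lemma rV_norm_leP x (M : R) : 0 <= M -> `|x| <= M <-> forall i, `|x 0 i| <= M.
Proof.
move=> M0; rewrite [`|x|]/Num.norm /= mx_normrE; split.
  by move/bigmax_leP => [_ h] i; exact: (h (0, i)).
by move=> h; apply/bigmax_leP; split => // -[i j] _ /=; rewrite ord1.
Qed.

Lemma rV_norm_ltP x (M : R) : 0 < M -> `|x| < M <-> forall i, `|x 0 i| < M.
Proof.
move=> M0; rewrite [`|x|]/Num.norm /= mx_normrE; split.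
  by move/bigmax_ltP => [_ h] i; exact: (h (0, i)).
by move=> h; apply/bigmax_ltP; split => // -[i j] _ /=; rewrite ord1.
Qed.

Lemma le_coord_norm x i : `|x 0 i| <= `|x|.
Proof. exact: (proj1 (rV_norm_leP x (normr_ge0 _))). Qed.

Lemma within_continuousP (V : normedModType R) A (f : 'rV[R]_n -> V) :
  {within A, continuous f} <-> forall x, A x -> forall e : R, 0 < e ->
    exists2 d : R, 0 < d & forall y, A y -> `|x - y| < d -> `|f x - f y| < e.
Proof.
split => [/subspace_continuousP fc x Ax e e0|h].
  have /cvgrPdist_lt /(_ e e0) := fc x Ax.
  rewrite near_withinE => /nbhs_ballP[d /= d0 hd]; exists d => // y Ay xy.
  by apply: hd => //; rewrite -ball_normE.
apply/subspace_continuousP => x Ax; apply/cvgrPdist_lt => e e0.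
have [d d0 hd] := h x Ax e e0.
rewrite near_withinE; apply/nbhs_ballP; exists d => // y.
by rewrite -ball_normE /= => xy Ay; exact: hd.
Qed.

(** Only one of the two points is confined to [K]. This is what a box around a point of [K] needs,
    since it may stick out of [K]. *)
Lemma compact_unif_continuous_near (V : normedModType R) K A (f : 'rV[R]_n -> V) :
  compact K -> K `<=` A -> {within A, continuous f} -> forall e : R, 0 < e ->
  exists2 d : R, 0 < d & forall x y, K x -> A y -> `|x - y| < d -> `|f x - f y| < e.
Proof.
move=> cK KA /within_continuousP fc e e0.
pose P (d : R) x := K x -> forall y, A y -> `|x - y| < d -> `|f x - f y| < e.
have /compact_near_coveringP ncK := cK.
have near0 : \forall d \near 0^'+, K `<=` P d.
  apply: (ncK _ (0^'+) P _).
  move=> x Kx; have [d d0 hd] := fc x (KA x Kx) _ (divr_gt0 e0 (ltr0n _ 2)).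
  have d20 : 0 < d / 2 by lra.
  exists (ball x (d/2), [set t : R | t < d / 2]) => /=.
    by split; [exact: nbhsx_ballx|exact: nbhs_right_lt].
  move=> [y t] /= []; rewrite -ball_normE /= => xy td Ky z Az yz.
  have xyd : `|x - y| < d by lra.
  have xzd : `|x - z| < d by have := ler_distD y x z; lra.
  have := ler_distD (f x) (f y) (f z); have := hd y (KA y Ky) xyd; have := hd z Az xzd.
  by rewrite (distrC (f y) (f x)); lra.
near (0 : R)^'+ => d; exists d; first by near: d; exact: nbhs_right_gt.
by move=> x y Kx Ky; apply: (near near0 d) => //; near: d.
Unshelve. all: by end_near. Qed.

Lemma compact_unif_continuous (V : normedModType R) K (f : 'rV[R]_n -> V) :
  compact K -> {within K, continuous f} -> forall e : R, 0 < e ->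
  exists2 d : R, 0 < d & forall x y, K x -> K y -> `|x - y| < d -> `|f x - f y| < e.
Proof. by move=> cK fc; exact: compact_unif_continuous_near. Qed.

Lemma cube_compact (a b : 'rV[R]_n) : compact [set x : 'rV[R]_n | forall i, x 0 i \in `[a 0 i, b 0 i]].
Proof.
by apply: (@rV_compact _ _ (fun i => `[a 0 i, b 0 i]%classic)) => i; exact: segment_compact.
Qed.

End rV_basics.

(* Brouwer's theorem in the form "a perturbation of the identity with bounded
   support is onto", by the discrete Poincare-Miranda lemma [kuhn]. *)
Lemma brouwer_surjective (R : realType) (n : nat) (F : 'rV[R]_n -> 'rV[R]_n) (M : R) :
  continuous F -> (forall x, M <= `|x| -> F x = x) -> forall z, exists x, F x = z.
Proof.
move=> cF FM z; apply: contrapT => /forallNP Fz.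
(* The cube of half-side [L] has [z] in its interior, and [F] is the identity on its boundary, which
   gives the labels their values on opposite faces. *)
pose L : R := 1 + `|M| + `|z|.
have L0 : 0 < L by rewrite /L; have := normr_ge0 z; have := normr_ge0 M; lra.
have ML : M <= L by rewrite /L; have := ler_norm M; have := normr_ge0 z; lra.
have zL : `|z| < L by rewrite /L; have := normr_ge0 M; lra.
pose C := [set x : 'rV[R]_n | forall i, x 0 i \in `[(- const_mx L : 'rV[R]_n) 0 i, (const_mx L : 'rV[R]_n) 0 i]].
have cC : compact C by exact: cube_compact.
have CE (x : 'rV[R]_n) : (forall i, - L <= x 0 i <= L) -> C x by move=> h i; rewrite inE /= !mxE; exact: h.
have C0 : C !=set0 by exists 0; apply: CE => i; rewrite mxE; lra.
have cG : {within C, continuous (fun x => `|F x - z|)}.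
  apply: continuous_subspaceT => x; apply: (@continuous_comp _ _ _ (fun x => F x - z)).
    by apply: continuousB; [exact: cF|exact: cst_continuous].
  exact: norm_continuous.
have [c cCc hc] := compact_EVT_min C0 cC cG.
pose d := `|F c - z|.
have d0 : 0 < d by rewrite normr_gt0 subr_eq0; apply/eqP.
have [r r0 hr] := compact_unif_continuous cC (continuous_subspaceT cF) d0.
have [N hN] : exists N : nat, 2 * L / N.+1%:R < r.
  exists (Num.truncn (2 * L / r)); rewrite ltr_pdivrMr// [r * _]mulrC -ltr_pdivrMr//.
  exact: truncnS_gt.
pose pt (v : {ffun 'I_n -> nat}) : 'rV[R]_n := \row_i (- L + 2 * L / N.+1%:R * (v i)%:R).
have NL : 2 * L / N.+1%:R * N.+1%:R = 2 * L by rewrite divfK.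
have ptC (v : {ffun 'I_n -> nat}) : (forall i, v i <= N.+1)%N -> C (pt v).
  move=> vN; apply: CE => i; rewrite mxE.
  have h0 : 0 <= 2 * L / N.+1%:R by rewrite divr_ge0// mulr_ge0// ltW.
  have := mulr_ge0 h0 (ler0n R (v i)).
  have : 2 * L / N.+1%:R * (v i)%:R <= 2 * L by rewrite -[leRHS]NL ler_wpM2l// ler_nat.
  by set y := _ * _ => ? ?; rewrite -lerBlDl -lerBrDl; lra.
pose a i (v : {ffun 'I_n -> nat}) := z 0 i <= F (pt v) 0 i.
have big (x : 'rV[R]_n) i : `|x 0 i| = L -> F x = x.
  by move=> xL; apply: FM; apply: le_trans (le_coord_norm x i); rewrite xL.
have aneg i (v : {ffun 'I_n -> nat}) : v i = 0%N -> a i v = false.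
  move=> vi; have pi : pt v 0 i = - L by rewrite mxE vi mulr0 addr0.
  rewrite /a (big _ i) ?pi ?normrN ?gtr0_norm//; apply/negbTE; rewrite -ltNge.
  by have := le_coord_norm z i; rewrite ler_norml; lra.
have apos i (v : {ffun 'I_n -> nat}) : v i = N.+1 -> a i v = true.
  move=> vi; have pi : pt v 0 i = L by rewrite mxE vi NL; lra.
  rewrite /a (big _ i) ?pi ?gtr0_norm//.
  by have := le_coord_norm z i; rewrite ler_norml; lra.
have [q hq] := kuhn aneg apos.
pose x := pt [ffun i => q i : nat].
have Cx : C x by apply: ptC => i; rewrite ffunE ltnW.
have near_x (v : {ffun 'I_n -> nat}) : (forall i, q i <= v i <= (q i).+1)%N -> `|F x - F (pt v)| < d.
  move=> hv; apply: hr => //.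
    by apply: ptC => i; case/andP: (hv i) => _ /leq_trans; apply.
  apply: le_lt_trans hN; rewrite rV_norm_leP ?divr_ge0 ?ltW ?mulr_gt0// => i.
  have subE s t : - L + s - (- L + t) = s - t by ring.
  rewrite /x !mxE ffunE subE -mulrBr normrM gtr0_norm ?divr_gt0 ?mulr_gt0//.
  rewrite ler_piMr ?divr_ge0 ?mulr_ge0 ?(ltW L0)//.
  have /andP[h1 h2] := hv i; rewrite distrC -natrB//.
  by rewrite normr_nat -[1]/(1%:R) ler_nat; lia.
(* In this grid cell every coordinate of [F - z] changes sign while [F] varies by less than [d] from
   [F x]; this contradicts [d] being the minimal distance from [z]. *)
have : `|F x - z| < d.
  rewrite rV_norm_ltP// => i; have [v [w [hv hw]]] := hq i.
  have := le_lt_trans (le_coord_norm _ i) (near_x _ hv).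
  have := le_lt_trans (le_coord_norm _ i) (near_x _ hw).
  rewrite !mxE !ltr_norml /a; case: (lerP (z 0 i)) => zv; case: (lerP (z 0 i)) => zw //= *; lra.
by rewrite ltNge (hc x)// inE.
Qed.

(** * Extension by the identity *)

Section topological_part.
Context {R : realType} {n : nat}.
Local Notation V := 'rV[R]_n.
Implicit Types (x y z w : V) (Om U : set V) (f g F : V -> V).

Definition extend_id Om f x : V := if pselect (Om x) then f x else x.

Lemma extend_id_in Om f x : Om x -> extend_id Om f x = f x.
Proof. by move=> Ox; rewrite /extend_id; case: pselect. Qed.

Lemma extend_id_out Om f x : ~ Om x -> extend_id Om f x = x.
Proof. by move=> Ox; rewrite /extend_id; case: pselect. Qed.

Lemma open_ballP U x : open U -> U x ->
  exists2 d : R, 0 < d & forall y, `|x - y| < d -> U y.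
Proof.
move=> oU Ux; have /nbhs_ballP[d /= d0 hd] := open_nbhs_nbhs (conj oU Ux).
by exists d => // y xy; apply: hd; rewrite -ball_normE.
Qed.

Lemma ball_openP U : (forall x, U x ->
  exists2 d : R, 0 < d & forall y, `|x - y| < d -> U y) -> open U.
Proof.
move=> h; rewrite openE => x /h[d d0 hd]; apply/nbhs_ballP; exists d => //= y.
by rewrite -ball_normE; exact: hd.
Qed.

Lemma continuous_normP f : (forall x (e : R), 0 < e ->
  exists2 d : R, 0 < d & forall y, `|x - y| < d -> `|f x - f y| < e) -> continuous f.
Proof.
move=> h x; apply/(@cvgrPdist_lt _ _ _ (nbhs x) _ f (f x)) => e e0; have [d d0 hd] := h x e e0.
by apply/nbhs_ballP; exists d => //= y; rewrite -ball_normE; exact: hd.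
Qed.

Lemma closureP Om x : closure Om x <->
  forall e : R, 0 < e -> exists2 y, Om y & `|x - y| < e.
Proof.
split => [clx e e0|h B /nbhs_ballP[e /= e0 he]].
  have [y [Oy xy]] := clx (ball x e) (nbhsx_ballx x e e0).
  by exists y => //; move: xy; rewrite -ball_normE.
have [y Oy xy] := h e e0; exists y; split => //; apply: he.
by rewrite -ball_normE.
Qed.

Lemma open_interior U : open U -> interior U = U.
Proof. by move=> oU; apply/interior_id. Qed.

(** As [U] is open and closed relative to [Om], the two pieces meet only on the boundary of [Om],
    where the extension of [f] agrees with the identity. The freedom in [U] is exploited in
    [image_homeo]. *)
Lemma extend_id_continuous Om U f : open U -> open (Om `\` U) -> U `<=` Om ->
  open Om -> {within Om, continuous f} -> identity_on_boundary Om f ->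
  continuous (extend_id U f).
Proof.
move=> oU oOU UO oO /within_continuousP fc [F [/within_continuousP Fc Ff Fid]].
have loc x U' h : open U' -> U' x -> (forall y, U' y -> extend_id U f y = h y) ->
  (forall e : R, 0 < e -> exists2 d : R, 0 < d & forall y, U' y -> `|x - y| < d -> `|h x - h y| < e) ->
  forall e : R, 0 < e -> exists2 d : R, 0 < d &
    forall y, `|x - y| < d -> `|extend_id U f x - extend_id U f y| < e.
  move=> oU' U'x hU' hc e e0; have [d d0 hd] := hc e e0.
  have [d' d'0 hd'] := open_ballP oU' U'x.
  exists (Num.min d d'); first by rewrite lt_min d0.
  move=> y; rewrite lt_min => /andP[xyd xyd']; rewrite !hU'//; last exact: hd'.
  by apply: hd => //; exact: hd'.
have idc (A : set V) x (e : R) : 0 < e ->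
    exists2 d : R, 0 < d & forall y, A y -> `|x - y| < d -> `|id x - id y| < e.
  by move=> e0; exists e.
apply: continuous_normP => x e e0.
have [Ux|nUx] := pselect (U x).
  apply: (loc x U f) => // [y|e' e'0]; first exact: extend_id_in.
  have [d d0 hd] := fc x (UO _ Ux) e' e'0.
  by exists d => // y Uy; apply: hd; exact: UO.
have [Ox|nOx] := pselect (Om x).
  apply: (loc x (Om `\` U) id) => // [y [_ nUy]|e' e'0]; first exact: extend_id_out.
  exact: idc.
have [clx|nclx] := pselect (closure Om x); last first.
  apply: (loc x (~` closure Om) id) => // [|y ncly|e' e'0].
  - by apply: closed_openC; exact: closed_closure.
  - by apply: extend_id_out => /UO/subset_closure.
  - exact: idc.
have Fx : F x = x by apply: Fid; rewrite inE; split => //; rewrite open_interior.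
have [d d0 hd] := Fc x clx e e0.
exists (Num.min d e); first by rewrite lt_min d0.
move=> y; rewrite lt_min (extend_id_out _ nUx) => /andP[xyd xye].
have [Uy|nUy] := pselect (U y); last by rewrite extend_id_out.
rewrite extend_id_in// -Ff ?inE; last exact: UO.
by rewrite -[x]Fx; apply: hd => //; apply: subset_closure; exact: UO.
Qed.

Lemma extend_id_surjective Om U f : bounded_set Om -> open U -> open (Om `\` U) ->
  U `<=` Om -> open Om -> {within Om, continuous f} -> identity_on_boundary Om f ->
  forall z, exists x, extend_id U f x = z.
Proof.
move=> [M [Mr bM]] oU oOU UO oO fc fid.
apply: (@brouwer_surjective _ _ _ (M + 2)); first exact: (extend_id_continuous oU oOU UO oO fc fid).
move=> x xM; apply: extend_id_out => /UO/(bM (M + 1)) /=; rewrite ltrDl ltr01 => /(_ erefl).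
by move=> h; have := le_trans xM h; lra.
Qed.

(** * The image of the homeomorphism and the boundary values of its inverse *)

Section homeo.
Variables (Om : set V) (f g : V -> V).
Hypotheses (bO : bounded_set Om) (oO : open Om).
Hypothesis fg : homeomorphism_with_inverse Om f g.
Hypothesis fid : identity_on_boundary Om f.

(** Otherwise [f x] is a boundary point, fixed by the extension of [f]. Points [v] of [Om] near
    [f x] then have [f v] near [f x], and applying [g] puts [v] near [x], although [x] differs from
    [f x]. *)
Lemma image_closure x : Om x -> closure Om (f x) -> Om (f x).
Proof.
case: fg => fgK fc gc Ox clfx; apply: contrapT => nOfx.
have [F [/within_continuousP Fc Ff Fid]] := fid.
have Ffx : F (f x) = f x by apply: Fid; rewrite inE; split => //; rewrite open_interior.
have xfx : 0 < `|x - f x|.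
  by rewrite normr_gt0 subr_eq0; apply/eqP => xfx; apply: nOfx; rewrite -xfx.
pose e : R := `|x - f x| / 2; have e0 : 0 < e by rewrite divr_gt0.
have [d d0 hd] := proj1 (within_continuousP _ _) gc (f x) (ex_intro2 _ _ x Ox erefl) e e0.
have [d' d'0 hd'] := Fc _ clfx d d0.
have m0 : 0 < Num.min d' e by rewrite lt_min d'0.
have [v Ov] := proj1 (closureP _ _) clfx _ m0; rewrite lt_min => /andP[vd' ve].
have := hd (f v) (ex_intro2 _ _ v Ov erefl).
have := hd' v (subset_closure Ov) vd'; rewrite Ffx Ff ?inE// => h /(_ h).
rewrite !fgK ?inE// => xv.
have := ler_distD v x (f x); rewrite (distrC v); move: xv ve; rewrite /e; lra.
Qed.

(** Let [U] be the set of points that [f] sends out of [Om]; by [image_closure] it is relatively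
    closed as well as open. Extending [f] from [U] by the identity gives a surjection, yet a point
    [x] of [U] has no preimage: [f] maps [U] outside [Om], and points off [U] are fixed. So [U] is
    empty. Surjectivity with [U = Om] gives the other inclusion. *)
Lemma image_homeo : f @` Om = Om.
Proof.
have [fgK fc gc] := fg.
have fcx x : Om x -> forall e : R, 0 < e -> exists2 d : R, 0 < d &
    forall y, `|x - y| < d -> Om y /\ `|f x - f y| < e.
  move=> Ox e e0; have [d d0 hd] := proj1 (within_continuousP _ _) fc x Ox e e0.
  have [d' d'0 hd'] := open_ballP oO Ox.
  exists (Num.min d d'); first by rewrite lt_min d0.
  by move=> y; rewrite lt_min => /andP[xyd /hd' Oy]; split => //; exact: hd.
pose U := [set x | Om x /\ ~ Om (f x)].
have oOU : Om `\` U = [set x | Om x /\ Om (f x)].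
  apply/seteqP; split => x /= [Ox h]; split => //; last by case.
  by apply: contrapT => nOfx; apply: h.
have oU : open U.
  apply: ball_openP => x [Ox nOfx].
  have nclfx : ~ closure Om (f x) by move=> /(image_closure Ox).
  have [d d0 hd] := open_ballP (closed_openC (@closed_closure _ Om)) nclfx.
  have [d' d'0 hd'] := fcx x Ox d d0.
  exists d' => // y /hd'[Oy /hd ncly]; split => // /subset_closure; exact: ncly.
have oO' : open (Om `\` U).
  rewrite oOU; apply: ball_openP => x [Ox Ofx].
  have [d d0 hd] := open_ballP oO Ofx.
  have [d' d'0 hd'] := fcx x Ox d d0.
  by exists d' => // y /hd'[Oy /hd].
have U0 x : Om x -> Om (f x).
  move=> Ox; apply: contrapT => nOfx.
  have UO : U `<=` Om by move=> ? [].
  have [y] := extend_id_surjective bO oU oO' UO oO fc fid x.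
  have [[Oy nOfy]|nUy] := pselect (U y).
    by rewrite extend_id_in// => yx; apply: nOfy; rewrite yx.
  by rewrite extend_id_out// => yx; apply: nUy; rewrite yx.
apply/seteqP; split => [_ [x Ox <-]|z Oz]; first exact: U0.
have oOO : open (Om `\` Om) by rewrite setDv; exact: open0.
have [y] := extend_id_surjective bO oO oOO (@subset_refl _ Om) oO fc fid z.
have [Oy|nOy] := pselect (Om y); first by rewrite extend_id_in// => <-; exists y.
by rewrite extend_id_out// => yz; case: nOy; rewrite yz.
Qed.

Lemma homeomorphism_inverse : homeomorphism_with_inverse Om g f.
Proof.
have [fgK fc gc] := fg; rewrite image_homeo in gc.
have gE : g @` Om = Om.
  apply/seteqP; split => [_ [y Oy <-]|x Ox]; last first.
    by exists (f x); [rewrite -image_homeo; exists x|rewrite fgK ?inE].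
  by move: Oy; rewrite -{1}image_homeo => -[x Ox <-]; rewrite fgK ?inE.
split => //; last by rewrite gE.
by move=> y; rewrite inE -{1}image_homeo => -[x Ox <-]; rewrite fgK ?inE.
Qed.

(** The delicate point is continuity of the extended [g] at a boundary point [y]. On the compact set
    of points of the closure at distance at least [e] from [y], the extension [F] of [f] avoids [y]:
    it maps [Om] into [Om] and fixes the boundary. Hence it stays at positive distance from [y], and
    [g z] cannot lie there when [z] is near [y]. *)
Lemma identity_on_boundary_inverse : identity_on_boundary Om g.
Proof.
have [fgK fc gc] := fg; have [gfK _ _] := homeomorphism_inverse; have imf := image_homeo.
rewrite imf in gc.
have [F [Fc Ff Fid]] := fid; have Fc' := proj1 (within_continuousP _ _) Fc.
have gO w : Om w -> Om (g w).
  by rewrite -{1}imf => -[x Ox <-]; rewrite fgK ?inE.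
have cO : compact (closure Om).
  apply: bounded_closed_compact; last exact: closed_closure.
  have [M [Mr bM]] := bO; exists M; split => // M' /bM h y cly /=.
  apply/ler_addgt0Pr => e e0; have [z Oz yz] := proj1 (closureP _ _) cly e e0.
  by have := ler_distD z y 0; rewrite !subr0; have /= := h z Oz; lra.
exists (extend_id Om g); split; last 2 first.
- by move=> x; rewrite inE => Ox; rewrite extend_id_in.
- by move=> x; rewrite inE => -[_ nOx]; rewrite extend_id_out//; rewrite open_interior in nOx.
apply/within_continuousP => y cly e e0.
have [Oy|nOy] := pselect (Om y).
  have [d d0 hd] := proj1 (within_continuousP _ _) gc y Oy e e0.
  have [d' d'0 hd'] := open_ballP oO Oy.
  exists (Num.min d d'); first by rewrite lt_min d0.
  move=> z clz; rewrite lt_min => /andP[yzd /hd' Oz].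
  by rewrite !extend_id_in//; exact: hd.
rewrite extend_id_out//.
pose K := closure Om `&` [set x | e <= `|y - x|].
have cK : compact K.
  apply: compact_closedI => //.
  rewrite (_ : [set _ | _] = (fun x => `|y - x|) @^-1` [set t | e <= t])//.
  apply: closed_comp => [x _|]; last exact: closed_ge.
  apply: (@continuous_comp _ _ _ (fun x => y - x)); last exact: norm_continuous.
  by apply: continuousB; [exact: cst_continuous|move=> ?; exact: cvg_id].
have KO w : Om w -> (K (g w) -> False) -> `|y - g w| < e.
  move=> Ow nK; rewrite ltNge; apply/negP => h; apply: nK; split => //.
  by apply: subset_closure; exact: gO.
have [K0|/set0P K0] := eqVneq K set0.
  exists e => // z clz yze; have [Oz|nOz] := pselect (Om z); last by rewrite extend_id_out.
  by rewrite extend_id_in//; apply: KO => //; rewrite K0.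
have cFK : {within K, continuous (fun x => `|F x - y|)}.
  apply: continuous_subspaceW (_ : K `<=` closure Om) _; first by move=> ? [].
  move=> x; apply: (@continuous_comp _ _ _ (F : subspace (closure Om) -> V) (fun z => `|z - y|)).
    exact: Fc.
  apply: (@continuous_comp _ _ _ (fun z => z - y)); last exact: norm_continuous.
  by apply: continuousB; [move=> ?; exact: cvg_id|exact: cst_continuous].
have [c cK' hc] := compact_EVT_min K0 cK cFK.
have d0 : 0 < `|F c - y|.
  rewrite normr_gt0 subr_eq0; apply/eqP => Fcy.
  move: cK'; rewrite inE => -[clc /= ec].
  have [Oc|nOc] := pselect (Om c).
    by apply: nOy; rewrite -Fcy Ff ?inE// -imf; exists c.
  move: ec; rewrite -Fcy Fid ?inE; last by split => //; rewrite open_interior.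
  by rewrite subrr normr0; lra.
exists (Num.min e `|F c - y|); first by rewrite lt_min e0.
move=> z clz; rewrite lt_min => /andP[yze yzd].
have [Oz|nOz] := pselect (Om z); last by rewrite extend_id_out.
rewrite extend_id_in//; apply: KO => // Kgz.
have := hc (g z); rewrite inE => /(_ Kgz); rewrite (Ff (g z)); last by rewrite inE; exact: gO.
by rewrite gfK ?inE// (distrC z); lra.
Qed.

End homeo.
End topological_part.

(** * Lebesgue outer measure *)

Section volume.
Context {R : realType} {n : nat}.
Local Notation V := 'rV[R]_n.
Implicit Types (A B E U K : set V) (x y : V).

(* [lebesgue R n] seen as an outer measure defined on all subsets. *)
Definition vol A : \bar R := lebesgue R n A.

Lemma volE A : vol A = mu_ext (@lebesgue_rV R n) A.
Proof. by []. Qed.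

Lemma vol_ge0 A : (0 <= vol A)%E.
Proof. exact: mu_ext_ge0. Qed.

Lemma le_vol A B : A `<=` B -> (vol A <= vol B)%E.
Proof. exact: le_mu_ext. Qed.

Lemma vol0 : vol set0 = 0%E.
Proof. by apply: mu_ext0 => //; exact: measure0. Qed.

Lemma volU2 A B : (vol (A `|` B) <= vol A + vol B)%E.
Proof. exact: (outer_measureU2 (mu_ext (@lebesgue_rV R n))). Qed.

Lemma vol_bigcup (F : (set V)^nat) :
  (vol (\bigcup_k F k) <= \sum_(0 <= k <oo) vol (F k))%E.
Proof. exact: mu_ext_sigma_subadditive. Qed.

Lemma vol_bigsetU (I : Type) (s : seq I) (P : pred I) (F : I -> set V) :
  (vol (\big[setU/set0]_(i <- s | P i) F i) <= \sum_(i <- s | P i) vol (F i))%E.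
Proof.
elim/big_ind2 : _ => //; first by rewrite vol0.
by move=> A a B b Aa Bb; apply: le_trans (volU2 _ _) _; exact: leeD.
Qed.

Lemma borel_lebesgue_measurable A : measurable A -> lebesgue_measurable A.
Proof. by move=> mA; apply: sub_caratheodory; exact: sub_sigma_algebra. Qed.

Lemma vol_borel A : measurable A -> vol A = @lebesgue_rV R n A.
Proof. exact: measurable_mu_extE. Qed.

Lemma measurable_boxX (I : 'I_n -> set R) : (forall i, measurable (I i)) ->
  measurable [set x : V | forall i, I i (x 0 i)].
Proof.
move=> mI; rewrite (_ : [set x | _] = \bigcap_(i in [set: 'I_n])
     ((fun x : V => x 0 i) @^-1` I i)); last first.
  by apply/seteqP; split => [x/= h i _|x/= h i]; [exact: h|exact: (h i Logic.I)].
apply: fin_bigcap_measurable; first exact: finite_finset.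
by move=> i _; rewrite -[X in measurable X]setTI; exact: measurable_rV_coord.
Qed.

Lemma open_borel U : open U -> measurable U.
Proof.
move=> oU.
pose bx (p : {ffun 'I_n -> rat * rat}) : set V :=
  [set x | forall i, `]ratr (p i).1, ratr (p i).2[%classic (x 0 i)].
have mbx p : measurable (bx p).
  by apply: (@measurable_boxX (fun i => `]ratr (p i).1, ratr (p i).2[%classic)).
rewrite (_ : U = \bigcup_p (if pselect (bx p `<=` U) then bx p else set0)); last first.
  apply/seteqP; split => [x Ux|x [p _]]; last by case: pselect => // h /h.
  have [d d0 hd] := open_ballP oU Ux.
  have hl i : exists q : rat, ratr q \in `]x 0 i - d, x 0 i[ by apply: rat_in_itvoo; lra.
  have hr i : exists q : rat, ratr q \in `]x 0 i, x 0 i + d[ by apply: rat_in_itvoo; lra.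
  pose p := [ffun i => (xget 0 [set q : rat | ratr q \in `]x 0 i - d, x 0 i[], 
                        xget 0 [set q : rat | ratr q \in `]x 0 i, x 0 i + d[])].
  have pl i : (ratr (p i).1 : R) \in `]x 0 i - d, x 0 i[.
    by rewrite ffunE /=; case: xgetP => [q _ //|nq]; have [q /nq] := hl i.
  have pr i : (ratr (p i).2 : R) \in `]x 0 i, x 0 i + d[.
    by rewrite ffunE /=; case: xgetP => [q _ //|nq]; have [q /nq] := hr i.
  have pU : bx p `<=` U.
    move=> y bxy; apply: hd; rewrite rV_norm_ltP// => i; rewrite !mxE.
    have := bxy i; rewrite /= in_itv /=; have := pl i; have := pr i; rewrite !in_itv /= ltr_norml.
    by move=> *; lra.
  exists p => //; case: pselect => // _ i.
  by rewrite /= in_itv /=; have := pl i; have := pr i; rewrite !in_itv /=; lra.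
apply: countable_bigcupT_measurable; first exact: countableP.
by move=> p; case: (pselect _) => _ /=; [exact: mbx|exact: measurable0].
Qed.

Lemma closed_borel A : closed A -> measurable A.
Proof. by move=> cA; rewrite -[A]setCK; apply: measurableC; apply: open_borel; exact: closed_openC. Qed.

Lemma compact_closed_rV K : compact K -> closed K.
Proof. by apply: compact_closed; exact: norm_hausdorff. Qed.

Lemma compact_borel K : compact K -> measurable K.
Proof. by move=> /compact_closed_rV; exact: closed_borel. Qed.

End volume.

Lemma lebesgue_rV_setX (R : realType) (n : nat) (I : 'I_n -> set R) : (forall i, measurable (I i)) ->
  @lebesgue_rV R n [set x : 'rV[R]_n | forall i, I i (x 0 i)] = (\prod_(i < n) lebesgue_measure (I i))%E.
Proof.
elim: n I => [|n IH] I mI.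
  by rewrite big_ord0 /= diracE mem_set//=; case.
rewrite big_ord_recl /=.
pose I' j := I (lift ord0 j).
transitivity ((lebesgue_measure \x @lebesgue_rV R n)%E
    (I ord0 `*` [set x : 'rV[R]_n | forall i, I' i (x 0 i)])).
  rewrite /lebesgue_rVS /pushforward; congr (_ _).
  apply/seteqP; split => [[u x]/= h|[u x]/= [h0 h] i].
    split; first by have := h ord0; rewrite mxE unlift_none.
    by move=> j; have := h (lift ord0 j); rewrite !mxE liftK.
  by rewrite mxE; case: unliftP => [j|] -> //=; exact: h.
rewrite product_measure1E; [|exact: mI|by apply: measurable_boxX => i; exact: mI].
by rewrite IH// => i; exact: mI.
Qed.

Section volume2.
Context {R : realType} {n : nat}.
Local Notation V := 'rV[R]_n.
Implicit Types (A B E U K : set V) (x y : V).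

(** Half-open, so that the cells of a grid are pairwise disjoint. *)
Definition cell (a b : V) : set V := [set x | forall i, x 0 i \in `[a 0 i, b 0 i[].

Lemma cell_borel (a b : V) : measurable (cell a b).
Proof. by apply: (@measurable_boxX _ _ (fun i => `[a 0 i, b 0 i[%classic)). Qed.

Lemma vol_cell (a b : V) : (forall i, a 0 i <= b 0 i)%R ->
  vol (cell a b) = (\prod_(i < n) (b 0 i - a 0 i))%:E.
Proof.
move=> ab; rewrite vol_borel; last exact: cell_borel.
rewrite (@lebesgue_rV_setX _ _ (fun i => `[a 0 i, b 0 i[%classic))// -prodEFin.
apply: eq_bigr => i _; rewrite lebesgue_measure_itv/= lte_fin.
case: ifPn => //; rewrite -leNgt => ba.
by rewrite (le_anti (introT andP (conj ba (ab i)))) subrr.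
Qed.

Lemma vol_box (a b : V) : (forall i, a 0 i <= b 0 i)%R ->
  vol [set x : V | forall i, x 0 i \in `[a 0 i, b 0 i]] = (\prod_(i < n) (b 0 i - a 0 i))%:E.
Proof.
move=> ab; rewrite vol_borel ?lebesgue_rV_box//.
by apply: (@measurable_boxX _ _ (fun i => `[a 0 i, b 0 i]%classic)).
Qed.

Lemma vol_bigcap_lt (T : (set V)^nat) (e : R) : (forall N, lebesgue_measurable (T N)) ->
  (vol (T 0%N) < +oo)%E -> (forall k l, (k <= l)%N -> T l `<=` T k) ->
  (vol (\bigcap_N T N) < e%:E)%E -> exists N, (vol (T N) < e%:E)%E.
Proof.
move=> mT T0oo dT Te.
have mTI : lebesgue_measurable (\bigcap_N T N) by exact: bigcapT_measurable.
have fT A : (vol A < +oo)%E -> vol A = (fine (vol A))%:E.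
  by move=> Aoo; rewrite fineK// ge0_fin_numE// vol_ge0.
have cvT : (lebesgue R n \o T) x @[x --> \oo] --> lebesgue R n (\bigcap_N T N).
  apply: nonincreasing_cvg_mu => // k l kl; apply/subsetPset; exact: dT.
have TIoo := lt_trans Te (ltry e).
have TNoo N : (vol (T N) < +oo)%E by apply: le_lt_trans T0oo; apply: le_vol; exact: dT.
move: cvT; rewrite -/(vol _) (fT _ TIoo) => /fine_cvgP[_ /cvgrPdist_lt].
have d0 : 0 < e - fine (vol (\bigcap_N T N)) by rewrite subr_gt0 -lte_fin -(fT _ TIoo).
move=> /(_ _ d0)[N _ /(_ N (leqnn N))] /= hN; exists N.
rewrite (fT _ (TNoo N)) lte_fin; move: hN; rewrite -/(vol _) ltr_norml; lra.
Qed.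

Definition nearly_regular (Q : set V) A := measurable A /\ forall e : R, (0 < e)%R ->
  exists C U, [/\ closed C, open U, C `<=` A, A `<=` U & (vol ((U `\` C) `&` Q) <= e%:E)%E].

(** Approximating from both sides at once makes the property stable under complements, so the sets
    having it form a sigma-algebra. On generators it is checked by shrinking an open interval of one
    coordinate. *)
Lemma borel_regular Q A : closed Q -> (vol Q < +oo)%E -> measurable A -> nearly_regular Q A.
Proof.
move=> cQ Qoo; move: A.
have mQ : measurable Q by exact: closed_borel.
have sigG : sigma_algebra setT (nearly_regular Q).
  split.
  - split=> // e e0; exists set0, set0; split => //; try exact: open0; first exact: closed0.
    by rewrite setD0 set0I vol0 lee_fin ltW.
  - move=> A [mA hA]; rewrite setTD; split => [|e e0]; first exact: measurableC.
    have [C [U [cC oU CA AU CU]]] := hA e e0; exists (~` U), (~` C); split.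
    + exact: open_closedC.
    + exact: closed_openC.
    + exact: subsetC.
    + exact: subsetC.
    + by rewrite (_ : ~` C `\` ~` U = U `\` C)// setDE setCK setIC -setDE.
  - move=> F hF; split => [|e e0]; first by apply: bigcupT_measurable => k; case: (hF k).
    have e2 : (0 < e / 2)%R by rewrite divr_gt0.
    have h k : exists CU : set V * set V, [/\ closed CU.1, open CU.2, CU.1 `<=` F k, F k `<=` CU.2 &
        (vol ((CU.2 `\` CU.1) `&` Q) <= (e / 2 / (2 ^ k.+1)%:R)%:E)%E].
      have [|C [U hCU]] := (hF k).2 (e / 2 / (2 ^ k.+1)%:R); first by rewrite divr_gt0// ltr0n expn_gt0.
      by exists (C, U).
    have [CU hCU] := choice h.
    pose C k := (CU k).1; pose U k := (CU k).2.
    have mC k : measurable (C k) by apply: closed_borel; case: (hCU k).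
    have mU k : measurable (U k) by apply: open_borel; case: (hCU k).
    pose D := \bigcup_k U k.
    have mD : measurable D by exact: bigcupT_measurable.
    (* Only finite unions of the closed sets are again closed; the error of truncating the union is
       controlled by continuity from above inside [Q], of finite measure. *)
    pose T N := (D `\` \big[setU/set0]_(k < N) C k) `&` Q.
    have mT N : measurable (T N).
      by apply: measurableI => //; apply: measurableD => //; apply: bigsetU_measurable.
    have TI : \bigcap_N T N `<=` \bigcup_k ((U k `\` C k) `&` Q).
      move=> x hx; have [[[k _ Ukx] _] Qx] := hx 0%N Logic.I; exists k => //; split => //; split => // Ckx.
      have [[_ +] _] := hx k.+1 Logic.I; apply; rewrite big_ord_recr /=; by right.
    have volT : (vol (\bigcap_N T N) <= (e / 2)%:E)%E.
      apply: le_trans (le_vol TI) _; apply: le_trans (vol_bigcup _) _.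
      apply: le_trans (@lee_nneseries _ _ (fun k => (e / 2 / (2 ^ k.+1)%:R)%:E) xpredT 0%N _ _) _.
      - by move=> k _ _; exact: vol_ge0.
      - by move=> k _; case: (hCU k).
      have eps := @epsilon_trick R (fun=> 0%E) (e/2) xpredT (fun=> lexx 0%E) (ltW e2).
      apply: le_trans (le_trans _ eps) _; last by rewrite [X in (X + _ <= _)%E]eseries0 ?add0e.
      apply: lee_nneseries => [k _ _|k _]; first by rewrite lee_fin divr_ge0// ltW.
      by rewrite add0e.
    have mTI : measurable (\bigcap_N T N) by exact: bigcapT_measurable.
    have [N hN] : exists N, (vol (T N) < e%:E)%E.
      apply: vol_bigcap_lt.
      - by move=> N; exact: borel_lebesgue_measurable.
      - apply: le_lt_trans Qoo; apply: le_vol; exact: subIsetr.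
      - move=> i j ij x [[Dx nC] Qx]; split => //; split => // CN; apply: nC.
        by apply: subset_bigsetU CN.
      - by apply: le_lt_trans volT _; rewrite lte_fin; lra.
    exists (\big[setU/set0]_(k < N) C k), D; split; [|by apply: bigcup_open => k _; case: (hCU k)| | |exact: ltW].
    + by apply: closed_bigsetU => k _; case: (hCU k).
    + rewrite -bigcup_mkord => x [k _ Ckx]; exists k => //; by case: (hCU k) => _ _ + _ _; apply.
    + by move=> x [k _ Fx]; exists k => //; case: (hCU k) => _ _ _ + _; apply.
rewrite [measurable]/(@rV_measurable R n) => A mA.
apply: (smallest_sub sigG) mA => {A} _ [i [A [mA ->]]].
pose cyl := fun B : set R => nearly_regular Q ((fun x : V => x 0 i) @^-1` B).
have sigcyl : sigma_algebra setT cyl.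
  case: sigG => s0 sC sU; split => [|B cB|F cF].
  - by rewrite /cyl preimage_set0.
  - by rewrite /cyl setTD preimage_setC -setTD; exact: sC.
  - by rewrite /cyl preimage_bigcup; exact: sU.
suff : @measurable_realfun.RGenOpens.G R `<=` cyl.
  have : (@measurable_realfun.RGenOpens.G R).-sigma.-measurable A.
    by rewrite -measurable_realfun.RGenOpens.measurableE.
  by move=> mA' h; exact: (smallest_sub sigcyl h mA').
move=> _ [a [b ->]].
pose U : set V := (fun x : V => x 0 i) @^-1` `]a, b[%classic.
have oU : open U by apply: open_comp => [x _|]; [exact: coord_continuous|exact: interval_open].
split => [|e e0]; first exact: open_borel.
pose C k : set V := (fun x : V => x 0 i) @^-1` `[a + k.+1%:R^-1, b - k.+1%:R^-1]%classic.
pose T k := (U `\` C k) `&` Q.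
have cC k : closed (C k).
  by apply: closed_comp => [x _|]; [exact: coord_continuous|exact: interval_closed].
have mT k : measurable (T k).
  apply: measurableI => //; apply: measurableD; [exact: open_borel|exact: closed_borel].
have kinv (d : R) : (0 < d)%R -> exists k : nat, (k.+1%:R^-1 <= d)%R.
  move=> d0; exists (Num.truncn d^-1); rewrite invf_ple ?posrE ?ltr0n//; exact/ltW/truncnS_gt.
have T0 : \bigcap_k T k = set0.
  apply/seteqP; split => // x hx; have [[+ _] _] := hx 0%N Logic.I.
  rewrite /U /= in_itv /= => /andP[ax xb].
  have [k hk] := kinv (x 0 i - a)%R ltac:(lra).
  have [l hl] := kinv (b - x 0 i)%R ltac:(lra).
  have [[_ +] _] := hx (maxn k l) Logic.I; apply; rewrite /C /= in_itv /=.
  have h1 : ((maxn k l).+1%:R^-1 <= k.+1%:R^-1 :> R)%R.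
    by rewrite lef_pV2 ?posrE// ler_nat ltnS leq_maxl.
  have h2 : ((maxn k l).+1%:R^-1 <= l.+1%:R^-1 :> R)%R.
    by rewrite lef_pV2 ?posrE// ler_nat ltnS leq_maxr.
  apply/andP; split; first by rewrite -lerBrDl; exact: le_trans h1 hk.
  by rewrite lerBrDr -lerBrDl; exact: le_trans h2 hl.
have [N hN] : exists N, (vol (T N) < e%:E)%E.
  apply: vol_bigcap_lt; last by rewrite T0 vol0 lte_fin.
  - by move=> N; exact: borel_lebesgue_measurable.
  - apply: le_lt_trans Qoo; apply: le_vol; exact: subIsetr.
  - move=> k l kl x [[Dx nC] Qx]; split => //; split => // h; apply: nC.
    move: h; rewrite /C /= !in_itv /=.
    have : (l.+1%:R^-1 <= k.+1%:R^-1 :> R)%R by rewrite lef_pV2 ?posrE// ler_nat ltnS.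
    move=> kl' /andP[h1 h2]; apply/andP; split; first by apply: le_trans h1; rewrite lerD2l.
    by apply: le_trans h2 _; rewrite lerD2l lerN2.
exists (C N), U; split => //; last exact: ltW.
move=> x; rewrite /C /= !in_itv /=; have : (0 < N.+1%:R^-1 :> R)%R by rewrite invr_gt0.
move=> N0 /andP[h1 h2]; apply/andP; split; first by apply: lt_le_trans h1; rewrite ltrDl.
by apply: le_lt_trans h2 _; rewrite ltrBlDr ltrDl.
Qed.

Definition cube (M : R) : set V :=
  [set x | forall i, x 0 i \in `[(- const_mx M : V) 0 i, (const_mx M : V) 0 i]].

Definition thicken A (r : R) : set V := [set x | exists2 y, A y & `|x - y| < r].

Lemma bounded_sub A B : bounded_set B -> A `<=` B -> bounded_set A.
Proof. by move=> [M [Mr hM]] AB; exists M; split=> // M' MM' x /AB; exact: hM. Qed.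

Lemma open_lebesgue U : open U -> lebesgue_measurable U.
Proof. by move=> oU; apply: borel_lebesgue_measurable; exact: open_borel. Qed.

Lemma compact_lebesgue K : compact K -> lebesgue_measurable K.
Proof. by move=> cK; apply: borel_lebesgue_measurable; exact: compact_borel. Qed.

Lemma bounded_cube A : bounded_set A -> exists2 M : R, 0 < M & A `<=` cube M.
Proof.
move=> [M [Mr hM]]; exists (`|M| + 1); first by have := normr_ge0 M; lra.
move=> x Ax i; rewrite !mxE in_itv /= -ler_norml; apply: le_trans (le_coord_norm _ _) _.
by apply: (hM (`|M| + 1)) => //; have := ler_norm M; lra.
Qed.

Lemma vol_cube (M : R) : 0 < M -> (vol (cube M) < +oo)%E.
Proof. by move=> M0; rewrite /cube vol_box ?ltry// => i; rewrite !mxE; lra. Qed.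

Lemma bounded_vol A : bounded_set A -> (vol A < +oo)%E.
Proof. by move=> /bounded_cube[M M0 /le_vol h]; apply: le_lt_trans h _; exact: vol_cube. Qed.

Lemma vol_fine A : (vol A < +oo)%E -> vol A = (fine (vol A))%:E.
Proof. by move=> Aoo; rewrite fineK// ge0_fin_numE// vol_ge0. Qed.

Lemma vol_setID A B : lebesgue_measurable A -> lebesgue_measurable B ->
  vol B = (vol (B `&` A) + vol (B `\` A))%E.
Proof. by move=> mA mB; rewrite addeC; exact: measureDI. Qed.

(** The definition of the outer measure provides a Borel cover of the complement of [E] in a cube,
    with little excess. Its complement in the cube is a Borel subset of [E], to which
    [borel_regular] applies. *)
Lemma lebesgue_inner_regular E : lebesgue_measurable E -> bounded_set E ->
  forall e : R, 0 < e -> exists K, [/\ compact K, K `<=` E & (vol (E `\` K) <= e%:E)%E].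
Proof.
move=> mE bE e e0; have [M M0 EQ] := bounded_cube bE.
pose Q := cube M; have cQ : compact Q by exact: cube_compact.
have Qoo : (vol Q < +oo)%E by exact: vol_cube.
have clQ : closed Q by exact: compact_closed_rV.
have mQ : measurable Q by exact: closed_borel.
have e2 : 0 < e / 2 by rewrite divr_gt0.
pose D := Q `\` E.
have mD : lebesgue_measurable D.
  by apply: measurableD => //; exact: borel_lebesgue_measurable.
have Doo : (vol D < +oo)%E by apply: le_lt_trans Qoo; apply: le_vol => x [].
have [G [mG DG GD]] : exists G, [/\ measurable G, D `<=` G & (vol G <= vol D + (e / 2)%:E)%E].
  have /(lb_ereal_inf_adherent e2) : mu_ext (@lebesgue_rV R n) D \is a fin_num.
    by rewrite ge0_fin_numE// -volE vol_ge0.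
  move=> [_ [F [mF DF] <-]] hF; exists (\bigcup_k F k); split => //.
    exact: bigcupT_measurable.
  apply: le_trans (ltW hF); apply: le_trans (vol_bigcup _) _.
  by apply: lee_nneseries => [k _ _|k _]; [exact: vol_ge0|rewrite vol_borel].
pose E' := Q `\` G; have mE' : measurable E' by exact: measurableD.
have E'E : E' `<=` E by move=> x [Qx nGx]; apply: contrapT => nEx; apply: nGx; apply: DG.
have EE' : (vol (E `\` E') <= (e / 2)%:E)%E.
  apply: (@le_trans _ _ (vol (G `\` D))).
    apply: le_vol => x [Ex nE'x]; split; last by case.
    by apply: contrapT => nGx; apply: nE'x; split => //; exact: EQ.
  have := vol_setID mD (borel_lebesgue_measurable mG).
  rewrite setIidr// => GE; move: GD; rewrite GE leeD2lE//.
  by rewrite ge0_fin_numE// vol_ge0.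
have [C [U [cC oU CE' E'U UC]]] := (borel_regular clQ Qoo mE').2 _ e2.
exists (C `&` Q); split.
- by rewrite setIC; exact: compact_closedI.
- by move=> x [/CE'/E'E].
apply: (@le_trans _ _ (vol (E `\` E') + vol ((U `\` C) `&` Q))%E).
  apply: le_trans (volU2 _ _); apply: le_vol => x [Ex nCQx].
  have [E'x|nE'x] := pselect (E' x); last by left.
  right; split; last exact: EQ.
  by split; [exact: E'U|move=> Cx; apply: nCQx; split => //; exact: EQ].
by rewrite [e](_ : _ = e / 2 + e / 2) ?EFinD ?leeD//; lra.
Qed.

Lemma compact_outer_regular K (e : R) : compact K -> (vol K < e%:E)%E ->
  exists2 r : R, 0 < r & (vol (thicken K r) < e%:E)%E.
Proof.
move=> cK Ke; pose T k := thicken K k.+1%:R^-1.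
have oT k : open (T k).
  apply: ball_openP => x [y Ky xy]; exists (k.+1%:R^-1 - `|x - y|); first by rewrite subr_gt0.
  move=> z xz; exists y => //; apply: le_lt_trans (ler_distD x z y) _.
  by rewrite (distrC z x) -ltrBrDr.
have bK : bounded_set K by exact: compact_bounded.
have TI : \bigcap_k T k = K.
  apply/seteqP; split => [x Tx|x Kx k _]; last first.
    by exists x => //; rewrite subrr normr0 invr_gt0.
  have := compact_closed_rV cK; apply; apply/closureP => d d0.
  pose k := Num.truncn d^-1; have [y Ky xy] := Tx k Logic.I; exists y => //.
  apply: lt_le_trans xy _; rewrite invf_ple ?posrE ?ltr0n//; exact/ltW/truncnS_gt.
have [N hN] : exists N, (vol (T N) < e%:E)%E.
  apply: vol_bigcap_lt; last by rewrite TI.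
  - by move=> k; apply: borel_lebesgue_measurable; exact: open_borel.
  - apply: bounded_vol; have [M [Mr hM]] := bK.
    exists (M + 2); split; first by rewrite realD.
    move=> M' MM' x [y Ky xy]; have /= := hM (M + 1) ltac:(lra) y Ky.
    have : 1%:R^-1 = 1 :> R by rewrite invr1.
    by have := ler_distD y x 0; rewrite !subr0 in xy *; lra.
  - move=> k l kl x [y Ky xy]; exists y => //; apply: lt_le_trans xy _.
    by rewrite lef_pV2 ?posrE// ler_nat ltnS.
by exists N.+1%:R^-1.
Qed.

End volume2.

(** * Smooth functions of one variable and their products *)

Section smooth.
Context {R : realType}.
Implicit Types (f g c : R -> R) (P : {poly R}) (t : R).

Lemma scaleE (x y : R) : x *: y = x * y.
Proof. by []. Qed.

Fixpoint smoothk (k : nat) f : Prop :=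
  if k is k'.+1 then (forall t, derivable f t 1) /\ smoothk k' (derive1 f) else True.

Definition smooth f := forall k, smoothk k f.

Lemma smoothkW k f : smoothk k.+1 f -> smoothk k f.
Proof. by elim: k f => //= k IH f [df h]; split => //; apply: IH. Qed.

Lemma smooth_derivable f t : smooth f -> derivable f t 1.
Proof. by move=> /(_ 1%N)[]. Qed.

Lemma smooth_derive1 f : smooth f -> smooth (derive1 f).
Proof. by move=> sf k; case: (sf k.+1). Qed.

Lemma smooth_is_derive f t : smooth f -> is_derive t 1 f ((derive1 f) t).
Proof. by move=> sf; rewrite derive1E; apply: DeriveDef => //; exact: smooth_derivable. Qed.

Lemma smooth_continuous f : smooth f -> continuous f.
Proof.
by move=> sf t; apply: differentiable_continuous; apply/derivable1_diffP; exact: smooth_derivable.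
Qed.

Lemma derive1_ext f g : (forall t, is_derive t 1 f (g t)) ->
  (forall t, derivable f t 1) /\ (derive1 f) = g.
Proof.
move=> h; split => [t|]; first by case: (h t).
by apply/funext => t; rewrite derive1E; apply: derive_val.
Qed.

Lemma smoothk_is_derive k f g : (forall t, is_derive t 1 f (g t)) ->
  smoothk k g -> smoothk k.+1 f.
Proof. by move=> /derive1_ext[df fg] sg /=; rewrite fg. Qed.

Lemma is_derive_conv f t d d' : is_derive t 1 f d -> d = d' -> is_derive t 1 f d'.
Proof. by move=> + <-. Qed.

Lemma smooth_cst (a : R) : smooth (fun=> a).
Proof.
move=> k; elim: k a => // k IH a; apply: (@smoothk_is_derive k (fun=> a) (fun=> 0)) => // t.
Qed.

Lemma smoothkD k f g : smoothk k f -> smoothk k g -> smoothk k (fun t => f t + g t).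
Proof.
elim: k f g => // k IH f g [df sf] [dg sg].
apply: (@smoothk_is_derive k (fun t => f t + g t) (fun t => derive1 f t + derive1 g t)); last exact: IH.
by move=> t; apply: is_deriveD; rewrite derive1E; exact: DeriveDef.
Qed.

Lemma smoothkM k f g : smoothk k f -> smoothk k g -> smoothk k (fun t => f t * g t).
Proof.
elim: k f g => // k IH f g sf sg.
have [df sf'] := sf; have [dg sg'] := sg.
apply: (@smoothk_is_derive k (fun t => f t * g t) (fun t => f t * derive1 g t + g t * derive1 f t)).
  by move=> t; apply: is_deriveM; rewrite derive1E; exact: DeriveDef.
by apply: smoothkD; apply: IH => //; exact: smoothkW.
Qed.

Lemma smoothD f g : smooth f -> smooth g -> smooth (fun t => f t + g t).
Proof. by move=> sf sg k; exact: smoothkD. Qed.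

Lemma smoothM f g : smooth f -> smooth g -> smooth (fun t => f t * g t).
Proof. by move=> sf sg k; exact: smoothkM. Qed.

Lemma smoothV f : (forall t, f t != 0) -> smooth f -> smooth (fun t => (f t)^-1).
Proof.
move=> f0 sf.
elim=> // k IH; apply: (@smoothk_is_derive k (fun t => (f t)^-1) (fun t => (- 1 * derive1 f t) * ((f t)^-1 * (f t)^-1))).
  move=> t; have sft := smooth_is_derive t sf; apply: is_derive_conv (is_deriveV (f0 t) sft) _.
  by rewrite scaleE -exprVn; ring.
apply: smoothkM; last exact: smoothkM.
by apply: smoothM; [exact: smooth_cst|exact: smooth_derive1].
Qed.

Lemma smooth_affine f (a b : R) : smooth f -> smooth (fun t => f (a * t + b)).
Proof.
move=> sf k; elim: k f sf => // k IH f sf.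
apply: (@smoothk_is_derive k (fun t => f (a * t + b)) (fun t => (derive1 f) (a * t + b) * a)).
  move=> t; apply: (@is_derive1_comp _ f (fun t => a * t + b)); first exact: smooth_is_derive.
  have -> : (fun t => a * t + b) = (a *: (@id R) + cst b) by [].
  by apply: is_derive_eq; rewrite addr0 [LHS]mulr1.
apply: (IH (fun s => derive1 f s * a)); apply: smoothM; [exact: smooth_derive1|exact: smooth_cst].
Qed.

Definition flat P t : R := if 0 < t then P.[t^-1] * expR (- t^-1) else 0.

(** With d the size of [P], [expR s] dominates s^(d+2)/(d+2)!. The two spare powers give the factor
    t^2, which forces the derivative at 0 to vanish. *)
Lemma flat_bound P : exists2 A : R, 0 <= A & forall t, t <= 1 -> `|flat P t| <= A * t ^+ 2.
Proof.
pose d := size P; pose A := \sum_(i < d) `|P`_i|.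
have A0 : 0 <= A by apply: sumr_ge0.
exists (A * (d.+2)`!%:R) => [|t t1]; first by rewrite mulr_ge0.
rewrite /flat; case: ifPn => [t0|_]; last by rewrite normr0 mulr_ge0 ?sqr_ge0// mulr_ge0.
set s := t^-1; have s1 : 1 <= s by rewrite invf_ge1.
have s0 : 0 < s by exact: lt_le_trans s1.
have Ps : `|P.[s]| <= A * s ^+ d.
  rewrite horner_coef; apply: le_trans (ler_norm_sum _ _ _) _.
  rewrite mulr_suml; apply: ler_sum => i _; rewrite normrM ler_wpM2l//.
  by rewrite normrX (gtr0_norm s0) ler_weXn2l// ltnW.
have es : s ^+ d.+2 / (d.+2)`!%:R <= expR s.
  by have := @expR_ge1Dxn R s d.+1 (ltW s0); lra.
have f0 : 0 < (d.+2)`!%:R :> R by rewrite ltr0n fact_gt0.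
rewrite normrM (gtr0_norm (expR_gt0 _)) expRN -[t]invrK -/s exprVn.
rewrite ler_pdivlMr ?exprn_gt0// mulrAC ler_pdivrMr ?expR_gt0//.
apply: le_trans (_ : A * s ^+ d * s ^+ 2 <= _); first by rewrite ler_wpM2r ?exprn_ge0// ltW.
by rewrite -!mulrA ler_wpM2l// -exprD addn2 mulrC -ler_pdivrMr.
Qed.

Lemma is_derive_near f g t d : (\forall s \near t, f s = g s) ->
  is_derive t 1 g d -> is_derive t 1 f d.
Proof.
move=> fg [dg <-]; apply: DeriveDef; last exact: near_eq_derive.
by apply: near_eq_derivable dg; apply: filterS fg => s ->.
Qed.

Lemma flat_is_derive P t :
  is_derive t 1 (flat P) (flat ('X^2 * (P - P^`())) t).
Proof.
have [t0|t0|->] := ltgtP t 0.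
- have -> : flat ('X^2 * (P - P^`())) t = 0 by rewrite /flat ltNge (ltW t0).
  apply: (@is_derive_near _ (fun=> 0)).
  by near=> s; rewrite /flat ltNge ltW//; near: s; exact: lt_nbhsl.
- apply: (@is_derive_near _ (fun s => P.[s^-1] * expR (- s^-1))).
    by near=> s; rewrite /flat ifT//; near: s; exact: lt_nbhsr.
  have tn0 : t != 0 by rewrite gt_eqF.
  have dV : is_derive t 1 (fun s : R => s^-1) (- t ^- 2).
    by apply: is_derive_conv (@is_deriveV R id t 1 1 tn0 (is_derive_id _ _)) _; rewrite [LHS]mulr1.
  have dP : is_derive t 1 (fun s : R => P.[s^-1]) (P^`().[t^-1] * (- t ^- 2)).
    exact: (@is_derive1_comp _ (horner P) (fun s => s^-1)).
  have dN : is_derive t 1 (fun s : R => - s^-1) (- - t ^- 2) by exact: is_deriveN.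
  have dE : is_derive t 1 (fun s : R => expR (- s^-1)) (expR (- t^-1) * (- - t ^- 2)).
    exact: (@is_derive1_comp _ expR (fun s => - s^-1)).
  apply: is_derive_conv (is_deriveM dP dE) _.
  by rewrite !scaleE /flat t0 hornerM hornerXn hornerD hornerN -!exprVn; ring.
- have [A A0 hA] := flat_bound P.
  have fQ0 : flat ('X^2 * (P - P^`())) 0 = 0 by rewrite /flat ltxx.
  have fP0 : flat P 0 = 0 by rewrite /flat ltxx.
  have cv : h^-1 *: ((flat P \o shift 0) (h *: (1 : R)) - flat P 0) @[h --> 0^'] --> (0 : R).
    apply/cvgrPdist_le => e e0.
    have m0 : 0 < Num.min 1 (e / (A + 1)) by rewrite lt_min ltr01 divr_gt0//; lra.
    near=> h.
    have h0 : h != 0 by near: h; exact: nbhs_dnbhs_neq.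
    rewrite sub0r normrN fP0 subr0 /= addr0 [h *: 1]mulr1 normrZ normfV.
    rewrite ler_pdivrMl ?normr_gt0//.
    have h1 : `|h| < Num.min 1 (e / (A + 1)).
      by near: h; exact: dnbhs0_lt.
    move: h1; rewrite lt_min => /andP[h1 he].
    apply: le_trans (hA h (ltW (le_lt_trans (ler_norm _) h1))) _.
    rewrite -(real_normK (num_real h)) expr2 mulrCA ler_wpM2l//.
    move: he; rewrite ltr_pdivlMr; last lra.
    have := normr_ge0 h; lra.
  apply: DeriveDef; first by apply: cvgP cv.
  by rewrite fQ0; apply: cvg_lim.
Unshelve. all: by end_near. Qed.

Lemma smooth_flat P : smooth (flat P).
Proof.
move=> k; elim: k P => // k IH P.
apply: (@smoothk_is_derive k (flat P) (flat ('X^2 * (P - P^`())))) => // t.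
exact: flat_is_derive.
Qed.

Definition step_den t : R := flat 1 t + flat 1 (-1 * t + 1).

Definition step t : R := flat 1 t * (step_den t)^-1.

Lemma flat1_ge0 t : 0 <= flat 1 t.
Proof. by rewrite /flat hornerC mul1r; case: ifP => // _; exact: expR_ge0. Qed.

Lemma step_den_gt0 t : 0 < step_den t.
Proof.
rewrite /step_den; have [t0|t0] := ltP 0 t.
  by apply: ltr_wpDr; [exact: flat1_ge0|rewrite /flat t0 hornerC mul1r expR_gt0].
apply: ltr_wpDl; first exact: flat1_ge0.
by rewrite /flat ifT ?hornerC ?mul1r ?expR_gt0//; lra.
Qed.

Lemma smooth_step : smooth step.
Proof.
apply: smoothM; first exact: smooth_flat.
apply: smoothV => [t|]; first by rewrite gt_eqF// step_den_gt0.
by apply: smoothD; [exact: smooth_flat|apply: smooth_affine; exact: smooth_flat].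
Qed.

Lemma flat_le0 P t : t <= 0 -> flat P t = 0.
Proof. by move=> t0; rewrite /flat ltNge t0. Qed.

Lemma step_le0 t : t <= 0 -> step t = 0.
Proof. by move=> t0; rewrite /step flat_le0// mul0r. Qed.

Lemma step_ge1 t : 1 <= t -> step t = 1.
Proof.
move=> t1; rewrite /step; have := step_den_gt0 t.
rewrite /step_den (_ : flat 1 (-1 * t + 1) = 0) ?addr0; last by apply: flat_le0; lra.
by move=> f0; rewrite divff// gt_eqF.
Qed.

Lemma step_bound t : `|step t| <= 1.
Proof.
rewrite /step normrM normfV (gtr0_norm (step_den_gt0 t)) ger0_norm ?flat1_ge0//.
by rewrite ler_pdivrMr ?step_den_gt0// mul1r lerDl flat1_ge0.
Qed.

Lemma derive1_cst_left f (a : R) : smooth f -> (forall t, t <= a -> f t = f a) ->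
  forall t, t <= a -> derive1 f t = 0.
Proof.
move=> sf fa.
have lta t : t < a -> derive1 f t = 0.
  move=> ta; rewrite derive1E; apply: derive_val; apply: (@is_derive_near _ (fun=> f a)).
  by near=> s; apply: fa; apply: ltW; near: s; exact: lt_nbhsl.
move=> t; rewrite le_eqVlt => /predU1P[->|]; last exact: lta.
have c : {for a, continuous (derive1 f)} by apply: smooth_continuous; exact: smooth_derive1.
have cl : derive1 f s @[s --> a^'-] --> derive1 f a by exact: cvg_at_left_filter.
apply/esym; apply: (cvg_unique _ _ cl) => //.
apply: cvg_near_cst; near=> s; apply: lta; near: s; exact: nbhs_left_lt.
Unshelve. all: by end_near. Qed.

Lemma derive1_cst_right f (a : R) : smooth f -> (forall t, a <= t -> f t = f a) ->
  forall t, a <= t -> derive1 f t = 0.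
Proof.
move=> sf fa.
have lta t : a < t -> derive1 f t = 0.
  move=> ta; rewrite derive1E; apply: derive_val; apply: (@is_derive_near _ (fun=> f a)).
  by near=> s; apply: fa; apply: ltW; near: s; exact: lt_nbhsr.
move=> t; rewrite le_eqVlt => /predU1P[<-|]; last exact: lta.
have c : {for a, continuous (derive1 f)} by apply: smooth_continuous; exact: smooth_derive1.
have cl : derive1 f s @[s --> a^'+] --> derive1 f a by exact: cvg_at_right_filter.
apply/esym; apply: (cvg_unique _ _ cl) => //.
apply: cvg_near_cst; near=> s; apply: lta; near: s; exact: nbhs_right_gt.
Unshelve. all: by end_near. Qed.

Lemma derive1_support f (a b : R) : smooth f -> (forall t, ~ (a < t < b) -> f t = 0) ->
  forall t, ~ (a < t < b) -> derive1 f t = 0.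
Proof.
move=> sf f0 t /negP; rewrite negb_and -!leNgt => /orP[ta|tb].
  by apply: (@derive1_cst_left f a) => // s sa; rewrite !f0// => /andP[]; lra.
by apply: (@derive1_cst_right f b) => // s sa; rewrite !f0// => /andP[]; lra.
Qed.

End smooth.

Section product_tests.
Context {R : realType} {n : nat}.
Local Notation V := 'rV[R]_n.
Implicit Types (c : 'I_n -> R -> R) (x : V).

(** The test functions used throughout. Their partial derivatives have the same form, and their
    integrals factor into integrals over the line. *)
Definition prodf c x : R := \prod_i c i (x 0 i).

Definition dprod (j : 'I_n) c : 'I_n -> R -> R :=
  fun i => if i == j then derive1 (c i) else c i.

Lemma prodf_is_derive c j x : (forall i, smooth (c i)) ->
  is_derive x 'e_j (prodf c) (prodf (dprod j c) x).
Proof.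
move=> sc; pose A := \prod_(i | i != j) c i (x 0 i).
have pE (h : R) : prodf c (h *: 'e_j + x) = A * c j (h + x 0 j).
  rewrite /prodf (bigD1 j)//= mulrC; congr (_ * _); last by rewrite !mxE !eqxx mulr1.
  by apply: eq_bigr => i ij; rewrite !mxE (negbTE ij) andbF mulr0 add0r.
have dE : prodf (dprod j c) x = A * derive1 (c j) (x 0 j).
  rewrite /prodf (bigD1 j)//= mulrC /dprod eqxx; congr (_ * _).
  by apply: eq_bigr => i /negbTE ->.
have dc : derivable (c j) (x 0 j) 1 by exact: smooth_derivable.
have cv : h^-1 *: ((prodf c \o shift x) (h *: 'e_j) - prodf c x) @[h --> 0^'] --> prodf (dprod j c) x.
  rewrite dE (_ : (fun h : R => _) = (fun h : R => A * (h^-1 *: ((c j \o shift (x 0 j)) (h *: (1 : R)) - c j (x 0 j))))).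
    by apply: cvgMr; rewrite derive1E; exact: dc.
  apply/funext => h; rewrite /= pE -[in prodf c x](add0r x) -{1}(scale0r 'e_j) pE add0r.
  by rewrite [h *: 1]mulr1 !scaleE -mulrBr mulrCA.
by apply: DeriveDef; [apply: cvgP cv|apply: cvg_lim].
Qed.

Lemma partial_prodf c j : (forall i, smooth (c i)) -> partial j (prodf c) = prodf (dprod j c).
Proof. by move=> sc; apply/funext => x; rewrite /partial; have [] := prodf_is_derive j x sc. Qed.

Lemma smooth_dprod c j : (forall i, smooth (c i)) -> forall i, smooth (dprod j c i).
Proof. by move=> sc i; rewrite /dprod; case: ifP => // _; exact: smooth_derive1. Qed.

Lemma continuous_prodf c : (forall i, continuous (c i)) -> continuous (prodf c).
Proof.
move=> sc x.
have -> : prodf c = (fun x => \prod_(i <- enum 'I_n) c i (x 0 i)).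
  by apply/funext => y; rewrite /prodf big_enum.
elim: (enum 'I_n) => [|i s IH].
  rewrite (_ : (fun _ => _) = cst 1); first exact: cst_continuous.
  by apply/funext => y; rewrite big_nil.
rewrite (_ : (fun _ => _) = (fun y : V => c i (y 0 i) * \prod_(i <- s) c i (y 0 i))); last first.
  by apply/funext => y; rewrite big_cons.
apply: continuousM => //.
apply: (@continuous_comp _ _ _ (fun x : V => x 0 i) (c i)); first exact: coord_continuous.
exact: sc.
Qed.

Lemma Ck_prodf k c : (forall i, smooth (c i)) -> Ck k (prodf c).
Proof.
elim: k c => [|k IH] c sc; split => //; try by apply: continuous_prodf => i; exact: smooth_continuous.
move=> j; split => [x|]; first by case: (prodf_is_derive j x sc).
by rewrite partial_prodf//; apply: IH; exact: smooth_dprod.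
Qed.

Definition supported_in (a b : V) c := forall i t, ~ (a 0 i < t < b 0 i) -> c i t = 0.

Definition box (a b : V) : set V := [set x | forall i, x 0 i \in `[a 0 i, b 0 i]].

Lemma supported_prodf a b c x : supported_in a b c -> prodf c x != 0 ->
  forall i, a 0 i < x 0 i < b 0 i.
Proof.
move=> sc px i; apply: contraNT px => /negP h; rewrite /prodf (bigD1 i)//= sc ?mul0r//.
Qed.

Lemma supported_dprod a b c j : (forall i, smooth (c i)) -> supported_in a b c ->
  supported_in a b (dprod j c).
Proof.
move=> smc sc i t; rewrite /dprod; case: ifP => [_|_]; last exact: sc.
by apply: derive1_support => // s; exact: sc.
Qed.

Lemma test_prodf a b c (Om : set V) : (forall i, smooth (c i)) -> supported_in a b c ->
  box a b `<=` Om -> test_function Om (prodf c).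
Proof.
move=> smc sc bO.
have cb : compact (box a b) by exact: cube_compact.
have sb : closure [set x | prodf c x != 0] `<=` box a b.
  rewrite closureE; apply: smallest_sub; first exact: compact_closed_rV.
  move=> x /= px i; rewrite in_itv /=.
  by have /andP[h1 h2] := supported_prodf sc px i; rewrite !ltW.
split; [by move=> k; exact: Ck_prodf| |exact: subset_trans sb bO].
apply: subclosed_compact cb sb; exact: closed_closure.
Qed.

End product_tests.

(** * Integrals of products *)

Section integrals.
Context {R : realType} {n : nat}.
Local Notation V := 'rV[R]_n.
Local Notation L := (lebesgue R n).
Local Notation LT := (lebesgue_type R n).

Lemma continuous_borel (h : V -> R) : continuous h -> measurable_fun [set: V] h.
Proof.
move=> ch; apply: (measurability _ (RGenOpens.measurableE R)).
move=> _ [_ [a [b ->]] <-]; rewrite setTI; apply: open_borel.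
by apply: open_comp => [x _|]; [exact: ch|exact: interval_open].
Qed.

Lemma borel_measurable_fun d (T : measurableType d) (h : V -> T) (D : set V) :
  measurable_fun setT h -> measurable_fun (D : set LT) (h : LT -> T).
Proof.
move=> mh; apply: measurable_funTS => _ A mA; rewrite setTI.
by apply: borel_lebesgue_measurable; have := mh measurableT A mA; rewrite setTI.
Qed.

(** The identity, from the Lebesgue measurable to the Borel structure, pushes the completed measure
    forward to [lebesgue_rV]. *)
Lemma integral_lebesgue_rV (h : V -> \bar R) : measurable_fun [set: V] h ->
  (@lebesgue_rV R n).-integrable [set: V] h ->
  L.-integrable [set: LT] h /\ (\int[L]_x h x = \int[@lebesgue_rV R n]_x h x)%E.
Proof.
move=> mh ih.
have mid : measurable_fun [set: LT] (fun x : LT => x : V).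
  by move=> _ A mA; rewrite setTI; exact: borel_lebesgue_measurable.
have eqm A : measurable A -> A `<=` setT -> @lebesgue_rV R n A = pushforward L (fun x : LT => x : V) A.
  by move=> mA _; rewrite /pushforward -[RHS]/(vol A) vol_borel.
have iL : L.-integrable [set: LT] h.
  apply/integrableP; split; first exact: borel_measurable_fun.
  move/integrableP : ih => [_]; apply: le_lt_trans.
  rewrite (eq_measure_integral (pushforward L (fun x : LT => x : V)))//.
  by rewrite ge0_integral_pushforward//; exact: measurableT_comp.
split => //.
rewrite (eq_measure_integral (pushforward L (fun x : LT => x : V)))//.
by rewrite (integral_pushforward mid).
Qed.

End integrals.

Lemma integral_transport (R : realType) d1 d2 (X : measurableType d1) (Y : measurableType d2)
    (phi : X -> Y) (mu : {measure set X -> \bar R}) (m : {measure set Y -> \bar R}) (f : Y -> \bar R) :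
  measurable_fun [set: X] phi -> (forall A, measurable A -> m A = mu (phi @^-1` A)) ->
  measurable_fun [set: Y] f -> mu.-integrable [set: X] (f \o phi) ->
  m.-integrable [set: Y] f /\ (\int[m]_y f y = \int[mu]_x f (phi x))%E.
Proof.
move=> mphi mE mf ifp.
have eqm A : measurable A -> A `<=` setT -> m A = pushforward mu phi A by move=> mA _; exact: mE.
split.
  apply/integrableP; split => //; rewrite (eq_measure_integral (pushforward mu phi))//.
  rewrite ge0_integral_pushforward//; last exact: measurableT_comp.
  by have [_] := integrableP _ _ _ ifp.
by rewrite (eq_measure_integral (pushforward mu phi))// (integral_pushforward mphi).
Qed.

Section product_integral.
Context {R : realType}.

Lemma product_integral n (c : 'I_n -> R -> R) : (forall i, continuous (c i)) ->
  (forall i, (@lebesgue_measure R).-integrable setT (EFin \o c i)) ->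
  (@lebesgue_rV R n).-integrable [set: 'rV[R]_n] (EFin \o prodf c) /\
  (\int[@lebesgue_rV R n]_x (prodf c x)%:E =
   (\prod_i \int[@lebesgue_measure R]_x c i x)%:E)%E.
Proof.
elim: n c => [|n IH] c cc ic.
  have e1 : EFin \o prodf c = cst 1%E.
    by apply/funext => x; rewrite /= /prodf big_ord0.
  have m1 : measurable_fun [set: 'rV[R]_0] (EFin \o prodf c) by rewrite e1.
  split.
    apply/integrableP; split => //; rewrite e1 /=.
    by rewrite integral_dirac// diracT mul1e /= normr1 ltry.
  rewrite (eq_integral (cst 1%E)); last by move=> x _; rewrite -e1.
  by rewrite big_ord0 integral_dirac// diracT mul1e.
pose c' j := c (lift ord0 j).
have [ic' Ic'] := IH c' (fun j => cc _) (fun j => ic _).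
pose F (z : R * 'rV[R]_n) : \bar R := ((c ord0 z.1)%:E * (prodf c' z.2)%:E)%E.
have FE z : ((prodf c) (rV_cons z))%:E = F z.
  rewrite /F -EFinM /prodf big_ord_recl; congr (_ * _)%:E; first by rewrite mxE unlift_none.
  by apply: eq_bigr => j _; rewrite mxE liftK.
have mc : measurable_fun setT (c ord0) by exact: continuous_measurable_fun.
have mc' : measurable_fun [set: 'rV[R]_n] (prodf c') by apply: continuous_borel; apply: continuous_prodf => j; exact: cc.
have mF : measurable_fun setT F.
  apply: emeasurable_funM; apply/measurable_EFinP.
    exact: (measurableT_comp mc measurable_fst).
  exact: (measurableT_comp mc' measurable_snd).
have iF : ((@lebesgue_measure R) \x (@lebesgue_rV R n))%E.-integrable setT F.
  apply/integrable12ltyP => //.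
  have [_ fc] := integrableP _ _ _ (ic ord0); have [_ fc'] := integrableP _ _ _ ic'.
  have mP : measurable_fun [set: 'rV[R]_n] (abse \o (EFin \o prodf c')).
    by apply: measurableT_comp => //; exact/measurable_EFinP.
  have mC : measurable_fun setT (abse \o (EFin \o c ord0)).
    by apply: measurableT_comp => //; exact/measurable_EFinP.
  have inner t : (\int[@lebesgue_rV R n]_x `|F (t, x)| =
      (abse \o (EFin \o c ord0)) t * \int[@lebesgue_rV R n]_x (abse \o (EFin \o prodf c')) x)%E.
    transitivity (\int[@lebesgue_rV R n]_x ((abse \o (EFin \o c ord0)) t * (abse \o (EFin \o prodf c')) x))%E.
      by apply: eq_integral => x _; rewrite /F abseM.
    by apply: ge0_integralZl => // *; exact: abse_ge0.
  set I := (\int[@lebesgue_rV R n]_x (abse \o (EFin \o prodf c')) x)%E in inner.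
  have I0 : (0 <= I)%E by apply: integral_ge0 => x _; exact: abse_ge0.
  suff h : (\int[@lebesgue_measure R]_t ((abse \o (EFin \o c ord0)) t * I) < +oo)%E.
    apply: le_lt_trans h; apply: eqW.
    by apply: eq_integral => t _; exact: inner.
  have J0 : (0 <= \int[@lebesgue_measure R]_t (abse \o (EFin \o c ord0)) t)%E.
    by apply: integral_ge0 => x _; exact: abse_ge0.
  rewrite ge0_integralZr//; last by move=> x _; exact: abse_ge0.
  by apply: lte_mul_pinfty => //; rewrite ge0_fin_numE.
have mp : measurable_fun [set: 'rV[R]_n.+1] (EFin \o prodf c).
  by apply/measurable_EFinP; apply: continuous_borel; apply: continuous_prodf.
have mE A : measurable A -> @lebesgue_rV R n.+1 A =
    ((@lebesgue_measure R) \x (@lebesgue_rV R n))%E (@rV_cons R n @^-1` A) by [].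
have iFp : ((@lebesgue_measure R) \x (@lebesgue_rV R n))%E.-integrable setT ((EFin \o prodf c) \o rV_cons).
  by rewrite (_ : _ \o _ = F)//; apply/funext => z; exact: FE.
have mr : measurable_fun [set: (measurableTypeR R * 'rV[R]_n)%type]
    (@rV_cons R n : (measurableTypeR R * 'rV[R]_n)%type -> _).
  exact: measurable_rV_cons.
have [ip ->] := integral_transport mr mE mp iFp; split => //.
rewrite [X in integral _ _ X](_ : _ = F); last by apply/funext => z; exact: FE.
rewrite -integral12_prod_meas1// /fubini_F /F /=.
have inner t : (\int[@lebesgue_rV R n]_x ((c ord0 t)%:E * (prodf c' x)%:E) =
    (EFin \o c ord0) t * (\prod_i \int[@lebesgue_measure R]_x c' i x)%:E)%E.
  by rewrite integralZl// Ic'.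
set I := (\prod_i _) in inner.
transitivity (\int[@lebesgue_measure R]_t ((EFin \o c ord0) t * I%:E))%E.
  by apply: eq_integral => t _; exact: inner.
rewrite integralZr// big_ord_recl EFinM /Rintegral fineK//.
exact: (integrable_fin_num measurableT (ic ord0)).
Qed.

End product_integral.

(** * Integration by parts on the line and bump kernels *)

Section one_dim.
Context {R : realType}.
Local Notation leb := (@lebesgue_measure R).

Lemma smooth_FTC (F : R -> R) (a b : R) : a < b -> smooth F ->
  (forall t, ~ (a < t < b) -> derive1 F t = 0) ->
  leb.-integrable setT (EFin \o derive1 F) /\ \int[leb]_x derive1 F x = F b - F a.
Proof.
move=> ab sF F0.
have cF : {within `[a, b], continuous (derive1 F)}.
  by apply: continuous_subspaceT; apply: smooth_continuous; exact: smooth_derive1.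
have patchE : (EFin \o derive1 F) = (EFin \o derive1 F) \_ `[a, b].
  apply/funext => t; rewrite patchE; case: ifPn => //.
  rewrite notin_setE /= in_itv /= => tab; rewrite F0// => /andP[h1 h2].
  by apply: tab; rewrite !ltW.
have iF : leb.-integrable setT (EFin \o derive1 F).
  have iab : leb.-integrable `[a, b] (EFin \o derive1 F).
    by apply: continuous_compact_integrable => //; exact: segment_compact.
  have mab : measurable (`[a, b]%classic : set (measurableTypeR R)) by exact: measurable_itv.
  have [h _] := @integrable_mkcond _ _ _ leb `[a, b]%classic (EFin \o derive1 F) mab.
  by rewrite patchE; exact: h.
split => //; rewrite /Rintegral [X in fine X](_ : _ = (F b - F a)%:E)//.
transitivity (\int[leb]_(x in `[a, b]) (derive1 F x)%:E)%E.
  rewrite [RHS]integral_mkcond; apply: eq_integral => x _.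
  by rewrite -[in LHS]/((EFin \o derive1 F) x) patchE.
rewrite (@continuous_FTC2 _ (derive1 F) F)// ?EFinB//.
split.
- by move=> t _; exact: smooth_derivable.
- by apply: cvg_at_right_filter; exact: smooth_continuous.
- by apply: cvg_at_left_filter; exact: smooth_continuous.
Qed.

Lemma compact_support_integrable (c : R -> R) (a b : R) : continuous c ->
  (forall t, ~ (a < t < b) -> c t = 0) -> leb.-integrable setT (EFin \o c).
Proof.
move=> cc c0.
have -> : (EFin \o c) = (EFin \o c) \_ `[a, b].
  apply/funext => t; rewrite patchE; case: ifPn => //.
  rewrite notin_setE /= in_itv /= => tab; rewrite c0// => /andP[h1 h2].
  by apply: tab; rewrite !ltW.
have iab : leb.-integrable `[a, b] (EFin \o c).
  apply: continuous_compact_integrable; first exact: segment_compact.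
  exact: continuous_subspaceT.
have mab : measurable (`[a, b]%classic : set (measurableTypeR R)) by exact: measurable_itv.
have [h _] := @integrable_mkcond _ _ _ leb `[a, b]%classic (EFin \o c) mab.
exact: h.
Qed.

Lemma integral_derive1 (c : R -> R) (a b : R) : a < b -> smooth c ->
  (forall t, ~ (a < t < b) -> c t = 0) -> \int[leb]_x derive1 c x = 0.
Proof.
move=> ab sc c0; have [|_ ->] := smooth_FTC ab sc; first exact: derive1_support.
by rewrite !c0 ?subrr//; move/andP; lra.
Qed.

Lemma smooth_id : smooth (@id R).
Proof.
move=> k; case: k => // k; apply: (@smoothk_is_derive _ k id (fun=> 1)); exact: smooth_cst.
Qed.

Lemma integral_id_derive1 (c : R -> R) (a b : R) : a < b -> smooth c ->
  (forall t, ~ (a < t < b) -> c t = 0) ->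
  \int[leb]_x (x * derive1 c x) = - \int[leb]_x c x.
Proof.
move=> ab sc c0.
have sF : smooth (fun t => t * c t) by apply: smoothM => //; exact: smooth_id.
have F0 t : ~ (a < t < b) -> t * c t = 0 by move=> /c0 ->; rewrite mulr0.
have dF : derive1 (fun t => t * c t) = (fun t => t * derive1 c t + c t).
  apply: (derive1_ext _).2 => t; apply: is_derive_conv.
    by have d1 := smooth_is_derive t sc; exact: is_deriveM (is_derive_id t 1) d1.
  by rewrite !scaleE mulr1.
have := integral_derive1 ab sF F0; rewrite dF RintegralD//.
- by move=> /eqP; rewrite addr_eq0 => /eqP.
- apply: (@compact_support_integrable _ a b) => [|t h].
    by apply: smooth_continuous; apply: smoothM; [exact: smooth_id|exact: smooth_derive1].
  by rewrite (derive1_support sc c0)// mulr0.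
- by apply: (@compact_support_integrable _ a b) => //; exact: smooth_continuous.
Qed.

Definition stepat (a r t : R) : R := step ((t - a) / r).

Lemma smooth_stepat a r : smooth (stepat a r).
Proof.
have -> : stepat a r = (fun t => step (r^-1 * t + (- a / r))).
  by apply/funext => t; rewrite /stepat mulrBl mulrC mulNr.
by apply: smooth_affine; exact: smooth_step.
Qed.

Lemma stepat_le a r t : 0 < r -> t <= a -> stepat a r t = 0.
Proof. by move=> r0 ta; apply: step_le0; rewrite pmulr_lle0 ?invr_gt0//; lra. Qed.

Lemma stepat_ge a r t : 0 < r -> a + r <= t -> stepat a r t = 1.
Proof. by move=> r0 ta; apply: step_ge1; rewrite ler_pdivlMr//; lra. Qed.

(** A bump on []a, a + r[] of integral 1. Being the derivative of a step, it makes the difference of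
    two kernels the derivative of a difference of steps, which has compact support and can enter a
    test function. *)
Definition kern (a r : R) : R -> R := derive1 (stepat a r).

Lemma smooth_kern a r : smooth (kern a r).
Proof. by apply: smooth_derive1; exact: smooth_stepat. Qed.

Lemma kern_support a r t : 0 < r -> ~ (a < t < a + r) -> kern a r t = 0.
Proof.
move=> r0 /negP; rewrite negb_and -!leNgt => /orP[h|h].
  by apply: (derive1_cst_left (smooth_stepat a r)) h => s sa; rewrite !stepat_le.
by apply: (derive1_cst_right (smooth_stepat a r)) h => s sa; rewrite !stepat_ge.
Qed.

Lemma kern_integral a r : 0 < r -> \int[leb]_x kern a r x = 1.
Proof.
move=> r0; have ar : a < a + r by lra.
have [|_ ->] := smooth_FTC ar (smooth_stepat a r).
  by move=> t h; exact: kern_support.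
by rewrite stepat_ge// stepat_le// subr0.
Qed.

Lemma kern_bound : exists2 C : R, 1 <= C & forall a r t : R, 0 < r -> `|kern a r t| <= C / r.
Proof.
have cs : {within `[0, 1]%classic, continuous (fun t : R => `|derive1 (@step R) t|)}.
  apply: continuous_subspaceT => t; apply: (@continuous_comp _ _ _ (derive1 (@step R))).
    by apply: smooth_continuous; apply: smooth_derive1; exact: smooth_step.
  exact: norm_continuous.
have [c _ hc] := @EVT_max _ (fun t : R => `|derive1 (@step R) t|) 0 1 ler01 cs.
exists (1 + `|derive1 (@step R) c|); first by rewrite lerDl.
move=> a r t r0; have -> : kern a r t = derive1 (@step R) ((t - a) / r) / r.
  have h (s : R) : is_derive s 1 (stepat a r) (derive1 (@step R) ((s - a) / r) / r).
    have d1 : is_derive s 1 (fun t : R => (t - a) / r) r^-1.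
      have -> : (fun t => (t - a) / r) = r^-1 *: (@id R) + cst (- a / r).
        by apply/funext => u; transitivity (u * r^-1 - a * r^-1); [exact: mulrBl|rewrite mulrC -mulNr].
      by apply: is_derive_conv; rewrite addr0 [LHS]mulr1.
    exact: (is_derive1_comp (smooth_is_derive _ smooth_step) d1).
  by rewrite /kern (derive1_ext h).2.
rewrite normrM normfV (gtr0_norm r0) ler_wpM2r ?invr_ge0 ?(ltW r0)//.
set s := (t - a) / r; have [s01|/negP] := boolP (s \in `[0, 1]).
  by apply: le_trans (hc s s01) _; rewrite lerDr.
rewrite in_itv /= => /negP; rewrite negb_and -!ltNge => /orP[s0|s1].
  have -> : derive1 (@step R) s = 0.
    by apply: (derive1_cst_left smooth_step (a := 0)); [move=> u u0; rewrite !step_le0|exact: ltW].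
  by rewrite normr0 addr_ge0.
have -> : derive1 (@step R) s = 0.
  by apply: (derive1_cst_right smooth_step (a := 1)); [move=> u u0; rewrite !step_ge1|exact: ltW].
by rewrite normr0 addr_ge0.
Qed.

End one_dim.

(** * Weak derivatives tested against products *)

Section real_integral.
Context {R : realType} {n : nat}.
Local Notation V := 'rV[R]_n.
Local Notation LT := (lebesgue_type R n).
Implicit Types (D E : set V) (h k : V -> R).

Definition RI D h : R := \int[lebesgue R n]_(x in D) h x.

Definition Lint D h : Prop := (lebesgue R n).-integrable (D : set LT) (EFin \o h).

Lemma Lint_sub D E h : lebesgue_measurable D -> lebesgue_measurable E ->
  E `<=` D -> Lint D h -> Lint E h.
Proof. by move=> mD mE ED; apply: integrableS. Qed.

Lemma LintD D h k : lebesgue_measurable D -> Lint D h -> Lint D k -> Lint D (fun x => h x + k x).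
Proof. by move=> mD ih ik; apply: (integrableD mD ih ik). Qed.

Lemma LintB D h k : lebesgue_measurable D -> Lint D h -> Lint D k -> Lint D (fun x => h x - k x).
Proof. by move=> mD ih ik; apply: (integrableB mD ih ik). Qed.

Lemma LintZ D (a : R) h : lebesgue_measurable D -> Lint D h -> Lint D (fun x => a * h x).
Proof. by move=> mD ih; apply: (integrableZl mD a ih). Qed.

Lemma Lint_abs D h : lebesgue_measurable D -> Lint D h -> Lint D (fun x => `|h x|).
Proof. by move=> mD ih; apply: (integrable_abse ih). Qed.

Lemma Lint_sum D (I : Type) (s : seq I) (P : pred I) (h : I -> V -> R) : lebesgue_measurable D ->
  (forall i, P i -> Lint D (h i)) -> Lint D (fun x => \sum_(i <- s | P i) h i x).
Proof.
move=> mD ih; rewrite /Lint.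
have -> : EFin \o (fun x => \sum_(i <- s | P i) h i x) = (fun x => (\sum_(i <- s | P i) (h i x)%:E)%E).
  by apply/funext => x /=; rewrite sumEFin.
by apply: integrable_sum => // i Pi; exact: ih.
Qed.

Lemma Lint_cst D (a : R) : lebesgue_measurable D -> (vol D < +oo)%E -> Lint D (fun=> a).
Proof.
move=> mD Doo; apply: measurable_bounded_integrable => //.
by exists `|a|; split => // M aM x _ /=; exact: ltW.
Qed.

Lemma continuous_lebesgue_measurable D h : continuous h -> measurable_fun (D : set LT) (h : LT -> R).
Proof. by move=> ch; apply: borel_measurable_fun; exact: continuous_borel. Qed.

Lemma continuous_bounded_on K h : compact K -> continuous h -> [bounded h x | x in K].
Proof.
move=> cK ch; have [->|/set0P K0] := eqVneq K set0.
  by exists 0; split => // M _ x [].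
have cN : {within K, continuous (fun x => `|h x|)}.
  apply: continuous_subspaceT => x; apply: (@continuous_comp _ _ _ h); first exact: ch.
  exact: norm_continuous.
have [c _ hc] := compact_EVT_max K0 cK cN.
exists `|h c|; split => // M cM x Kx; apply: le_trans (ltW cM); apply: hc.
by rewrite inE.
Qed.

Lemma LintM D h k : compact D -> continuous k -> Lint D h -> Lint D (fun x => h x * k x).
Proof.
move=> cD ck ih; have mD : lebesgue_measurable D.
  by apply: borel_lebesgue_measurable; exact: compact_borel.
apply: (integrableMl mD ih); first exact: continuous_lebesgue_measurable.
exact: continuous_bounded_on.
Qed.

Lemma Lint_continuous D h : compact D -> continuous h -> Lint D h.
Proof.
move=> cD ch; have mD : lebesgue_measurable D.
  by apply: borel_lebesgue_measurable; exact: compact_borel.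
apply: measurable_bounded_integrable => //.
- by apply: bounded_vol; exact: compact_bounded.
- exact: continuous_lebesgue_measurable.
- exact: continuous_bounded_on.
Qed.

Lemma RID D h k : lebesgue_measurable D -> Lint D h -> Lint D k ->
  RI D (fun x => h x + k x) = RI D h + RI D k.
Proof. by move=> mD ih ik; apply: RintegralD. Qed.

Lemma RIB D h k : lebesgue_measurable D -> Lint D h -> Lint D k ->
  RI D (fun x => h x - k x) = RI D h - RI D k.
Proof. by move=> mD ih ik; apply: RintegralB. Qed.

Lemma RIZ D (a : R) h : lebesgue_measurable D -> Lint D h -> RI D (fun x => a * h x) = a * RI D h.
Proof. by move=> mD ih; apply: RintegralZl. Qed.

Lemma RI_sum D (I : Type) (s : seq I) (P : pred I) (h : I -> V -> R) : lebesgue_measurable D ->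
  (forall i, Lint D (h i)) -> RI D (fun x => \sum_(i <- s | P i) h i x) = \sum_(i <- s | P i) RI D (h i).
Proof.
move=> mD ih; elim: s => [|i s IH].
  rewrite big_nil /RI /Rintegral (eq_integral (cst 0%E)); first by rewrite integral0.
  by move=> x _; rewrite big_nil.
rewrite big_cons; case: ifPn => Pi; rewrite -IH -?RID//.
- by congr Rintegral; apply/funext => x; rewrite big_cons Pi.
- exact: Lint_sum.
- by congr Rintegral; apply/funext => x; rewrite big_cons (negbTE Pi).
Qed.

Lemma RI_le D h k : lebesgue_measurable D -> Lint D h -> Lint D k ->
  (forall x, D x -> h x <= k x) -> RI D h <= RI D k.
Proof. by move=> mD ih ik hk; exact: (@le_Rintegral _ _ _ (lebesgue R n) D h k mD ih ik hk). Qed.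

Lemma RI_abs D h : lebesgue_measurable D -> Lint D h -> `|RI D h| <= RI D (fun x => `|h x|).
Proof. by move=> mD ih; apply: le_normr_Rintegral. Qed.

Lemma RI_ge0 D h : (forall x, D x -> 0 <= h x) -> 0 <= RI D h.
Proof. by move=> h0; apply: Rintegral_ge0. Qed.

Lemma RI_cst D (a : R) : lebesgue_measurable D -> RI D (fun=> a) = a * fine (vol D).
Proof. by move=> mD; apply: Rintegral_cst. Qed.

Lemma RI_support D E h : (forall x, h x != 0 -> D x <-> E x) -> RI D h = RI E h.
Proof.
move=> DE; rewrite /RI /Rintegral; congr fine.
rewrite integral_mkcond [RHS]integral_mkcond; apply: eq_integral => x _.
rewrite !patchE; have [hx|/DE DEx] := eqVneq (h x) 0; first by rewrite hx !if_same.
by congr (if _ then _ else _); apply/idP/idP; rewrite !inE => /DEx.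
Qed.

Lemma eq_RI D h k : (forall x, D x -> h x = k x) -> RI D h = RI D k.
Proof. by move=> hk; apply: eq_Rintegral => x; rewrite inE; exact: hk. Qed.

Lemma RI_subset D E h : lebesgue_measurable D -> lebesgue_measurable E -> E `<=` D ->
  Lint D h -> (forall x, D x -> 0 <= h x) -> RI E h <= RI D h.
Proof.
move=> mD mE ED iD h0; have iE := Lint_sub mD mE ED iD.
apply: fine_le; [exact: integrable_fin_num iE|exact: integrable_fin_num iD|].
apply: ge0_subset_integral; [exact: mE|exact: mD|by case/integrableP: iD| |exact: ED].
by move=> x /h0; rewrite lee_fin.
Qed.

Lemma RI_bigsetU (I : choiceType) (s : seq I) (F : I -> set V) D h : uniq s ->
  lebesgue_measurable D -> (forall i, lebesgue_measurable (F i)) ->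
  (forall i, i \in s -> F i `<=` D) -> trivIset [set` s] F ->
  Lint D h -> (forall x, D x -> 0 <= h x) ->
  \sum_(i <- s) RI (F i) h <= RI D h.
Proof.
move=> us mD mF FD tF iD h0.
pose U := \big[setU/set0]_(i <- s) F i.
have UD : U `<=` D by rewrite /U -bigcup_seq => x [i /FD]; exact.
have mU : lebesgue_measurable U by apply: bigsetU_measurable => i _; exact: mF.
apply: le_trans (RI_subset mD mU UD iD h0).
have iF i : i \in s -> Lint (F i) h by move=> si; exact: Lint_sub (mF i) (FD i si) iD.
have e : (\int[lebesgue R n]_(x in U) (h x)%:E = \sum_(i <- s) \int[lebesgue R n]_(x in F i) (h x)%:E)%E.
  rewrite ge0_integral_bigsetU; [by []|exact: mF|exact: us|exact: tF| |].
  - by case/integrableP: (Lint_sub mD mU UD iD).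
  - by move=> x Ux; rewrite lee_fin; apply: h0; exact: UD.
have e2 : (\sum_(i <- s) RI (F i) h)%:E = (\int[lebesgue R n]_(x in U) (h x)%:E)%E.
  rewrite e -sumEFin big_seq [RHS]big_seq; apply: eq_bigr => i si.
  by have /fineK := integrable_fin_num (mF i) (iF i si).
by rewrite [leRHS]/RI /Rintegral -e2.
Qed.

End real_integral.

(** * Weak derivatives on boxes *)

Section product_weak.
Context {R : realType} {n : nat}.
Local Notation V := 'rV[R]_n.
Implicit Types (a b r : V) (u : V -> R) (v : 'I_n -> V -> R) (c : 'I_n -> R -> R).

Lemma box_compact a b : compact (box a b).
Proof. exact: cube_compact. Qed.

Lemma box_measurable a b : lebesgue_measurable (box a b).
Proof. by apply: borel_lebesgue_measurable; apply: compact_borel; exact: box_compact. Qed.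

(* The weak derivative identity on a box, tested against products of functions of
   one variable only, which makes it stable under adding affine functions. *)
Definition pweak a b u v : Prop :=
  [/\ Lint (box a b) u, forall j, Lint (box a b) (v j) &
    forall c, (forall i, smooth (c i)) -> supported_in a b c -> forall j,
      RI (box a b) (fun x => u x * prodf (dprod j c) x) =
      - RI (box a b) (fun x => v j x * prodf c x)].

Lemma supported_box a b c x : supported_in a b c -> prodf c x != 0 -> box a b x.
Proof.
move=> sc px i; rewrite in_itv /=.
by have /andP[h1 h2] := supported_prodf sc px i; rewrite !ltW.
Qed.

Lemma RI_prodf_restrict a b (D : set V) c (h : V -> R) : supported_in a b c -> box a b `<=` D ->
  RI D (fun x => h x * prodf c x) = RI (box a b) (fun x => h x * prodf c x).
Proof.
move=> sc bD; apply: RI_support => x; rewrite mulf_eq0 negb_or => /andP[_ px].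
by split => [_|/bD//]; exact: supported_box px.
Qed.

Lemma pweak_sub a b a' b' u v : box a' b' `<=` box a b ->
  (forall i, a 0 i <= a' 0 i) -> (forall i, b' 0 i <= b 0 i) ->
  pweak a b u v -> pweak a' b' u v.
Proof.
move=> bb aa bb' [iu iv h]; split.
- by apply: (Lint_sub _ _ bb iu); exact: box_measurable.
- by move=> j; apply: (Lint_sub _ _ bb (iv j)); exact: box_measurable.
move=> c smc sc j.
have sc' : supported_in a b c.
  move=> i t h'; apply: sc => /andP[h1 h2]; apply: h'.
  by rewrite (le_lt_trans (aa i) h1) (lt_le_trans h2 (bb' i)).
rewrite -(RI_prodf_restrict u (supported_dprod _ smc sc) bb) -(RI_prodf_restrict (v j) sc bb).
exact: h.
Qed.

Lemma L1loc_box (Om : set V) a b u : L1loc Om u -> box a b `<=` Om -> Lint (box a b) u.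
Proof. by move=> iu bO; have h := iu (box a b) (@box_compact a b) bO. Qed.

Lemma weak_partial_pweak (Om : set V) a b u v : (forall j, weak_partial Om u j (v j)) ->
  box a b `<=` Om -> pweak a b u v.
Proof.
move=> wp bO; split.
(* In dimension 0 there is no index from which to obtain integrability; there [u] is constant. *)
- have [j _|n0] := pickP (@predT 'I_n); first by have [iu _ _] := wp j; exact: (L1loc_box iu bO).
  have -> : u = fun=> u 0.
    by apply/funext => x; congr u; apply/rowP => i; have := n0 i.
  by apply: Lint_continuous; [exact: box_compact|exact: cst_continuous].
- by move=> j; have [_ iv _] := wp j; apply: iv => //; exact: box_compact.
move=> c smc sc j; have [_ _ /(_ _ (test_prodf smc sc bO))] := wp j.
rewrite partial_prodf// -!/(RI _ _) => h.
by rewrite -(RI_prodf_restrict u (supported_dprod _ smc sc) bO) h (RI_prodf_restrict (v j) sc bO).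
Qed.

Lemma RI_prodf a b c : (forall i, continuous (c i)) ->
  supported_in a b c -> RI (box a b) (prodf c) = \prod_i \int[@lebesgue_measure R]_x c i x.
Proof.
move=> cc sc.
have ic i : (@lebesgue_measure R).-integrable setT (EFin \o c i).
  by apply: (@compact_support_integrable _ _ (a 0 i) (b 0 i)) => // t; exact: sc.
have [ip Ip] := product_integral cc ic.
rewrite (@RI_support _ _ _ setT); last first.
  by move=> x px; split => // _; exact: supported_box px.
have mp : measurable_fun [set: V] (EFin \o prodf c).
  by apply/measurable_EFinP; apply: continuous_borel; exact: continuous_prodf.
have [_ e] := integral_lebesgue_rV mp ip.
by rewrite /RI /Rintegral -[X in fine X]/(\int[lebesgue R n]_x (EFin \o prodf c) x)%E e /= Ip.
Qed.

(** The factor [x 0 l] is absorbed into the l-th function, so the integral still factors. If [l] is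
    not [j], the j-th factor is the integral of a derivative with compact support; otherwise it is
    computed by parts. *)
Lemma RI_coord_dprod a b c l j : (forall i, smooth (c i)) -> supported_in a b c -> a 0 j < b 0 j ->
  RI (box a b) (fun x => x 0 l * prodf (dprod j c) x) = - ((l == j)%:R * RI (box a b) (prodf c)).
Proof.
move=> smc sc ab.
pose c' i t := (if i == l then t else 1) * dprod j c i t.
have e (x : V) : x 0 l * prodf (dprod j c) x = prodf c' x.
  rewrite /prodf /c' big_split /=; congr (_ * _).
  by rewrite (bigD1 l)//= eqxx big1 ?mulr1// => i /negbTE ->.
have sc' : supported_in a b c'.
  by move=> i t h; rewrite /c' (supported_dprod _ smc sc h) mulr0.
have cc' i : continuous (c' i).
  apply: smooth_continuous; apply: smoothM; last exact: smooth_dprod.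
  by case: (i == l); [exact: smooth_id|exact: smooth_cst].
rewrite (eq_RI (fun x _ => e x)) RI_prodf// RI_prodf//; last by move=> i; exact: smooth_continuous.
have [lj|lj] := eqVneq l j.
  subst l; rewrite mul1r (bigD1 j)//= [in RHS](bigD1 j)//= -mulNr; congr (_ * _).
    rewrite /c' eqxx /dprod eqxx (@integral_id_derive1 _ _ (a 0 j) (b 0 j))// => t; exact: sc.
  apply: eq_bigr => i ij; congr Rintegral; apply/funext => t.
  by rewrite /c' /dprod (negbTE ij) mul1r.
rewrite mul0r oppr0 (bigD1 j)//= [X in X * _](_ : _ = 0) ?mul0r//.
rewrite (_ : c' j = derive1 (c j)); last first.
  by apply/funext => t; rewrite /c' /dprod eqxx eq_sym (negbTE lj) mul1r.
by apply: (@integral_derive1 _ _ (a 0 j) (b 0 j)) => // t; exact: sc.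
Qed.

Lemma pweak_affine a b u v (L : 'I_n -> R) : (forall j, a 0 j < b 0 j) -> pweak a b u v ->
  pweak a b (fun x => u x - \sum_l L l * x 0 l) (fun j x => v j x - L j).
Proof.
move=> ab [iu iv h]; have cb := @box_compact a b; have mb := @box_measurable a b.
have boo : (vol (box a b) < +oo)%E by apply: bounded_vol; exact: compact_bounded.
have ccoord l : continuous (fun x : V => x 0 l) by move=> x; exact: coord_continuous.
have il l : Lint (box a b) (fun x => L l * x 0 l) by apply: LintZ => //; exact: Lint_continuous.
have iL : Lint (box a b) (fun x => \sum_l L l * x 0 l) by exact: Lint_sum.
split; first exact: LintB.
  by move=> j; apply: LintB => //; exact: Lint_cst.
move=> c smc sc j.
have cd : continuous (prodf (dprod j c)).
  by apply: continuous_prodf => i; apply: smooth_continuous; exact: smooth_dprod.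
have cp : continuous (prodf c) by apply: continuous_prodf => i; exact: smooth_continuous.
transitivity (RI (box a b) (fun x => u x * prodf (dprod j c) x - \sum_l L l * (x 0 l * prodf (dprod j c) x))).
  by apply: eq_RI => x _; rewrite mulrBl mulr_suml; congr (_ - _); apply: eq_bigr => l _; rewrite mulrA.
have ild l : Lint (box a b) (fun x => x 0 l * prodf (dprod j c) x).
  by apply: LintM => //; exact: Lint_continuous.
have ilZ l : Lint (box a b) (fun x => L l * (x 0 l * prodf (dprod j c) x)) by exact: LintZ.
rewrite RIB//; [|exact: LintM|exact: Lint_sum].
rewrite RI_sum// h//.
transitivity (- RI (box a b) (fun x => v j x * prodf c x - L j * prodf c x)); last first.
  by congr (- _); apply: eq_RI => x _; rewrite mulrBl.
have ip : Lint (box a b) (prodf c) by exact: Lint_continuous.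
rewrite RIB//; [|exact: LintM|exact: LintZ].
rewrite RIZ// opprB addrC; congr (_ + _).
rewrite (bigD1 j)//= big1 ?addr0.
  by rewrite RIZ// RI_coord_dprod// eqxx mul1r mulrN opprK.
by move=> l lj; rewrite RIZ// RI_coord_dprod// (negbTE lj) mul0r oppr0 mulr0.
Qed.

End product_weak.

(** * Averages over shrinking boxes *)

Lemma telescope_sum_ord (R : realType) (A : nat -> R) J : A 0%N = A J + \sum_(j < J) (A j - A j.+1).
Proof.
elim: J => [|J IH]; first by rewrite big_ord0 addr0.
by rewrite big_ord_recr /= [in LHS]IH; ring.
Qed.

Lemma halving_nested (R : realFieldType) (y d rho q : R) : 0 <= d -> d <= rho -> 0 <= q ->
  [/\ rho * (2^-1 * q) = rho * q / 2, y - d * q <= y - d * (2^-1 * q) &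
    y - d * (2^-1 * q) + rho * (2^-1 * q) <= y - d * q + rho * q].
Proof. by move=> d0 dr q0; split; [ring|nra|nra]. Qed.

Section telescoping.
Context {R : realType} {n : nat}.
Local Notation V := 'rV[R]_n.
Implicit Types (a b r x y : V) (u : V -> R) (v : 'I_n -> V -> R) (c : 'I_n -> R -> R) (S : {set 'I_n}).
Variable C : R.
Hypothesis C1 : 1 <= C.
Hypothesis kernC : forall a r t : R, 0 < r -> `|kern a r t| <= C / r.

Lemma two_le_double : 1 + 1 <= 2 * C.
Proof. by move: C1; lra. Qed.

Lemma bound_ge0 : 0 <= C.
Proof. by move: C1; lra. Qed.

Lemma le_double : C <= 2 * C.
Proof. by move: C1; lra. Qed.

Definition boxkern a r : 'I_n -> R -> R := fun i => kern (a 0 i) (r 0 i).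

Definition average a r u : R := RI (box a (a + r)) (fun x => u x * prodf (boxkern a r) x).

(** A bound for the kernels of the box. The factor 2 lets it also serve when some sides are halved,
    and it covers the difference of two steps. *)
Definition weight r : R := \prod_i (2 * C / r 0 i).

Lemma smooth_boxkern a r i : smooth (boxkern a r i).
Proof. exact: smooth_kern. Qed.

Lemma supported_boxkern a r : (forall i, 0 < r 0 i) -> supported_in a (a + r) (boxkern a r).
Proof. by move=> r0 i t; rewrite mxE; exact: kern_support. Qed.

Lemma continuous_boxkern a r : continuous (prodf (boxkern a r)).
Proof. by apply: continuous_prodf => i; apply: smooth_continuous; exact: smooth_boxkern. Qed.

Lemma RI_boxkern a r : (forall i, 0 < r 0 i) -> RI (box a (a + r)) (prodf (boxkern a r)) = 1.
Proof.
move=> r0; rewrite RI_prodf; last exact: supported_boxkern.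
  by rewrite big1// => i _; exact: kern_integral.
by move=> i; apply: smooth_continuous; exact: smooth_boxkern.
Qed.

Lemma weight_ge0 r : (forall i, 0 < r 0 i) -> 0 <= weight r.
Proof. by move=> r0; apply: prodr_ge0 => i _; rewrite divr_ge0 ?(ltW (r0 _))// mulr_ge0//; move: C1; lra. Qed.

Lemma boxkern_bound a r x : (forall i, 0 < r 0 i) -> `|prodf (boxkern a r) x| <= weight r.
Proof.
move=> r0; rewrite normr_prod; apply: ler_prod => i _; rewrite normr_ge0 /=.
apply: le_trans (kernC _ _ (r0 i)) _; rewrite ler_wpM2r ?invr_ge0 ?(ltW (r0 i))//; move: C1; lra.
Qed.

Lemma vol_sbox a r : (forall i, 0 < r 0 i) -> vol (box a (a + r)) = (\prod_i r 0 i)%:E.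
Proof.
move=> r0; rewrite vol_box; last by move=> i; rewrite mxE lerDl ltW.
by congr EFin; apply: eq_bigr => i _; rewrite mxE addrAC subrr add0r.
Qed.

Lemma weight_vol r : (forall i, 0 < r 0 i) -> weight r * \prod_i r 0 i = (2 * C) ^+ n.
Proof.
move=> r0; rewrite /weight -big_split /= (eq_bigr (fun=> 2 * C)).
  by rewrite prodr_const card_ord.
by move=> i _; rewrite divfK// gt_eqF.
Qed.

Lemma average_approx a r u (t e : R) : (forall i, 0 < r 0 i) -> 0 <= e ->
  Lint (box a (a + r)) u -> (forall x, box a (a + r) x -> `|u x - t| <= e) ->
  `|average a r u - t| <= (2 * C) ^+ n * e.
Proof.
move=> r0 e0 iu ut; have cb := @box_compact _ _ a (a + r); have mb := @box_measurable _ _ a (a + r).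
have boo : (vol (box a (a + r)) < +oo)%E by rewrite vol_sbox// ltry.
have ik : Lint (box a (a + r)) (prodf (boxkern a r)) by apply: Lint_continuous => //; exact: continuous_boxkern.
have iuk : Lint (box a (a + r)) (fun x => u x * prodf (boxkern a r) x).
  by apply: LintM => //; exact: continuous_boxkern.
have -> : average a r u - t = RI (box a (a + r)) (fun x => u x * prodf (boxkern a r) x - t * prodf (boxkern a r) x).
  by rewrite RIB//; [rewrite RIZ// RI_boxkern// mulr1|exact: LintZ].
have iB : Lint (box a (a + r)) (fun x => u x * prodf (boxkern a r) x - t * prodf (boxkern a r) x).
  by apply: LintB => //; exact: LintZ.
apply: le_trans (RI_abs mb iB) _.
apply: (@le_trans _ _ (RI (box a (a + r)) (fun=> e * weight r))).
  apply: RI_le => //; [exact: Lint_abs|exact: Lint_cst|move=> x bx].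
  by rewrite -mulrBl normrM ler_pM// ?boxkern_bound// ut.
by rewrite RI_cst// vol_sbox//= -mulrA weight_vol// mulrC.
Qed.

(** The kernel is changed one coordinate at a time. Each change is the i-th partial derivative of a
    test function [phi i], so it costs an integral of [v i]; coordinates off [S] cost nothing, since
    their steps coincide. The gain [rho] over the kernel bound comes from replacing one kernel, of
    size [2 * C / rho], by a difference of steps, of size [2 * C]. *)
Lemma average_step a r a' r' u v S (rho : R) :
  (forall i, 0 < r 0 i) -> pweak a (a + r) u v ->
  (forall i, i \notin S -> a' 0 i = a 0 i /\ r' 0 i = r 0 i) ->
  (forall i, i \in S -> [/\ r' 0 i = r 0 i / 2, a 0 i <= a' 0 i, a' 0 i + r' 0 i <= a 0 i + r 0 i & r 0 i = rho]) ->
  `|average a r u - average a' r' u| <=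
  rho * weight r * \sum_(i in S) RI (box a (a + r)) (fun x => `|v i x|).
Proof.
move=> r0 [iu iv h] nS inS; have cb := @box_compact _ _ a (a + r); have mb := @box_measurable _ _ a (a + r).
have r'0 i : 0 < r' 0 i.
  have [iS|iS] := boolP (i \in S); first by have [-> _ _ _] := inS i iS; rewrite divr_gt0.
  by have [_ ->] := nS i iS.
have r'r i : r 0 i / 2 <= r' 0 i.
  have [iS|iS] := boolP (i \in S); first by have [-> _ _ _] := inS i iS.
  by have [_ ->] := nS i iS; have := r0 i; lra.
have aa' i : a 0 i <= a' 0 i.
  have [iS|iS] := boolP (i \in S); first by have [] := inS i iS.
  by have [->] := nS i iS.
have bb' i : a' 0 i + r' 0 i <= a 0 i + r 0 i.
  have [iS|iS] := boolP (i \in S); first by have [] := inS i iS.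
  by have [-> ->] := nS i iS.
have sub : box a' (a' + r') `<=` box a (a + r).
  move=> x hx i; have := hx i; rewrite !in_itv /= !mxE => /andP[h1 h2].
  by rewrite (le_trans (aa' i) h1) (le_trans h2 (bb' i)).
rewrite {2}/average -(RI_prodf_restrict u (supported_boxkern r'0) sub) /average.
pose k (m : nat) : 'I_n -> R -> R := fun j => if (j < m)%N then boxkern a r j else boxkern a' r' j.
have ck m : continuous (prodf (k m)).
  by apply: continuous_prodf => j; rewrite /k; apply: smooth_continuous; case: ifP => _; exact: smooth_boxkern.
have iuk m : Lint (box a (a + r)) (fun x => u x * prodf (k m) x) by exact: LintM.
(* New kernels after slot [i], old ones before it, and in slot [i] the difference of the steps whose
   derivative is the difference of the two kernels. That difference vanishes outside the larger
   interval. *)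
pose phi (i : 'I_n) : 'I_n -> R -> R := fun j => if (j < i)%N then boxkern a r j else
   if j == i then (fun t => stepat (a 0 i) (r 0 i) t + -1 * stepat (a' 0 i) (r' 0 i) t) else boxkern a' r' j.
have smphi i j : smooth (phi i j).
  rewrite /phi; case: ifP => _; first exact: smooth_boxkern.
  case: ifP => _; last exact: smooth_boxkern.
  apply: smoothD; first exact: smooth_stepat.
  by apply: smoothM; [exact: smooth_cst|exact: smooth_stepat].
have sphi i : supported_in a (a + r) (phi i).
  move=> j t hj; rewrite /phi; have bk : boxkern a' r' j t = 0.
    apply: kern_support => // /andP[h1 h2]; apply: hj; rewrite mxE.
    by rewrite (le_lt_trans (aa' j) h1) (lt_le_trans h2 (bb' j)).
  case: ifP => _; first exact: (supported_boxkern r0 hj).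
  case: eqP => [ji|_ //]; rewrite -ji; move/negP: hj; rewrite negb_and -!leNgt mxE => /orP[ta|ta].
    by rewrite !stepat_le// ?mulr0 ?addr0// (le_trans ta (aa' j)).
  by rewrite !stepat_ge//; [lra|exact: le_trans (bb' j) ta].
have dphi (i : 'I_n) x : prodf (dprod i (phi i)) x = prodf (k i.+1) x - prodf (k i) x.
  rewrite /prodf (bigD1 i)//= [in RHS](bigD1 i)//= [X in _ = _ - X](bigD1 i)//=.
  have e1 : dprod i (phi i) i (x 0 i) = boxkern a r i (x 0 i) - boxkern a' r' i (x 0 i).
    rewrite /dprod eqxx /phi ltnn eqxx.
    have d1 := smooth_is_derive (x 0 i) (smooth_stepat (a 0 i) (r 0 i)).
    have d2 := smooth_is_derive (x 0 i) (smooth_stepat (a' 0 i) (r' 0 i)).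
    rewrite derive1E; apply: derive_val; apply: (is_derive_conv (is_deriveD d1 (is_deriveZ (-1) d2))).
    by rewrite scaleN1r.
  rewrite e1 /k ltnS leqnn ltnn mulrBl; congr (_ - _); congr (_ * _); apply: eq_bigr => j ji.
    rewrite /dprod (negbTE ji) /phi (negbTE ji) ltnS.
    have -> : (j <= i)%N = (j < i)%N by rewrite leq_eqVlt -[j == i :> nat]/(j == i) (negbTE ji).
    by [].
  by rewrite /dprod (negbTE ji) /phi (negbTE ji).
have tel : RI (box a (a + r)) (fun x => u x * prodf (boxkern a r) x) -
   RI (box a (a + r)) (fun x => u x * prodf (boxkern a' r') x) =
   \sum_(i < n) (- RI (box a (a + r)) (fun x => v i x * prodf (phi i) x)).
  have -> : boxkern a r = k n by apply/funext => j; rewrite /k ltn_ord.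
  have -> : boxkern a' r' = k 0%N by apply/funext => j; rewrite /k ltn0.
  rewrite -(telescope_sumr (fun m => RI (box a (a + r)) (fun x => u x * prodf (k m) x)))//.
  rewrite big_mkord; apply: eq_bigr => i _; rewrite -h// -RIB//.
  by apply: eq_RI => x _; rewrite dphi mulrBr.
have phi_bound i x : i \in S -> `|prodf (phi i) x| <= rho * weight r.
  move=> iS; have [_ _ _ rho_i] := inS i iS; rewrite /prodf normr_prod (bigD1 i)//= /weight [in leRHS](bigD1 i)//= mulrA.
  rewrite -rho_i [r 0 i * _]mulrC divfK ?gt_eqF//.
  apply: ler_pM => //; first by apply: prodr_ge0.
    rewrite /phi ltnn eqxx mulN1r; apply: le_trans (ler_normB _ _) _.
    apply: (@le_trans _ _ (1 + 1)); first exact: lerD (step_bound _) (step_bound _).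
    exact: two_le_double.
  apply: ler_prod => j ji; rewrite normr_ge0 /= /phi (negbTE ji); case: ifP => _.
    apply: le_trans (kernC _ _ (r0 j)) _; rewrite ler_wpM2r ?invr_ge0 ?(ltW (r0 j))//; exact: le_double.
  apply: le_trans (kernC _ _ (r'0 j)) _; rewrite ler_pdivrMr// mulrAC ler_pdivlMr//.
  rewrite [2 * _]mulrC -mulrA ler_wpM2l//; first exact: bound_ge0.
  by rewrite -ler_pdivrMl// mulrC; exact: r'r.
rewrite tel; apply: le_trans (ler_norm_sum _ _ _) _.
rewrite mulr_sumr (bigID (mem S)) /= [X in _ + X]big1 ?addr0.
  apply: ler_sum => i iS; rewrite normrN.
  have ivp : Lint (box a (a + r)) (fun x => v i x * prodf (phi i) x).
    by apply: LintM => //; apply: continuous_prodf => j; apply: smooth_continuous.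
  apply: le_trans (RI_abs mb ivp) _.
  have iav : Lint (box a (a + r)) (fun x => `|v i x|) by exact: Lint_abs.
  rewrite -RIZ//; apply: RI_le => //; [exact: Lint_abs|exact: LintZ|move=> x bx].
  by rewrite normrM mulrC ler_wpM2r// phi_bound.
move=> i iS; have [ea er] := nS i iS.
rewrite (@eq_RI _ _ _ _ (fun=> 0)) ?RI_cst ?mul0r ?oppr0 ?normr0//.
move=> x _; rewrite /prodf (bigD1 i)//= /phi ltnn eqxx ea er mulN1r subrr mul0r mulr0//.
Qed.

(** The homothety of centre [y] and ratio 2^-j, applied in the coordinates of [S] only: the boxes
    are nested and keep [y]. *)
Definition zoom_corner S y a j : V := \row_i (if i \in S then y 0 i - (y 0 i - a 0 i) / 2 ^+ j else a 0 i).
Definition zoom_side S r j : V := \row_i (if i \in S then r 0 i / 2 ^+ j else r 0 i).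

(** The last box keeps its sides off [S], so it does not shrink to a point as [J] grows. The
    oscillation of [u] over it is therefore left as a hypothesis, to be met by continuity. *)
Lemma average_telescope a r u v S (rho e : R) y J :
  (forall i, 0 < r 0 i) -> (forall i, i \in S -> r 0 i = rho) -> pweak a (a + r) u v ->
  box a (a + r) y -> 0 <= e ->
  let a' j := zoom_corner S y a j in let r' j := zoom_side S r j in
  (forall x, box (a' J) (a' J + r' J) x -> `|u x - u y| <= e) ->
  `|average a r u - u y| <= (2 * C) ^+ n * e +
    \sum_(j < J) rho / 2 ^+ j * weight (r' j) *
      \sum_(i in S) RI (box (a' j) (a' j + r' j)) (fun x => `|v i x|).
Proof.
move=> r0 rS pw yb e0 a' r' osc.
have p2 j : 0 < (2 : R) ^+ j by rewrite exprn_gt0.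
have r'0 j i : 0 < r' j 0 i by rewrite mxE; case: ifP => // _; rewrite divr_gt0.
have ar j i : a 0 i <= a' j 0 i /\ a' j 0 i + r' j 0 i <= a 0 i + r 0 i.
  have := yb i; rewrite in_itv /= !mxE => /andP[ya yr]; case: ifP => // _.
  have q1 : (2 ^+ j : R)^-1 <= 1 by rewrite invf_le1// exprn_ege1// ler1n.
  have q0 : 0 <= (2 ^+ j : R)^-1 by rewrite invr_ge0 ltW.
  by split; nra.
have addE (s t : V) i : (s + t) 0 i = s 0 i + t 0 i by rewrite mxE.
have bs j : box (a' j) (a' j + r' j) `<=` box a (a + r).
  move=> x hx i; have := hx i; have [h1 h2] := ar j i; rewrite !in_itv /= !addE => /andP[h3 h4].
  by rewrite (le_trans h1 h3) (le_trans h4 h2).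
have pwj j : pweak (a' j) (a' j + r' j) u v.
  by apply: pweak_sub pw => // i; have [h1 h2] := ar j i; rewrite ?addE.
have a'0 : a' 0%N = a by apply/rowP => i; rewrite mxE expr0 divr1 subKr if_same.
have r'E : r' 0%N = r by apply/rowP => i; rewrite mxE expr0 divr1 if_same.
have tel := telescope_sum_ord (fun j => average (a' j) (r' j) u) J.
rewrite /= a'0 r'E in tel.
rewrite tel addrAC; apply: le_trans (ler_normD _ _) _; apply: lerD.
  by apply: average_approx => //; have [] := pwj J.
apply: le_trans (ler_norm_sum _ _ _) _; apply: ler_sum => j _.
apply: average_step => // i iS; rewrite !mxE ?(negbTE iS)// ?iS rS// exprS.
have := yb i; rewrite in_itv /= !mxE rS// => /andP[ya yr].
have q0 : 0 <= (2 ^+ j : R)^-1 by rewrite invr_ge0 ltW.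
have d0 : 0 <= y 0 i - a 0 i by rewrite subr_ge0.
have d1 : y 0 i - a 0 i <= rho by rewrite lerBlDl.
have [h1 h2 h3] := halving_nested (y 0 i) d0 d1 q0.
by rewrite invfM; split.
Qed.

End telescoping.

(** * Coverings by grid cells *)

Section covering.
Context {R : realType} {n : nat}.
Local Notation V := 'rV[R]_n.
Implicit Types (a b c r s x y z : V) (K U Z : set V) (h : V -> R) (Psi : V -> V).

Lemma grid_cover s Z : (forall i, 0 < s 0 i) -> bounded_set Z ->
  exists cs : seq V, [/\ uniq cs, trivIset [set` cs] (fun c => cell c (c + s)),
    forall c, c \in cs -> Z `&` cell c (c + s) !=set0 &
    forall z, Z z -> exists2 c, c \in cs & cell c (c + s) z].
Proof.
move=> s0 bZ; have [M M0 ZM] := bounded_cube bZ.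
pose N := (\max_(i < n) Num.truncn (M / s 0 i)%R).+1.
have Ns i : M <= N%:R * s 0 i.
  rewrite -ler_pdivrMr//; apply: ltW; apply: lt_le_trans (truncnS_gt _) _.
  by rewrite ler_nat ltnS; exact: (leq_bigmax i).
pose corner (k : {ffun 'I_n -> 'I_(N + N).+1}) : V := \row_i (((k i)%:R - N%:R) * s 0 i).
pose meets c := `[< Z `&` cell c (c + s) !=set0 >].
have cornerE k z i : cell (corner k) (corner k + s) z ->
   ((k i)%:R - N%:R) * s 0 i <= z 0 i /\ z 0 i < ((k i)%:R + 1 - N%:R) * s 0 i.
  by move/(_ i); rewrite in_itv /= !mxE => /andP[-> h]; split=> //; move: h; congr (_ < _); ring.
exists (undup [seq c <- [seq corner k | k : {ffun 'I_n -> 'I_(N + N).+1}] | meets c]); split.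
- exact: undup_uniq.
- move=> c c' /=; rewrite !mem_undup !mem_filter => /andP[_ /mapP[k _ ->]] /andP[_ /mapP[k' _ ->]].
  move=> [x [hx hx']]; congr corner; apply/ffunP => i; apply/val_inj => /=.
  have [h1 h2] := cornerE _ _ i hx; have [h3 h4] := cornerE _ _ i hx'.
  have := le_lt_trans h1 h4; have := le_lt_trans h3 h2; rewrite !ltr_pM2r//.
  rewrite !ltrD2r !natr1 !ltr_nat !ltnS => l1 l2.
  by apply/eqP; rewrite eqn_leq l1 l2.
- by move=> c; rewrite mem_undup mem_filter => /andP[/asboolP].
move=> z Zz.
have zb i : 0 <= z 0 i / s 0 i + N%:R /\ z 0 i / s 0 i + N%:R < (N + N)%:R + 1.
  have := ZM z Zz i; rewrite in_itv /= !mxE => /andP[h1 h2].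
  rewrite -(lerBlDr 0) sub0r ler_pdivlMr// natrD -ltrBrDr.
  have := Ns i; rewrite ltr_pdivrMr// => h3; split; first by lra.
  have := s0 i; nra.
have zb' i : (Num.truncn (z 0 i / s 0 i + N%:R)%R < (N + N).+1)%N.
  by have [h1 h2] := zb i; have /andP[h3 _] := truncn_itv h1; rewrite -(ltr_nat R) -natr1; exact: le_lt_trans h3 h2.
pose k := [ffun i => Ordinal (zb' i)].
have kz : cell (corner k) (corner k + s) z.
  move=> i; rewrite in_itv /= !mxE ffunE /=.
  have [h0 _] := zb i; have /andP[h1 h2] := truncn_itv h0.
  rewrite -ler_pdivlMr// lerBlDr h1 /=.
  have -> : forall t, (t - N%:R) * s 0 i + s 0 i = (t + 1 - N%:R) * s 0 i by move=> t; ring.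
  by rewrite -ltr_pdivrMr// ltrBrDr natr1.
exists (corner k) => //; rewrite mem_undup mem_filter map_f ?mem_enum// andbT.
by apply/asboolP; exists z.
Qed.

Lemma cell_sub_box a b : cell a b `<=` box a b.
Proof. by move=> x h i; have := h i; rewrite !in_itv /= => /andP[-> /ltW ->]. Qed.

Lemma cell_near c r x y i : box c (c + r) x -> box c (c + r) y -> `|x 0 i - y 0 i| <= r 0 i.
Proof.
move=> /(_ i) + /(_ i); rewrite !in_itv /= ![(c + r) 0 i]mxE.
move=> /andP[h1 h2] /andP[h3 h4].
by rewrite ler_norml; apply/andP; split; lra.
Qed.

Lemma cell_lebesgue a b : lebesgue_measurable (cell a b).
Proof. by apply: borel_lebesgue_measurable; exact: cell_borel. Qed.

Lemma RI_box_cell a b h : (forall i, a 0 i <= b 0 i) -> Lint (box a b) h ->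
  RI (box a b) h = RI (cell a b) h.
Proof.
move=> ab ih.
have cb := @cell_sub_box a b; have mb := @box_measurable _ _ a b; have mc := cell_lebesgue a b.
have vD : vol (box a b `\` cell a b) = 0%E.
  have := vol_setID mc mb; rewrite (setIidr cb) vol_box// vol_cell//.
  case: (vol _) => [t| |]//; rewrite -EFinD => -[/eqP].
  by rewrite -subr_eq0 opprD addNKr oppr_eq0 => /eqP ->.
rewrite /RI /Rintegral (negligible_integral _ mb ih vD)//; last exact: measurableD.
by rewrite setDD (setIidr cb).
Qed.

(** Local bounds are summed over a grid. Disjointness of the half-open cells is what lets the
    integrals of [h] add up to at most the integral over [U]. *)
Lemma cover_volume Psi Z U s (A : R) h : bounded_set Z -> lebesgue_measurable U ->
  (vol U < +oo)%E -> 0 <= A -> Lint U h -> (forall x, U x -> 0 <= h x) -> (forall i, 0 < s 0 i) ->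
  (forall c z, Z z -> cell c (c + s) z -> cell c (c + s) `<=` U /\
     (vol (Psi @` (Z `&` cell c (c + s))) <= (A * (\prod_i s 0 i) + RI (cell c (c + s)) h)%:E)%E) ->
  (vol (Psi @` Z) <= (A * fine (vol U) + RI U h)%:E)%E.
Proof.
move=> bZ mU Uoo A0 iU h0 s0 hc.
have [cs [ucs tcs meet cov]] := grid_cover s0 bZ.
have csU c : c \in cs -> cell c (c + s) `<=` U /\
   (vol (Psi @` (Z `&` cell c (c + s))) <= (A * (\prod_i s 0 i) + RI (cell c (c + s)) h)%:E)%E.
  by move=> /meet[z [Zz cz]]; exact: hc Zz cz.
apply: (@le_trans _ _ (vol (\big[setU/set0]_(c <- cs) (Psi @` (Z `&` cell c (c + s)))))).
  apply: le_vol => _ [z Zz <-]; have [c ccs cz] := cov z Zz.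
  by rewrite -bigcup_seq; exists c => //; exists z.
apply: le_trans (vol_bigsetU _ _ _) _.
apply: (@le_trans _ _ (\sum_(c <- cs) (RI (cell c (c + s)) (fun x => A + h x))%:E)%E).
  rewrite big_seq [leRHS]big_seq; apply: lee_sum => c ccs; have [cU hv] := csU c ccs.
  apply: le_trans hv _; rewrite lee_fin RID; last 3 first.
  - exact: cell_lebesgue.
  - by apply: Lint_cst; [exact: cell_lebesgue|exact: le_lt_trans (le_vol cU) Uoo].
  - by apply: Lint_sub iU => //; exact: cell_lebesgue.
  rewrite RI_cst; last exact: cell_lebesgue.
  rewrite vol_cell; last by move=> i; rewrite mxE lerDl ltW.
  rewrite /= lerD2r ler_wpM2l// le_eqVlt; apply/orP; left; apply/eqP.
  by apply: eq_bigr => i _; rewrite mxE addrAC subrr add0r.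
rewrite sumEFin lee_fin -(RI_cst _ mU) -RID//; last exact: Lint_cst.
apply: RI_bigsetU => //.
- by move=> c; exact: cell_lebesgue.
- by move=> c /csU[].
- by apply: LintD => //; exact: Lint_cst.
- by move=> x Ux; rewrite addr_ge0// h0.
Qed.

Lemma null_of_small_cover Psi Z (eta0 C : R) U : bounded_set Z -> lebesgue_measurable U -> (vol U < +oo)%E ->
  0 < eta0 -> 0 <= C ->
  (forall eta : R, 0 < eta <= eta0 -> exists2 s : V, (forall i, 0 < s 0 i) &
    forall c z, Z z -> cell c (c + s) z -> cell c (c + s) `<=` U /\
     (vol (Psi @` (Z `&` cell c (c + s))) <= (C * eta * (\prod_i s 0 i))%:E)%E) ->
  vol (Psi @` Z) = 0%E.
Proof.
move=> bZ mU Uoo eta00 C0 hyp; apply/le_anti; rewrite vol_ge0 andbT.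
apply/lee_addgt0Pr => e e0; rewrite add0e.
have D0 : 0 <= C * fine (vol U) by rewrite mulr_ge0// fine_ge0// vol_ge0.
pose D : R := C * fine (vol U) + 1; have D1 : 0 < D by rewrite ltr_wpDl.
pose eta : R := Num.min eta0 (e / D).
have etap : 0 < eta <= eta0 by rewrite lt_min eta00 divr_gt0//= ge_min lexx.
have [s s0 hs] := hyp eta etap.
have [/andP[e1 e2] eD] : 0 < eta <= eta0 /\ eta <= e / D by rewrite etap ge_min lexx orbT.
apply: (@le_trans _ _ (C * eta * fine (vol U) + RI U (fun=> 0))%:E); last first.
  rewrite RI_cst// mul0r addr0 lee_fin mulrAC; move: eD; rewrite ler_pdivlMr// mulrC => eD.
  by apply: le_trans eD; rewrite ler_wpM2r ?(ltW e1)// lerDl.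
apply: (@cover_volume Psi Z U s) => //; first by apply: mulr_ge0 => //; exact: ltW.
  by apply: Lint_cst.
move=> c z Zz cz; have [h1 h2] := hs c z Zz cz; split=> //.
by rewrite RI_cst ?mul0r ?addr0//; exact: cell_lebesgue.
Qed.
End covering.

(** * Oscillation on a cell *)

Section exponents.
Context {R : realType}.
Implicit Types (a b h q t T D : R).

Lemma geometric_sum_le a J : 0 <= a < 1 -> \sum_(j < J) a ^+ j <= (1 - a)^-1.
Proof.
move=> /andP[a0 a1]; have h : 0 < 1 - a by rewrite subr_gt0.
rewrite -[leRHS]mul1r ler_pdivlMr// mulrC -opprB mulNr -subrX1 opprB lerBlDr lerDl.
exact: exprn_ge0.
Qed.

Lemma ltr_powR2 : {homo powR (2 : R) : x y / x < y}.
Proof. by move=> x y xy; rewrite /powR pnatr_eq0 /= ltr_expR ltr_pM2r// ln_gt0 ?ltr1n. Qed.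

(** This is where [k < q] enters: the requirement on [b] is that it exceed 2^((k-1)/(q-1)), whose
    exponent is less than 1. The exponent [g] lies midway between that ratio and 1. *)
Lemma powR_subunit_ratio (k : nat) q : (0 < k)%N -> k%:R < q ->
  exists b, [/\ 0 < b, b < 2 & b `^ (1 - q) * 2 ^+ k.-1 < 1].
Proof.
move=> k0 kq; have k1 : (k.-1%:R : R) = k%:R - 1 by rewrite -[in RHS](prednK k0) -natr1 addrK.
have kn : (1 : R) <= k%:R by rewrite ler1n.
have q1 : 0 < q - 1 by lra.
pose g : R := (k.-1%:R / (q - 1) + 1) / 2.
have g1 : k.-1%:R / (q - 1) < 1 by rewrite ltr_pdivrMr// mul1r k1; lra.
exists (2 `^ g); split; first exact: powR_gt0.
  rewrite -[ltRHS](@powRr1 _ 2)//; apply: ltr_powR2.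
  by rewrite /g; lra.
rewrite -powRrM -powR_mulrn// -powRD; last by rewrite pnatr_eq0 implybT.
rewrite -[ltRHS](powRr0 2); apply: ltr_powR2.
have -> : g * (1 - q) = - (k.-1%:R + (q - 1)) / 2.
  by rewrite /g; field; rewrite gt_eqF.
by rewrite k1; lra.
Qed.

Lemma young_split (v h t q : R) : 1 <= q -> 0 < t -> `|v| `^ q <= h -> `|v| <= t + t `^ (1 - q) * h.
Proof.
move=> q1 t0 vh; have h0 : 0 <= h by apply: le_trans vh; exact: powR_ge0.
have [vt|tv] := leP `|v| t; first by rewrite (le_trans vt)// lerDl mulr_ge0// powR_ge0.
apply: (@le_trans _ _ (t `^ (1 - q) * h)); last by rewrite lerDr ltW.
have v0 : 0 < `|v| by apply: lt_trans tv.
have -> : `|v| = `|v| `^ (1 - q) * `|v| `^ q.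
  by rewrite -powRD ?subrK ?powRr1//; rewrite gt_eqF// implybT.
apply: ler_pM => //; rewrite ?powR_ge0//.
rewrite -[1 - q]opprB !powRN lef_pV2 ?posrE ?powR_gt0//.
by apply: ge0_ler_powR; rewrite ?nnegrE ?subr_ge0// ltW.
Qed.

Lemma powR_ge1 a q : 1 <= a -> 0 <= q -> 1 <= a `^ q.
Proof. by move=> a1 q0; rewrite -(powRr0 a); exact: ler_powR. Qed.

(** The truncation height that balances the two terms of [young_split] when [D] is the mean of [h]
    over a cell. The floor [T] is a free parameter, fixed in [mixed_small_image]. *)
Lemma level_powR q T D : 1 <= q -> 1 <= T -> 0 <= D -> let t := (T `^ q + D) `^ q^-1 in
  [/\ 1 <= t, t `^ q = T `^ q + D & D * t `^ (1 - q) <= t].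
Proof.
move=> q1 T1 D0 t; have q0 : 0 < q by exact: lt_le_trans q1.
have Tq1 : 1 <= T `^ q by apply: powR_ge1 => //; exact: ltW.
have tq : t `^ q = T `^ q + D by rewrite /t -powRrM mulVf ?gt_eqF// powRr1// addr_ge0// powR_ge0.
have t1 : 1 <= t by apply: powR_ge1; [lra|rewrite invr_ge0 ltW].
have t0 : 0 < t by exact: lt_le_trans t1.
split=> //; have -> : t `^ (1 - q) = t / t `^ q.
  by rewrite powRB ?powRr1 ?(ltW t0)// (gt_eqF t0) implybT.
have Dq : D / t `^ q <= 1.
  rewrite ler_pdivrMr; last exact: powR_gt0.
  by rewrite mul1r tq lerDr (le_trans ler01).
by rewrite mulrCA ler_piMr// ltW.
Qed.

Lemma powR_geometric t a q (j : nat) : 0 < t -> 0 < a -> (t * a ^+ j) `^ q = t `^ q * (a `^ q) ^+ j.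
Proof.
move=> t0 a0; rewrite powRM ?exprn_ge0 ?(ltW t0) ?(ltW a0)//; congr (_ * _).
elim: j => [|j IH]; first by rewrite powR1.
by rewrite !exprS powRM ?exprn_ge0 ?(ltW a0)// IH.
Qed.

End exponents.

Section oscillation.
Context {R : realType} {n : nat}.
Local Notation V := 'rV[R]_n.
Implicit Types (a s x y : V) (u h : V -> R) (v : 'I_n -> V -> R) (S : {set 'I_n}).

Lemma prod_zoom_side S s j :
  \prod_i zoom_side S s j 0 i = (\prod_i s 0 i) / 2 ^+ (j * #|S|).
Proof.
rewrite (eq_bigr (fun i => s 0 i * (if i \in S then (2 ^+ j)^-1 else 1))).
  by rewrite big_split /= -big_mkcond /= prodr_const exprVn exprM.
by move=> i _; rewrite mxE; case: ifP => // _; rewrite mulr1.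
Qed.

Lemma zoom_box S y a s j : box a (a + s) y -> (forall i, 0 < s 0 i) ->
  box (zoom_corner S y a j) (zoom_corner S y a j + zoom_side S s j) `<=` box a (a + s).
Proof.
move=> yb s0 x hx i; have := yb i; have := hx i; rewrite !in_itv /= !mxE => /andP[h1 h2] /andP[h3 h4].
have q1 : (2 ^+ j : R)^-1 <= 1 by rewrite invf_le1 ?exprn_gt0// exprn_ege1// ler1n.
have q0 : 0 <= (2 ^+ j : R)^-1 by rewrite invr_ge0 exprn_ge0.
move: h1 h2; case: ifP => _ h1 h2; last by rewrite h1.
by apply/andP; split; nra.
Qed.

(** A Morrey-type estimate that sees only k directions. At the j-th halving the step gains 2^-j and
    the box loses the factor 2^-(jk) of its volume. Truncating the derivatives at height t b^j
    leaves two geometric series, of ratios b/2 and b^(1-q) 2^(k-1); both are less than 1 by the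
    choice of [b]. The constant [B] does not depend on the sides off [S]. *)
Lemma cell_oscillation (k : nat) (q : R) : (0 < k)%N -> k%:R < q -> exists2 B : R, 1 <= B &
  forall S, #|S| = k -> forall a s (rho T : R) u v h y, 0 < rho -> 1 <= T ->
  (forall i, 0 < s 0 i) -> (forall i, i \in S -> s 0 i = rho) ->
  pweak a (a + s) u v -> Lint (box a (a + s)) h ->
  (forall l x, box a (a + s) x -> `|v l x| `^ q <= h x) -> box a (a + s) y ->
  (exists J, forall x, box (zoom_corner S y a J) (zoom_corner S y a J + zoom_side S s J) x -> `|u x - u y| <= rho) ->
  `|average a s u - u y| <= B * rho * (T `^ q + RI (box a (a + s)) h / \prod_i s 0 i) `^ q^-1.
Proof.
move=> k0 kq; have [C C1 kernC] := @kern_bound R.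
have kn : (1 : R) <= k%:R by rewrite ler1n.
have q1 : 1 <= q by lra.
have [b [b0 b2 bq]] := powR_subunit_ratio k0 kq.
pose A1 : R := b / 2; pose A2 : R := b `^ (1 - q) * 2 ^+ k.-1.
have A1p : 0 <= A1 < 1 by rewrite /A1; lra.
have A2p : 0 <= A2 < 1 by rewrite bq andbT mulr_ge0 ?powR_ge0// exprn_ge0.
pose G : R := (1 - A1)^-1 + (1 - A2)^-1.
have G0 : 0 <= G by rewrite addr_ge0// invr_ge0 subr_ge0 ltW//; move: A1p A2p => /andP[_ ?] /andP[_ ?].
pose D : R := (2 * C) ^+ n.
have D1 : 1 <= D by rewrite exprn_ege1//; move: C1; lra.
have DG : 0 <= D * (k%:R * G) by rewrite mulr_ge0//; [move: D1; lra|rewrite mulr_ge0].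
exists (D + D * (k%:R * G)); first by move: D1 DG; lra.
move=> S Sk a s rho T u v h y rho0 T1 s0 Ss pw ih vh yb [J osc].
set Vl := \prod_i s 0 i; set X := RI _ h.
have V0 : 0 < Vl by exact: prodr_gt0.
have h0 x : box a (a + s) x -> 0 <= h x.
  move=> bx; have /card_gt0P[l _] : (0 < #|S|)%N by rewrite Sk.
  by apply: le_trans (vh l x bx); exact: powR_ge0.
have X0 : 0 <= X by exact: RI_ge0.
set t := (_ `^ q^-1).
have XV : 0 <= X / Vl by rewrite divr_ge0// ltW.
have [t1 tq XVt] := level_powR q1 T1 XV; rewrite -/t in t1 tq XVt.
have t0 : 0 < t by exact: lt_le_trans t1.
have D0 : 0 <= D by exact: le_trans D1.
apply: le_trans (average_telescope C1 kernC s0 Ss pw yb (ltW rho0) osc) _.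
rewrite -/D !mulrDl; apply: lerD.
  by rewrite ler_peMr// mulr_ge0// ltW.
apply: (@le_trans _ _ (\sum_(j < J) D * k%:R * rho * t * (A1 ^+ j + A2 ^+ j))); last first.
  rewrite -mulr_sumr big_split /=.
  have -> : D * (k%:R * G) * rho * t = D * k%:R * rho * t * G by ring.
  rewrite ler_wpM2l//; last by rewrite /G lerD// geometric_sum_le.
  by rewrite !mulr_ge0// ltW.
apply: ler_sum => j _.
set bj := box _ _; pose Vj := Vl / 2 ^+ (j * k).
have p2 m : 0 < (2 : R) ^+ m by rewrite exprn_gt0.
have Vj0 : 0 < Vj by rewrite divr_gt0.
have sj0 i : 0 < zoom_side S s j 0 i by rewrite mxE; case: ifP => // _; rewrite divr_gt0.
have volj : vol bj = Vj%:E by rewrite vol_sbox// prod_zoom_side Sk.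
have sub : bj `<=` box a (a + s) by exact: zoom_box.
have mbj : lebesgue_measurable bj by exact: box_measurable.
have mb : lebesgue_measurable (box a (a + s)) by exact: box_measurable.
have ihj : Lint bj h by exact: Lint_sub ih.
have Xj : RI bj h <= X by apply: RI_subset.
pose tj := t * b ^+ j; have tj0 : 0 < tj by rewrite mulr_gt0// exprn_gt0.
have RIv l : RI bj (fun x => `|v l x|) <= tj * Vj + tj `^ (1 - q) * X.
  have [_ iv _] := pw.
  have ivj : Lint bj (fun x => `|v l x|) by apply: Lint_abs => //; exact: Lint_sub (iv l).
  have icj : Lint bj (fun=> tj) by apply: Lint_cst => //; rewrite volj ltry.
  apply: (@le_trans _ _ (RI bj (fun x => tj + tj `^ (1 - q) * h x))).
    apply: RI_le => //; first by apply: LintD => //; exact: LintZ.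
    by move=> x bx; apply: young_split => //; apply: vh; exact: sub.
  rewrite RID//; last exact: LintZ.
  by rewrite RI_cst// RIZ// volj /= lerD2l ler_wpM2l// powR_ge0.
have Wj : weight C (zoom_side S s j) = D / Vj.
  by rewrite /D -(weight_vol C sj0) prod_zoom_side Sk -/Vl -/Vj mulfK// gt_eqF.
rewrite Wj.
apply: (@le_trans _ _ (rho / 2 ^+ j * (D / Vj) * (k%:R * (tj * Vj + tj `^ (1 - q) * X)))).
  apply: ler_wpM2l; first by rewrite !mulr_ge0// ?invr_ge0 ltW.
  rewrite -Sk mulr_natl -sumr_const.
  by apply: ler_sum.
have tjq : tj `^ (1 - q) = t `^ (1 - q) * (b `^ (1 - q)) ^+ j.
  exact: powR_geometric.
have -> : rho / 2 ^+ j * (D / Vj) * (k%:R * (tj * Vj + tj `^ (1 - q) * X)) =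
  D * k%:R * rho * (t * A1 ^+ j + X / Vl * t `^ (1 - q) * A2 ^+ j).
  rewrite tjq /tj /Vj /A1 /A2 !exprMn exprVn.
  have -> : (j * k = j + k.-1 * j)%N by rewrite mulnC -[in LHS](prednK k0) mulSn.
  rewrite exprD exprM; field.
  by rewrite !gt_eqF// ?exprn_gt0.
rewrite -!mulrA ler_wpM2l//.
rewrite ler_wpM2l// ler_wpM2l ?(ltW rho0)// mulrDr lerD2l !mulrA ler_wpM2r//.
by apply: exprn_ge0; case/andP: A2p.
Qed.

End oscillation.

(** * Images of small sets *)

Section small_sets.
Context {R : realType} {n : nat}.
Local Notation V := 'rV[R]_n.
Local Notation LT := (lebesgue_type R n).
Implicit Types (a b c s x y z : V) (K U Z Om : set V) (u h : V -> R) (v : 'I_n -> V -> R) (S : {set 'I_n}).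

Lemma thicken_open K (r : R) : open (thicken K r).
Proof.
apply: ball_openP => x [y Ky xy]; exists (r - `|x - y|); first by rewrite subr_gt0.
move=> z xz; exists y => //; apply: le_lt_trans (ler_distD x z y) _.
by rewrite (distrC z x) -ltrBrDr.
Qed.

Lemma thicken_bounded K (r : R) : bounded_set K -> bounded_set (thicken K r).
Proof.
move=> bK; have [M M0 KM] := bounded_cube bK.
exists (M + `|r|); split; first exact: num_real.
move=> M' MM' x [y Ky xy] /=.
have yM : `|y| <= M.
  apply/rV_norm_leP; first exact: ltW.
  by move=> i; have := KM y Ky i; rewrite in_itv /= !mxE ler_norml.
have := ler_distD y x 0; rewrite !subr0; have := ler_norm r; lra.
Qed.

Lemma compact_thicken_sub K Om : compact K -> open Om -> K `<=` Om ->
  exists2 r : R, 0 < r & thicken K r `<=` Om.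
Proof.
move=> cK oOm KO; have /compact_near_coveringP ncK := cK.
pose P (d : R) x := forall y, `|y - x| < d -> Om y.
have near0 : \forall d \near 0^'+, K `<=` P d.
  apply: (ncK _ (0^'+) P _) => x Kx; have [d d0 hd] := open_ballP oOm (KO x Kx).
  have d20 : 0 < d / 2 by lra.
  exists (ball x (d/2), [set t : R | t < d / 2]) => /=.
    by split; [exact: nbhsx_ballx|exact: nbhs_right_lt].
  move=> [y t] /= []; rewrite -ball_normE /= => xy td z yz; apply: hd.
  by have := ler_distD y x z; rewrite (distrC y z); lra.
near (0 : R)^'+ => d; exists d; first by near: d; exact: nbhs_right_gt.
have dP : K `<=` P d by near: d.
by move=> x [y Ky xy]; exact: dP Ky _ xy.
Unshelve. all: by end_near. Qed.

Lemma Lp_Lint Om (p : R) u : open Om -> 1 <= p -> Lp Om p u -> Lint Om (fun x => `|u x| `^ p).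
Proof.
move=> oOm p1 /(Lfun_integrable p1) iu.
have mOm : lebesgue_measurable Om by exact: open_lebesgue.
have := integrableS measurableT mOm (@subsetT _ _) iu; apply: eq_integrable => // x.
by rewrite inE /= => Ox; rewrite /patch mem_set.
Qed.

Lemma half_pow_lt (d : R) : 0 < d -> exists J, (2 ^+ J)^-1 < d.
Proof.
move=> d0; exists (Num.truncn d^-1).+1; rewrite invf_plt ?posrE ?exprn_gt0//.
apply: lt_trans (truncnS_gt _) _.
by rewrite -natrX ltr_nat; exact: ltn_expl.
Qed.

(** Write t^k as t^q t^(k-q) and use that t is at least [T] while k - q is negative. The bound is
    linear in [D], with a coefficient that is small for large [T]. *)
Lemma level_powR_le (k : nat) (q T D : R) : (0 < k)%N -> k%:R < q -> 1 <= T -> 0 <= D ->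
  ((T `^ q + D) `^ q^-1) ^+ k <= T ^+ k + T `^ (k%:R - q) * D.
Proof.
move=> k0 kq T1 D0; have k1 : (1 : R) <= k%:R by rewrite ler1n.
have q1 : 1 <= q by lra.
have [t1 tq _] := level_powR q1 T1 D0; set t := _ `^ q^-1 in t1 tq *.
have T0 : 0 < T by lra.
have t0 : 0 < t by lra.
have Tt : T <= t.
  have e : T = (T `^ q) `^ q^-1 by rewrite -powRrM mulfV ?powRr1 ?gt_eqF//; lra.
  rewrite [leLHS]e; apply: ge0_ler_powR; rewrite ?nnegrE ?addr_ge0 ?powR_ge0 ?invr_ge0 ?lerDl//.
  exact: le_trans ler01 q1.
rewrite -powR_mulrn ?(ltW t0)//.
have -> : t `^ k%:R = (T `^ q + D) * t `^ (k%:R - q).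
  by rewrite -tq -powRD ?(gt_eqF t0) ?implybT//; congr (_ `^ _); ring.
have -> : T ^+ k = T `^ q * T `^ (k%:R - q).
  by rewrite -powRD ?(gt_eqF T0) ?implybT// -powR_mulrn ?(ltW T0)//; congr (_ `^ _); ring.
rewrite [_ `^ _ * D]mulrC -mulrDl ler_wpM2l//; first by rewrite addr_ge0// powR_ge0.
rewrite -[k%:R - q]opprB !powRN lef_pV2 ?posrE; [|exact: powR_gt0..].
by apply: ge0_ler_powR; rewrite ?nnegrE// ?subr_ge0 ltW.
Qed.

(** The reindexing [sigma] is the identity in the first bound; in the second it records which
    coordinates complete the chosen rows. *)
Definition mixed S (sigma : 'I_n -> 'I_n) (g : V -> V) y : V :=
  \row_i (if i \in S then g y 0 (sigma i) else y 0 i).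

(** By [cell_oscillation] a cell goes into a box with sides [2 * B * rho * t] along [S] and its own
    sides elsewhere, hence of volume [P * t ^+ k * Vl]. By [level_powR_le] this splits into a
    multiple of the volume and a multiple of the integral of [h]. The level [T] makes the second sum
    small; only then is [d] chosen, to make the first one small. *)
Lemma mixed_small_image Om S sigma (k : nat) (q : R) (g : V -> V) (Dg : V -> 'M[R]_n) :
  open Om -> (0 < k)%N -> k%:R < q -> #|S| = k ->
  {within Om, continuous g} -> weak_jacobian Om g Dg ->
  (forall i j, Lp Om q (fun x => Dg x i j)) ->
  forall e : R, 0 < e -> exists2 d : R, 0 < d & forall Z, compact Z -> Z `<=` Om ->
    (vol Z < d%:E)%E -> (vol (mixed S sigma g @` Z) <= e%:E)%E.
Proof.
move=> oOm k0 kq Sk cg wg Lg e e0; have k1 : (1 : R) <= k%:R by rewrite ler1n.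
have q1 : 1 <= q by lra.
have mOm : lebesgue_measurable Om by exact: open_lebesgue.
pose h x : R := \sum_i \sum_j `|Dg x i j| `^ q.
have hh i j x : `|Dg x i j| `^ q <= h x.
  rewrite /h (bigD1 i)//= (bigD1 j)//= -addrA lerDl addr_ge0//; apply: sumr_ge0 => l _.
    exact: powR_ge0.
  by apply: sumr_ge0 => m _; exact: powR_ge0.
have h0 x : 0 <= h x by apply: sumr_ge0 => i _; apply: sumr_ge0 => j _; exact: powR_ge0.
have ih : Lint Om h.
  by apply: Lint_sum => // i _; apply: Lint_sum => // j _; exact: Lp_Lint.
have [B B1 hB] := @cell_oscillation R n k q k0 kq.
have B0 : 0 < B by exact: lt_le_trans B1.
pose P : R := (2 * B) ^+ k; have P0 : 0 < P by rewrite exprn_gt0// mulr_gt0.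
pose H := RI Om h; have H0 : 0 <= H by exact: RI_ge0.
pose T : R := (2 * P * H / e + 1) `^ (q - k%:R)^-1.
have w0 : 0 <= 2 * P * H / e by rewrite divr_ge0 ?(ltW e0)// !mulr_ge0// ltW.
have T1 : 1 <= T by apply: powR_ge1; [rewrite lerDr|rewrite invr_ge0 subr_ge0 ltW].
have TH : P * T `^ (k%:R - q) * H <= e / 2.
  rewrite -opprB powRN /T -powRrM mulVf ?powRr1; [|lra..].
  have -> : P / (2 * P * H / e + 1) * H = e / 2 * ((2 * P * H / e) / (2 * P * H / e + 1)).
    by rewrite mulrA -[P / _ * H]mulrAC; congr (_ / _); field; rewrite gt_eqF.
  by rewrite ler_piMr ?divr_ge0 ?(ltW e0)// ler_pdivrMr ?mul1r ?lerDl// ltr_wpDl.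
have T0 : 0 < T by exact: lt_le_trans T1.
have PT0 : 0 < P * T ^+ k by rewrite mulr_gt0// exprn_gt0.
exists (e / 2 / (P * T ^+ k)); first by rewrite !divr_gt0.
move=> Z cZ ZO Zd.
have [r1 r10 hr1] := compact_outer_regular cZ Zd.
have [r2 r20 hr2] := compact_thicken_sub cZ oOm ZO.
pose r0 : R := Num.min r1 r2; have r00 : 0 < r0 by rewrite lt_min r10.
pose U := thicken Z r0.
have U1 : U `<=` thicken Z r1 by move=> x [y Zy xy]; exists y => //; move: xy; rewrite lt_min => /andP[].
have U2 : U `<=` Om by move=> x [y Zy xy]; apply: hr2; exists y => //; move: xy; rewrite lt_min => /andP[].
have oU : open U by exact: thicken_open.
have mU : lebesgue_measurable U by exact: open_lebesgue.
have Ud : (vol U < (e / 2 / (P * T ^+ k))%:E)%E by exact: le_lt_trans (le_vol U1) hr1.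
have Uoo : (vol U < +oo)%E by apply: lt_trans Ud _; rewrite ltry.
have bZ : bounded_set Z by exact: compact_bounded.
pose rho : R := r0 / 2; have rho0 : 0 < rho by rewrite divr_gt0.
have [d d0 hd] := compact_unif_continuous_near cZ ZO cg rho0.
(* The thin sides: once the sides along [S] have been halved below [s0], the whole box lies within
   the range [d] of uniform continuity, and [g] oscillates by at most [rho] on it. *)
pose s0 : R := Num.min rho (d / 2); have s00 : 0 < s0 by rewrite lt_min rho0 divr_gt0.
have [s0rho s0d] : s0 <= rho /\ s0 <= d / 2 by rewrite !ge_min !lexx orbT.
pose s : V := \row_i (if i \in S then rho else s0).
have sp i : 0 < s 0 i by rewrite mxE; case: ifP.
have srho i : s 0 i <= rho by rewrite mxE; case: ifP.
have Ss i : i \in S -> s 0 i = rho by rewrite mxE => ->.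
have cw : 0 <= P * T `^ (k%:R - q) by rewrite mulr_ge0 ?powR_ge0// ltW.
have iU : Lint U h by exact: Lint_sub ih.
apply: (@le_trans _ _ (P * T ^+ k * fine (vol U) + RI U (fun x => P * T `^ (k%:R - q) * h x))%:E); last first.
  rewrite lee_fin RIZ//.
  have l1 : P * T ^+ k * fine (vol U) <= e / 2.
    rewrite mulrC -ler_pdivlMr// -lee_fin -vol_fine//; exact: ltW.
  have l2 : P * T `^ (k%:R - q) * RI U h <= e / 2.
    by apply: le_trans TH; rewrite ler_wpM2l//; exact: RI_subset.
  by move: l1 l2; clear -n; lra.
apply: (@cover_volume _ _ _ _ _ s) => //; first exact: ltW.
- exact: LintZ.
- by move=> x _; rewrite mulr_ge0.
move=> c z Zz cz.
have near_z x (bx : box c (c + s) x) i : `|x 0 i - z 0 i| <= s 0 i := cell_near i bx (cell_sub_box cz).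
have bU : box c (c + s) `<=` U.
  move=> x bx; exists z => //; apply: (@le_lt_trans _ _ rho); last by rewrite ltr_pdivrMr// ltr_pMr// ltr1n.
  apply/rV_norm_leP; first exact: ltW.
  by move=> i; rewrite !mxE; apply: le_trans (near_z x bx i) _.
have bO : box c (c + s) `<=` Om by exact: subset_trans bU U2.
split; first exact: subset_trans (@cell_sub_box _ _ _ _) bU.
have ihc : Lint (box c (c + s)) h by apply: Lint_sub ih => //; exact: box_measurable.
set Vl := \prod_i s 0 i; have Vl0 : 0 < Vl by exact: prodr_gt0.
pose X := RI (box c (c + s)) h; have X0 : 0 <= X by exact: RI_ge0.
pose t : R := (T `^ q + X / Vl) `^ q^-1.
pose av i := average c s (fun x => g x 0 (sigma i)).
have osc i y : (Z `&` cell c (c + s)) y -> `|av i - g y 0 (sigma i)| <= B * rho * t.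
  move=> [Zy cy]; apply: (hB S Sk c s rho T _ (fun j x => Dg x (sigma i) j)) => //.
  - by apply: weak_partial_pweak bO => j; exact: wg.
  - exact: cell_sub_box.
  have [J hJ] : exists J, rho / 2 ^+ J <= s0.
    have [J hJ] := @half_pow_lt (s0 / rho) (divr_gt0 s00 rho0).
    by exists J; rewrite mulrC -ler_pdivlMr// ltW.
  exists J => x bx.
  have -> : g x 0 (sigma i) - g y 0 (sigma i) = (g x - g y) 0 (sigma i) by rewrite !mxE.
  apply: le_trans (le_coord_norm _ _) _; rewrite distrC; apply: ltW; apply: hd => //.
    by apply: bO; apply: zoom_box bx => //; exact: cell_sub_box.
  apply: (@le_lt_trans _ _ s0); last by move: s0d d0; clear -n; lra.
  apply/rV_norm_leP; first exact: ltW.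
  move=> l; have := bx l; have := cell_sub_box cy l; rewrite !in_itv /= !mxE.
  have r2J : 0 <= rho / 2 ^+ J by rewrite divr_ge0 ?exprn_ge0// ltW.
  have q1' : (2 ^+ J : R)^-1 <= 1 by rewrite invf_le1 ?exprn_gt0// exprn_ege1// ler1n.
  have q0' : 0 <= (2 ^+ J : R)^-1 by rewrite invr_ge0 exprn_ge0.
  case: ifP => _ /andP[h1 h2] /andP[h3 h4]; rewrite ler_norml.
  2: by apply/andP; split; move: h1 h2 h3 h4; clear -n; lra.
  have h5 : (y 0 l - c 0 l) / 2 ^+ J <= rho / 2 ^+ J by rewrite ler_wpM2r// lerBlDl.
  have h6 : 0 <= (y 0 l - c 0 l) / 2 ^+ J by rewrite mulr_ge0// subr_ge0.
  by apply/andP; split; move: h3 h4 h5 h6 hJ r2J; clear -n; lra.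
pose lo : V := \row_i (if i \in S then av i - B * rho * t else c 0 i).
pose hi : V := \row_i (if i \in S then av i + B * rho * t else c 0 i + s 0 i).
have loE i : lo 0 i = if i \in S then av i - B * rho * t else c 0 i by rewrite mxE.
have hiE i : hi 0 i = if i \in S then av i + B * rho * t else c 0 i + s 0 i by rewrite mxE.
have t0 : 0 <= t by exact: powR_ge0.
have Brt : 0 <= B * rho * t by rewrite !mulr_ge0// ltW.
have lohi i : lo 0 i <= hi 0 i.
  rewrite loE hiE; case: ifP => _; last by rewrite lerDl ltW.
  by rewrite lerD2l (le_trans _ Brt)// oppr_le0.
have sub : mixed S sigma g @` (Z `&` cell c (c + s)) `<=` box lo hi.
  move=> _ [y [Zy cy] <-] i; rewrite in_itv /= loE hiE mxE; case: ifP => iS.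
    by have := osc i y (conj Zy cy); rewrite distrC ler_distl.
  by have := cell_sub_box cy i; rewrite in_itv /= [(c + s) 0 i]mxE.
apply: le_trans (le_vol sub) _; rewrite vol_box// lee_fin.
have -> : \prod_(i < n) (hi 0 i - lo 0 i) = P * t ^+ k * Vl.
  rewrite (eq_bigr (fun i => s 0 i * (if i \in S then 2 * B * t else 1))).
    by rewrite big_split /= -big_mkcond /= prodr_const Sk /P -exprMn mulrC.
  move=> i _; rewrite loE hiE; case: ifP => iS; last by rewrite mulr1 addrAC subrr add0r.
  by rewrite Ss//; ring.
rewrite RIZ//; last 2 first.
- exact: cell_lebesgue.
- by apply: Lint_sub ihc; [exact: box_measurable|exact: cell_lebesgue|exact: cell_sub_box].
rewrite -(RI_box_cell _ ihc); last by move=> i; rewrite mxE lerDl ltW.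
have := level_powR_le k0 kq T1 (divr_ge0 X0 (ltW Vl0)); rewrite -/t => ht.
apply: (@le_trans _ _ (P * (T ^+ k + T `^ (k%:R - q) * (X / Vl)) * Vl)).
  by rewrite ler_wpM2r ?(ltW Vl0)// ler_wpM2l// ltW.
apply: eqW; rewrite -/X.
by field; rewrite gt_eqF.
Qed.

End small_sets.

(** * Maximal function and level sets *)

Section maximal.
Context {R : realType} {n : nat}.
Local Notation V := 'rV[R]_n.
Local Notation LT := (lebesgue_type R n).
Implicit Types (a b c s x y z : V) (K U Z N : set V) (F : V -> R).

Definition dball (p : V * R) : set V := [set x | `|p.1 - x| <= p.2].

Lemma dballE c (r : R) : 0 <= r -> dball (c, r) = box (c - const_mx r) (c + const_mx r).
Proof.
move=> r0; apply/seteqP; split => x; rewrite /dball /=.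
  move=> /(rV_norm_leP _ r0) h i; have := h i; rewrite in_itv /= !mxE ler_norml => /andP[h1 h2].
  by apply/andP; split; lra.
move=> h; apply/rV_norm_leP => // i; have := h i; rewrite in_itv /= !mxE ler_norml => /andP[h1 h2].
by apply/andP; split; lra.
Qed.

Lemma dball_measurable p : 0 <= p.2 -> lebesgue_measurable (dball p).
Proof. by case: p => c r /= r0; rewrite dballE//; exact: box_measurable. Qed.

Lemma vol_dball c (r : R) : 0 <= r -> vol (dball (c, r)) = ((2 * r) ^+ n)%:E.
Proof.
move=> r0; rewrite dballE// vol_box; last by move=> i; rewrite !mxE; lra.
congr EFin; rewrite (eq_bigr (fun=> 2 * r)) ?prodr_const ?card_ord// => i _.
by rewrite !mxE; ring.
Qed.

Lemma seq_argmax (I : eqType) (f : I -> R) (s : seq I) : s != [::] ->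
  exists2 d, d \in s & forall i, i \in s -> f i <= f d.
Proof.
elim: s => // a [|b s] IH _; first by exists a => [|i]; rewrite inE// => /eqP ->.
have [//|d ds hd] := IH; have [ad|da] := leP (f a) (f d).
  by exists d; [rewrite inE ds orbT|move=> i /[1!inE] /predU1P[->//|/hd]].
exists a; first by rewrite inE eqxx.
by move=> i /[1!inE] /predU1P[->//|/hd h]; exact: le_trans h (ltW da).
Qed.

(** Greedy selection: keep a ball of largest radius, discard all balls that it meets, and recurse on
    the others. *)
Lemma vitali_finite (s : seq (V * R)) : (forall p, p \in s -> 0 < p.2) ->
  exists D : seq (V * R), [/\ uniq D, {subset D <= s},
    forall p q, p \in D -> q \in D -> p != q -> p.2 + q.2 < `|p.1 - q.1| &
    forall p, p \in s -> exists q, [/\ q \in D, p.2 <= q.2 & `|p.1 - q.1| <= p.2 + q.2]].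
Proof.
have [m] := ubnP (size s); elim: m s => // m IH s sm s0.
have [->|sn0] := eqVneq s [::]; first by exists [::].
have [d ds hd] := seq_argmax snd sn0.
pose far p := p.2 + d.2 < `|p.1 - d.1|.
have dfar : ~~ far d by rewrite /far subrr normr0 -leNgt addr_ge0 ?ltW ?s0.
have [||D [uD Ds Dd hD]] := IH [seq p <- s | far p].
- rewrite size_filter; apply: leq_trans (_ : (size s <= m)%N); last by rewrite -ltnS.
  rewrite -(count_predC far s) -[X in (X < _)%N]addn0 ltn_add2l -has_count.
  by apply/hasP; exists d.
- by move=> p; rewrite mem_filter => /andP[_ /s0].
exists (d :: D); split.
- rewrite /= uD andbT; apply/negP => /Ds; rewrite mem_filter => /andP[dd _].
  by rewrite dd in dfar.
- by move=> p; rewrite inE => /predU1P[->//|/Ds]; rewrite mem_filter => /andP[].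
- have fD p : p \in D -> far p by move=> /Ds; rewrite mem_filter => /andP[].
  move=> p q; rewrite !inE => /predU1P[->|pD] /predU1P[->|qD]; rewrite ?eqxx// => pq.
  + by rewrite addrC distrC; exact: fD.
  + exact: fD.
  + exact: Dd.
move=> p ps; have [pf|pf] := boolP (far p).
  have [|q [qD pq hq]] := hD p; first by rewrite mem_filter pf.
  by exists q; rewrite inE qD orbT.
by exists d; rewrite inE eqxx; split=> //; [exact: hd|rewrite leNgt].
Qed.

Definition maximal_bad N F (lam : R) : set V := [set x | exists c (r : R),
  [/\ 0 < r, dball (c, r) `<=` N, lam * (2 * r) ^+ n < RI (dball (c, r)) F & `|c - x| < r]].

Lemma maximal_bad_open N F lam : open (maximal_bad N F lam).
Proof.
apply: ball_openP => x [c [r [r0 cN hF cx]]]; exists (r - `|c - x|); first by rewrite subr_gt0.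
move=> y xy; exists c, r; split=> //; apply: le_lt_trans (ler_distD x c y) _.
by rewrite addrC -ltrBrDr.
Qed.

(** The weak type inequality of Hardy and Littlewood. A compact subset of almost full measure has a
    finite cover by bad cubes, whose disjoint Vitali subfamily covers it after dilation by 3. *)
Lemma vol_maximal_bad N F (lam : R) : lebesgue_measurable N -> bounded_set N -> Lint N F ->
  (forall x, N x -> 0 <= F x) -> 0 < lam ->
  (vol (maximal_bad N F lam) <= (3 ^+ n / lam * RI N F)%:E)%E.
Proof.
move=> mN bN iF F0 lam0.
pose B := maximal_bad N F lam.
have BN : B `<=` N by move=> x [c [r [r0 cN _ cx]]]; apply: cN; exact: ltW.
have mB : lebesgue_measurable B by apply: open_lebesgue; exact: maximal_bad_open.
have bB : bounded_set B by exact: bounded_sub bN BN.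
have mNB : 0 <= 3 ^+ n / lam * RI N F by rewrite mulr_ge0 ?RI_ge0// divr_ge0 ?exprn_ge0// ltW.
apply/lee_addgt0Pr => e e0.
have [K [cK KB hK]] := lebesgue_inner_regular mB bB e0.
have BK : B `<=` K `|` (B `\` K) by move=> x Bx; have [|] := pselect (K x); [left|right].
apply: le_trans (le_vol BK) _; apply: le_trans (volU2 _ _) _; apply: leeD => //.
pose good (p : V * R) := [/\ 0 < p.2, dball p `<=` N & lam * (2 * p.2) ^+ n < RI (dball p) F].
have := cK; rewrite compact_cover => /(_ (V * R)%type [set p | good p] (fun p : V * R => [set x | `|p.1 - x| < p.2])).
case.
- move=> p _; apply: ball_openP => x /= px; exists (p.2 - `|p.1 - x|); first by rewrite subr_gt0.
  move=> y xy; apply: le_lt_trans (ler_distD x p.1 y) _.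
  by rewrite addrC -ltrBrDr.
- by move=> x /KB[c [r [r0 cN hF cx]]]; exists (c, r).
move=> Dc Dgood Kcov.
have good_seq p : p \in finmap.enum_fset Dc -> good p by move=> /Dgood; rewrite inE.
have [|D [uD Ds Dd hD]] := @vitali_finite (finmap.enum_fset Dc); first by move=> p /good_seq[].
have Dg p : p \in D -> good p by move=> /Ds /good_seq.
have cov3 : K `<=` \big[setU/set0]_(q <- D) dball (q.1, 3 * q.2).
  move=> x /Kcov[p /= pD px]; have [q [qD pq hq]] := hD p pD.
  rewrite -bigcup_seq; exists q => //; rewrite /dball /=.
  have := ler_distD p.1 q.1 x; rewrite (distrC q.1 p.1); move: hq px pq; clear -n; lra.
apply: le_trans (le_vol cov3) _; apply: le_trans (vol_bigsetU _ _ _) _.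
apply: (@le_trans _ _ (\sum_(q <- D) (3 ^+ n / lam * RI (dball q) F)%:E)%E).
  rewrite big_seq [leRHS]big_seq; apply: lee_sum => q /Dg[q0 qN hq].
  rewrite vol_dball; last by rewrite mulr_ge0// ltW.
  rewrite lee_fin mulrCA exprMn -mulrA ler_wpM2l ?exprn_ge0//.
  by rewrite ler_pdivlMl// ltW.
rewrite sumEFin lee_fin -mulr_sumr ler_wpM2l//; first by rewrite divr_ge0 ?exprn_ge0// ltW.
rewrite big_seq (eq_bigr (fun q => RI (if 0 < q.2 then dball q else set0) F)); last first.
  by move=> q /Dg[-> _ _].
rewrite -big_seq; apply: RI_bigsetU => //.
- by move=> q; case: ifP => q0; [apply: dball_measurable; exact: ltW|exact: measurable0].
- by move=> q /Dg[q0 qN _]; rewrite q0.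
move=> p q /= pD qD; have [p0 _ _] := Dg p pD; have [q0 _ _] := Dg q qD; rewrite p0 q0.
move=> [x [/= px qx]]; apply/eqP/negPn/negP => pq; have := Dd p q pD qD pq.
apply/negP; rewrite -leNgt; apply: le_trans (ler_distD x p.1 q.1) _.
by rewrite lerD// distrC.
Qed.

End maximal.

(** * Lusin-type approximation on compact sets *)

Section nearly_continuous.
Context {R : realType} {n : nat}.
Local Notation V := 'rV[R]_n.
Local Notation LT := (lebesgue_type R n).
Implicit Types (a b c s x y z : V) (K U Z N P A : set V) (F : V -> R) (v : 'I_n -> V -> R).

Lemma bigsetU_finP (I : finType) (Q : pred I) (K : I -> set V) x :
  (\big[setU/set0]_(i | Q i) K i) x <-> exists2 i, Q i & K i x.
Proof.
rewrite -bigcup_seq_cond; split=> [[i /= /andP[_ Qi] Kx]|[i Qi Kx]]; exists i => //=.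
by rewrite mem_index_enum.
Qed.

(** Lusin's theorem for a map with finitely many values: choose a compact subset of each level set;
    disjoint compact sets are at positive distance. *)
Lemma partition_compact (I : finType) (kappa : V -> I) P : bounded_set P ->
  (forall i, lebesgue_measurable (P `&` [set x | kappa x = i])) ->
  forall e : R, 0 < e -> exists C, [/\ compact C, C `<=` P, (vol (P `\` C) <= e%:E)%E &
    exists2 d : R, 0 < d & forall x y, C x -> C y -> `|x - y| < d -> kappa x = kappa y].
Proof.
move=> bP mP e e0; pose m : R := #|I|.+1%:R; have m0 : 0 < m by rewrite ltr0n.
pose Pi i := P `&` [set x | kappa x = i].
have bPi i : bounded_set (Pi i).
  by apply: bounded_sub bP _; exact: subIsetl.
have /choice[K hK] i : exists K, [/\ compact K, K `<=` Pi i & (vol (Pi i `\` K) <= (e / m)%:E)%E].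
  by apply: lebesgue_inner_regular; rewrite ?divr_gt0//; exact: mP.
pose C := \big[setU/set0]_(i : I) K i.
have CE x : C x <-> exists i, K i x.
  by split=> [/bigsetU_finP[i _]|[i Kx]]; [exists i|apply/bigsetU_finP; exists i].
have Kk i x : K i x -> kappa x = i by have [_ Ki _] := hK i => /Ki[].
pose O i := ~` (\big[setU/set0]_(j | j != i) K j).
have cO i : open (O i).
  apply: closed_openC; apply: compact_closed_rV; apply: bigsetU_compact => j _; by have [] := hK j.
have /choice[d hd] i : exists d : R, 0 < d /\ thicken (K i) d `<=` O i.
  have [cK _ _] := hK i; have [|r r0 hr] := compact_thicken_sub cK (cO i); last by exists r.
  move=> x Kx /bigsetU_finP[j ji /Kk xj]; move: ji; rewrite -xj.
  by rewrite (Kk i x Kx) eqxx.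
exists C; split.
- by apply: bigsetU_compact => i _; have [] := hK i.
- by move=> x /CE[i Kix]; have [_ Ki _] := hK i; have [] := Ki x Kix.
- have PC : P `\` C `<=` \big[setU/set0]_(i : I) (Pi i `\` K i).
    move=> x [Px nC]; apply/bigsetU_finP; exists (kappa x) => //; split=> // Kx.
    by apply: nC; apply/CE; exists (kappa x).
  apply: le_trans (le_vol PC) _; apply: le_trans (vol_bigsetU _ _ _) _.
  apply: (@le_trans _ _ (\sum_(i : I) (e / m)%:E)%E); first by apply: lee_sum => i _; have [] := hK i.
  rewrite sumEFin lee_fin sumr_const -mulr_natr mulrAC -mulrA ler_piMr ?(ltW e0)//.
  by rewrite ler_pdivrMr// mul1r ler_nat; apply: leq_trans (leqnSn _); exact: max_card.
exists (\big[Num.min/1]_(i : I) d i).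
  by elim/big_ind: _ => // [x y x0 y0|i _]; [rewrite lt_min x0|have [] := hd i].
move=> x y /CE[i Kix] /CE[j Kjy] xy; rewrite (Kk i x Kix) (Kk j y Kjy); apply/eqP/negPn/negP => ij.
have [_ dO] := hd i; have [|] := dO y.
  by exists x => //; rewrite distrC; apply: lt_le_trans xy _; exact: bigmin_le_cond.
by apply/bigsetU_finP; exists j => //; rewrite eq_sym.
Qed.

Lemma truncn_level_near (t s th : R) : 0 < th -> 0 <= t -> 0 <= s ->
  Num.truncn (t / th) = Num.truncn (s / th) -> `|t - s| <= th.
Proof.
move=> th0 t0 s0 e; have /andP[h1 h2] := truncn_itv (divr_ge0 t0 (ltW th0)).
have /andP[h3 h4] := truncn_itv (divr_ge0 s0 (ltW th0)).
rewrite e in h1 h2; rewrite -natr1 in h2 h4.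
move: h1 h2 h3 h4; rewrite ler_pdivlMr// ltr_pdivrMr// ler_pdivlMr// ltr_pdivrMr// => h1 h2 h3 h4.
by rewrite ler_norml; apply/andP; split; lra.
Qed.

(** Lusin at a fixed precision: the values are sorted into finitely many slots of width [th], and
    the vector of slot numbers is a map with finitely many values. *)
Lemma small_oscillation_compact P v (M : R) : bounded_set P -> lebesgue_measurable P ->
  (forall l, measurable_fun (P : set LT) (v l : LT -> R)) ->
  (forall l x, P x -> `|v l x| <= M) ->
  forall e th : R, 0 < e -> 0 < th -> exists C, [/\ compact C, C `<=` P, (vol (P `\` C) <= e%:E)%E &
    exists2 d : R, 0 < d & forall x y, C x -> C y -> `|x - y| < d -> forall l, `|v l x - v l y| <= th].
Proof.
move=> bP mP mv vM e th e0 th0.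
pose K := Num.truncn (2 * M / th).
pose kap x : {ffun 'I_n -> 'I_K.+1} := [ffun l => inord (Num.truncn ((v l x + M) / th))].
have vM0 l x : P x -> 0 <= v l x + M by move=> /(vM l); rewrite ler_norml => /andP[h _]; lra.
have kapE l x : P x -> kap x l = Num.truncn ((v l x + M) / th) :> nat.
  move=> Px; rewrite ffunE inordK// ltnS /K; apply: le_truncn.
  by rewrite ler_pM2r ?invr_gt0//; have := vM l x Px; rewrite ler_norml => /andP[_ h]; lra.
have [|C [cC CP hC [d d0 hd]]] := @partition_compact _ kap P bP _ e e0; last first.
  exists C; split=> //; exists d => // x y Cx Cy xy l.
  have -> : v l x - v l y = (v l x + M) - (v l y + M) by ring.
  apply: truncn_level_near => //; try exact: vM0 (CP _ _).
  by rewrite -!kapE ?(hd x y)//; exact: CP.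
move=> i.
  have -> : P `&` [set x | kap x = i] = P `&` \bigcap_(l in [set: 'I_n])
      (P `&` v l @^-1` `[(i l)%:R * th - M, (i l).+1%:R * th - M[%classic).
    have key l x : P x -> (kap x l = i l) <-> (`[(i l)%:R * th - M, (i l).+1%:R * th - M[%classic (v l x)).
      move=> Px; rewrite /= in_itv /= lerBlDr ltrBrDr -ler_pdivlMr// -ltr_pdivrMr//.
      rewrite -truncn_eq ?divr_ge0 ?vM0 ?ltW// -kapE//; split=> [->|/eqP h]; first exact/eqP.
      exact/val_inj.
    apply/seteqP; split => x [Px h]; split=> //.
      by move=> l _; split=> //; apply/key => //; rewrite h.
    by apply/ffunP => l; apply/key => //; have [] := h l Logic.I.
  apply: measurableI => //; apply: fin_bigcap_measurable; first exact: finite_finset.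
  by move=> l _; exact: mv.
Qed.

(** The term [M] in the integral off [C] is there because a derivative at a point off [C] will be
    compared with one at a point of [C], and the difference is bounded by [G x + M]. *)
Lemma integrable_approx N v : bounded_set N -> lebesgue_measurable N -> (forall l, Lint N (v l)) ->
  forall e th : R, 0 < e -> 0 < th ->
  let G x := \sum_l `|v l x| in
  exists C (M : R), [/\ compact C /\ C `<=` N, 0 <= M /\ (forall x, C x -> G x <= M),
    (vol (N `\` C) <= e%:E)%E, RI (N `\` C) (fun x => G x + M) <= e &
    exists2 d : R, 0 < d & forall x y, C x -> C y -> `|x - y| < d -> forall l, `|v l x - v l y| <= th].
Proof.
move=> bN mN iv e th e0 th0 G.
have iG : Lint N G by apply: Lint_sum => // l _; exact: Lint_abs.
have G0 x : 0 <= G x by exact: sumr_ge0.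
have Noo : (vol N < +oo)%E by exact: bounded_vol.
have mG : measurable_fun (N : set LT) (G : LT -> R).
  by apply/measurable_EFinP; case/integrableP: iG.
have iGT : (lebesgue R n).-integrable (setT : set LT) (EFin \o (G \_ N)).
  have -> : EFin \o (G \_ N) = ((EFin \o G) \_ N)%E by rewrite restrict_EFin.
  exact: (@integrable_mkcond _ _ _ (lebesgue R n) N (EFin \o G) mN).1.
have e30 : 0 < e / 3 by rewrite divr_gt0.
have [d1 [d10 hd1]] := integral_normr_continuous iGT e30.
have hA A : lebesgue_measurable A -> A `<=` N -> (vol A < d1%:E)%E -> RI A G < e / 3.
  move=> mA AN Ad; have := hd1 A mA Ad; apply: le_lt_trans; apply: eqW.
  apply: eq_RI => x Ax; rewrite /patch mem_set; last exact: AN.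
  by rewrite ger0_norm.
pose d2 : R := Num.min (d1 / 2) (e / 2).
have d20 : 0 < d2 by rewrite lt_min !divr_gt0.
have mGM (M : R) : lebesgue_measurable (N `&` [set x | M < G x]).
  have -> : [set x | M < G x] = G @^-1` `]M, +oo[%classic.
    by apply/seteqP; split => x /=; rewrite in_itv /= andbT.
  exact: mG.
have [k hk] : exists k : nat, (vol (N `&` [set x | (k%:R : R) < G x])%R < (d2 / 2)%:E)%E.
  apply: vol_bigcap_lt => //; first exact: le_lt_trans (le_vol (@subIsetl _ _ _)) Noo.
  - move=> k l kl x [Nx /= h]; split=> //=; apply: le_lt_trans h; by rewrite ler_nat.
  - rewrite (_ : \bigcap__ _ = set0) ?vol0 ?lte_fin ?divr_gt0//.
    apply/seteqP; split=> // x /(_ (Num.truncn (G x)).+1 Logic.I)[_ /=].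
    by rewrite ltNge ltW// truncnS_gt.
pose M : R := k%:R; have M0 : 0 <= M by exact: ler0n.
pose P := N `&` [set x | G x <= M].
have PE : P = N `\` (N `&` [set x | M < G x]).
  apply/seteqP; split => x [Nx /= h]; split=> //=; first by move=> [_]; rewrite ltNge h.
  by rewrite leNgt; apply/negP => MG; apply: h.
have mP : lebesgue_measurable P by rewrite PE; apply: measurableD; [exact: mN|exact: mGM].
have bP : bounded_set P by apply: bounded_sub bN _; exact: subIsetl.
(* Chosen after [M], so that [M] times the measure of [P] off [C] is small. On the set where [G]
   exceeds [M], the integral of [M] is bounded by that of [G], small by absolute continuity. *)
pose d3 : R := Num.min (d2 / 2) (e / 3 / (M + 1)).
have M10 : 0 < M + 1 by rewrite ltr_wpDl.
have d30 : 0 < d3 by rewrite lt_min !divr_gt0.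
have mv l : measurable_fun (P : set LT) (v l : LT -> R).
  have iP : Lint P (v l) by apply: Lint_sub (iv l) => //; exact: subIsetl.
  by apply/measurable_EFinP; case/integrableP: iP.
have vM l x : P x -> `|v l x| <= M.
  move=> [_ /= Gx]; apply: le_trans Gx; rewrite /G (bigD1 l)//= lerDl; exact: sumr_ge0.
have [C [cC CP hC [d d0 hd]]] := small_oscillation_compact bP mP mv vM d30 th0.
have [d3d d3e] : d3 <= d2 / 2 /\ d3 <= e / 3 / (M + 1) by rewrite !ge_min !lexx orbT.
have [d2d d2e] : d2 <= d1 / 2 /\ d2 <= e / 2 by rewrite !ge_min !lexx orbT.
have CN : C `<=` N by move=> x /CP[].
have mC : lebesgue_measurable C by exact: compact_lebesgue.
have mA : lebesgue_measurable (N `\` C) by apply: measurableD; [exact: mN|exact: mC].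
have Asub : N `\` C `<=` (N `&` [set x | M < G x]) `|` (P `\` C).
  move=> x [Nx nCx]; have [GM|MG] := leP (G x) M; [right|left]; split=> //.
have volA : (vol (N `\` C) <= vol (N `&` [set x | (M < G x)%R]) + vol (P `\` C))%E.
  exact: le_trans (le_vol Asub) (volU2 _ _).
have PCoo : (vol (P `\` C) < +oo)%E by apply: le_lt_trans hC _; rewrite ltry.
have Goo : (vol (N `&` [set x | (M < G x)%R]) < +oo)%E by apply: lt_trans hk _; rewrite ltry.
have Ad2 : (vol (N `\` C) < d2%:E)%E.
  apply: le_lt_trans volA _; rewrite [d2]splitr EFinD; apply: lte_leD => //.
    by rewrite ge0_fin_numE ?vol_ge0.
  by apply: le_trans hC _; rewrite lee_fin.
exists C, M; split=> //.
- by split=> // x Cx; have [] := CP x Cx.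
- by apply: le_trans (ltW Ad2) _; rewrite lee_fin; move: d2e e0; clear -n; lra.
- have Aoo : (vol (N `\` C) < +oo)%E by apply: lt_trans Ad2 _; rewrite ltry.
  rewrite RID//; [|by apply: Lint_sub iG => //; exact: subDsetl|exact: Lint_cst].
  rewrite RI_cst//.
  have h1 : RI (N `\` C) G < e / 3.
    apply: hA => //.
    by apply: lt_le_trans Ad2 _; rewrite lee_fin; move: d2d d10; clear -n; lra.
  have h2 : M * fine (vol (N `&` [set x | M < G x])) < e / 3.
    apply: le_lt_trans (hA _ (mGM M) (@subIsetl _ _ _) _); last by apply: lt_trans hk _; rewrite lte_fin; move: d2d d10; clear -n; lra.
    rewrite -RI_cst//; apply: RI_le => //; [exact: Lint_cst|exact: Lint_sub iG|by move=> x [_ /ltW]].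
  have h3 : M * fine (vol (P `\` C)) <= e / 3.
    have : fine (vol (P `\` C)) <= d3 by rewrite -lee_fin -vol_fine//; apply: le_trans hC _; rewrite lee_fin.
    have : 0 <= fine (vol (P `\` C)) by rewrite fine_ge0// vol_ge0.
    move: d3e; rewrite ler_pdivlMr// => d3e f0 fd.
    apply: (@le_trans _ _ (d3 * (M + 1))) => //; rewrite mulrC ler_pM// lerDl//.
  have h4 : fine (vol (N `\` C)) <= fine (vol (N `&` [set x | M < G x])) + fine (vol (P `\` C)).
    by rewrite -lee_fin EFinD -!vol_fine.
  have := ler_wpM2l M0 h4; rewrite mulrDr; move: h1 h2 h3; clear -n; lra.
by exists d.
Qed.

End nearly_continuous.

(** * Strong differentiability *)

Lemma half_sum_le (R : realType) J : \sum_(j < J) (2^-1 : R) ^+ j <= 2.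
Proof.
have h : (1 - 2^-1 : R)^-1 = 2 by field.
rewrite -[leRHS]h; apply: geometric_sum_le; apply/andP; split; lra.
Qed.

Section strong_differentiability.
Context {R : realType} {n : nat}.
Local Notation V := 'rV[R]_n.
Local Notation LT := (lebesgue_type R n).
Implicit Types (a b c s x y z : V) (E K U Z N A Om : set V) (F u : V -> R) (v : 'I_n -> V -> R).

Lemma RI_restrict N A F : lebesgue_measurable N -> lebesgue_measurable A -> Lint N F ->
  Lint N (F \_ A) /\ RI N (F \_ A) = RI (N `&` A) F.
Proof.
move=> mN mA iF; split; last by rewrite /RI Rintegral_mkcondr.
have mNA : lebesgue_measurable (N `&` A) by apply: measurableI; [exact: mN|exact: mA].
have iNA : Lint (N `&` A) F by apply: Lint_sub iF => //; exact: subIsetl.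
rewrite /Lint (_ : EFin \o (F \_ A) = ((EFin \o F) \_ A)%E); last by rewrite restrict_EFin.
by apply/integrable_restrict.
Qed.

(** Local integrability only speaks of compact sets, so the neighbourhood of [E] is enclosed in
    one. *)
Lemma closed_thickening Om E (r : R) : compact E -> thicken E r `<=` Om -> 0 < r ->
  exists N', [/\ compact N', N' `<=` Om & thicken E (r / 2) `<=` N'].
Proof.
move=> cE EO r0; exists (closure (thicken E (r / 2))).
have NO : closure (thicken E (r / 2)) `<=` thicken E r.
  move=> x /closureP /(_ _ (divr_gt0 r0 (ltr0n _ 2)))[y [z Ez yz] xy].
  by exists z => //; apply: le_lt_trans (ler_distD y x z) _; rewrite (splitr r) ltrD.
split; [|exact: subset_trans NO EO|exact: subset_closure].
have [M M0 hM] := bounded_cube (thicken_bounded r (compact_bounded cE)).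
apply: subclosed_compact (@cube_compact _ _ (- const_mx M) (const_mx M)) _; first exact: closed_closure.
exact: subset_trans NO hM.
Qed.

(** Subtract from [u] the linear map given by [v] at [x0]. On every cube around a point of [K] the
    mean of the remaining derivative is small: by near-continuity on [C0], and off [C0] because the
    points of [K] avoid the bad set of the maximal function. Telescoping averages over shrinking
    cubes then compares the values at [x] and at [y] with one common average. *)
Lemma strong_diff_step Om E u v (eta eps : R) : open Om -> compact E -> E `<=` Om ->
  (forall z, E z -> forall e : R, 0 < e -> exists2 d : R, 0 < d & forall x, `|z - x| < d -> `|u x - u z| <= e) ->
  (forall j, weak_partial Om u j (v j)) -> 0 < eta -> 0 < eps ->
  exists K, [/\ compact K, K `<=` E, (vol (E `\` K) <= eps%:E)%E,
    exists M : R, forall x l, K x -> `|v l x| <= M &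
    exists2 rho : R, 0 < rho & forall x0 x y, K x0 -> K x -> K y -> `|x0 - x| <= rho -> `|x0 - y| <= rho ->
      `|u y - u x - \sum_l v l x0 * (y - x) 0 l| <= eta * `|y - x|].
Proof.
move=> oOm cE EO cu wp eta0 eps0.
have [r1 r10 hr1] := compact_thicken_sub cE oOm EO.
have [N' [cN' N'O NN']] := closed_thickening cE hr1 r10.
pose N := thicken E (r1 / 2); rewrite -/N in NN'.
have mN : lebesgue_measurable N by apply: open_lebesgue; exact: thicken_open.
have bN : bounded_set N by exact: thicken_bounded (compact_bounded cE).
have EN : E `<=` N by move=> x Ex; exists x => //; rewrite subrr normr0 divr_gt0.
have mN' : lebesgue_measurable N' by exact: compact_lebesgue.
have iv l : Lint N (v l) by apply: Lint_sub NN' _ => //; have [_ ivl _] := wp l; exact: ivl.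
have [C C1 kernC] := @kern_bound R.
pose D : R := (2 * C) ^+ n.
have D1 : 1 <= D by rewrite exprn_ege1//; move: C1; lra.
have D0 : 0 < D by exact: lt_le_trans D1.
(* The final bound is [16 * d * D * kap] with [kap <= 2 * lam], whence the 32. *)
pose lam : R := eta / (32 * D); have lam0 : 0 < lam by rewrite divr_gt0// mulr_gt0.
pose th : R := lam / n.+1%:R; have th0 : 0 < th by rewrite divr_gt0.
have p3 : 0 < (3 ^+ n : R) by rewrite exprn_gt0.
pose tau : R := Num.min (eps / 2) (lam * (eps / 2) / 3 ^+ n).
have tau0 : 0 < tau by rewrite lt_min !divr_gt0// mulr_gt0// divr_gt0.
have [tau1 tau2] : tau <= eps / 2 /\ tau <= lam * (eps / 2) / 3 ^+ n by rewrite !ge_min !lexx orbT.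
have [C0 [M [[cC0 C0N] [M0 GM] hC0 hF [dC dC0 hdC]]]] := integrable_approx bN mN iv tau0 th0.
pose G x := \sum_l `|v l x|; rewrite -/G in hF.
have iG : Lint N G by apply: Lint_sum => // l _; exact: Lint_abs.
have G0 x : 0 <= G x by exact: sumr_ge0.
have Noo : (vol N < +oo)%E by exact: bounded_vol.
have mC0 : lebesgue_measurable C0 by exact: compact_lebesgue.
have mnC : lebesgue_measurable (~` C0) by apply: measurableC; exact: mC0.
have iGM : Lint N (fun x => G x + M) by apply: LintD => //; exact: Lint_cst.
(* Dominates the difference of the derivatives at a point off [C0] and at a point of [C0]. *)
pose F : V -> R := (fun x => G x + M) \_ (~` C0).
have [iF RIF] : Lint N F /\ RI N F = RI (N `&` ~` C0) (fun x => G x + M) by exact: RI_restrict.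
have F0 x : 0 <= F x by rewrite /F /patch; case: ifP => // _; rewrite addr_ge0.
pose Bd := maximal_bad N F lam.
have oBd : open Bd by exact: maximal_bad_open.
have vBd : (vol Bd <= (eps / 2)%:E)%E.
  apply: le_trans (vol_maximal_bad mN bN iF _ lam0) _ => //.
  rewrite lee_fin RIF -setDE mulrC mulrA ler_pdivrMr// -ler_pdivlMr// [eps / 2 * lam]mulrC.
  exact: le_trans hF tau2.
pose K := (E `&` C0) `&` ~` Bd.
have KE : K `<=` E by move=> x [[]].
have KC x : K x -> C0 x by case=> [[]].
exists K; split => //.
- apply: compact_closedI; last exact: open_closedC.
  by apply: compact_closedI => //; exact: compact_closed_rV.
- have sub : E `\` K `<=` (N `\` C0) `|` Bd.
    move=> x [Ex nK]; have [Cx|nCx] := pselect (C0 x); last by left; split=> //; exact: EN.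
    by right; apply: contrapT => nB; apply: nK.
  apply: le_trans (le_vol sub) _; apply: le_trans (volU2 _ _) _.
  rewrite (splitr eps) EFinD; apply: leeD => //; apply: le_trans hC0 _.
  by rewrite lee_fin.
- exists M => x l /KC /GM; apply: le_trans; rewrite /G (bigD1 l)//= lerDl; exact: sumr_ge0.
(* Here [d <= 2 * rho], so the cube of radius [2 * d] around [x] stays within [5 * rho] of [x0];
   dividing by 6 leaves the inequalities strict. *)
pose rho : R := Num.min (r1 / 2) dC / 6.
have rho0 : 0 < rho by rewrite divr_gt0// lt_min dC0 divr_gt0.
have [rho1 rho2] : 5 * rho < r1 / 2 /\ 5 * rho < dC.
  have : Num.min (r1 / 2) dC <= r1 / 2 /\ Num.min (r1 / 2) dC <= dC by rewrite !ge_min !lexx orbT.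
  by move: rho0; rewrite /rho; clear -n; lra.
exists rho => // x0 x y Kx0 Kx Ky x0x x0y.
have [->|xy] := eqVneq y x.
  rewrite !subrr normr0 mulr0 big1 ?subr0 ?normr0// => l _.
  by rewrite mxE mulr0.
pose d : R := `|y - x|; have d0 : 0 < d by rewrite normr_gt0 subr_eq0.
have d2 : d <= 2 * rho.
  by have := ler_distD x0 y x; rewrite (distrC y x0) -/d; move: x0x x0y; clear -n; lra.
pose L l := v l x0.
pose w z := u z - \sum_l L l * z 0 l.
have wB p z : w p - w z = u p - u z - \sum_l L l * (p - z) 0 l.
  have -> : \sum_l L l * (p - z) 0 l = \sum_l L l * p 0 l - \sum_l L l * z 0 l.
    by rewrite -sumrB; apply: eq_bigr => l _; rewrite !mxE; ring.
  by rewrite /w; ring.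
(* The cube of radius [2 * d] around [x] also contains [y], so its average serves for both
   points. *)
pose a : V := x - const_mx (2 * d); pose s : V := const_mx (4 * d).
have s0 i : 0 < s 0 i by rewrite mxE mulr_gt0.
have boxE : box a (a + s) = dball (x, 2 * d).
  rewrite dballE; last by rewrite mulr_ge0// ltW.
  by congr box; apply/rowP => i; rewrite !mxE; ring.
have near0 p : box a (a + s) p -> `|x0 - p| <= 5 * rho.
  rewrite boxE /dball /= => xp; apply: le_trans (ler_distD x x0 p) _; move: xp x0x d2; clear -n; lra.
have bN' : box a (a + s) `<=` N.
  by move=> p /near0 h; exists x0; [exact: KE|rewrite distrC; exact: le_lt_trans h _].
have bO : box a (a + s) `<=` Om by exact: subset_trans (subset_trans bN' NN') N'O.
have pw : pweak a (a + s) w (fun j z => v j z - L j).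
  by apply: pweak_affine; [move=> j; rewrite [(a + s) 0 j]mxE ltrDl|exact: weak_partial_pweak bO].
pose kap : R := n%:R * th + lam.
have kap0 : 0 <= kap by apply: addr_ge0; [apply: mulr_ge0; [exact: ler0n|exact: ltW]|exact: ltW].
have key z : K z -> box a (a + s) z -> `|z - x| <= d -> `|average a s w - w z| <= 8 * d * D * kap.
  move=> Kz bz zx; apply/ler_addgt0Pr => e e0.
  have eD0 : 0 < e / D by rewrite divr_gt0.
  pose cj j : V := z + (2 ^+ j)^-1 *: (x - z).
  have p2 j : 0 < (2 ^+ j : R)^-1 by rewrite invr_gt0 exprn_gt0.
  have boxj j : box (zoom_corner [set: 'I_n]%SET z a j) (zoom_corner [set: 'I_n]%SET z a j + zoom_side [set: 'I_n]%SET s j)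
     = dball (cj j, 2 * d / 2 ^+ j).
    rewrite dballE; last by rewrite !mulr_ge0// ltW.
    by congr box; apply/rowP => i; rewrite !mxE !inE; ring.
  have cjz j : `|cj j - z| <= d / 2 ^+ j.
    rewrite /cj addrC addKr normrZ gtr0_norm// mulrC ler_wpM2r ?(ltW (p2 j))//.
    by rewrite distrC.
  have [J hJ] : exists J, forall p, dball (cj J, 2 * d / 2 ^+ J) p -> `|w p - w z| <= e / D.
    have [du du0 hdu] := cu z (KE z Kz) (e / D / 2) (divr_gt0 eD0 (ltr0n _ 2)).
    have M10 : 0 < M + 1 by rewrite ltr_wpDl.
    pose dm : R := Num.min du (e / D / 2 / (M + 1)).
    have dm0 : 0 < dm by rewrite lt_min du0 !divr_gt0.
    have [dm1 dm2] : dm <= du /\ dm <= e / D / 2 / (M + 1) by rewrite !ge_min !lexx orbT.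
    have [J hJ] := @half_pow_lt R (dm / (4 * d)) (divr_gt0 dm0 (mulr_gt0 (ltr0n _ 4) d0)).
    exists J => p; rewrite /dball /= => cp.
    have zp : `|z - p| < dm.
      apply: le_lt_trans (ler_distD (cj J) z p) _; rewrite distrC.
      apply: le_lt_trans (lerD (cjz J) cp) _; move: hJ; rewrite ltr_pdivlMr ?mulr_gt0// => hJ.
      apply: le_lt_trans hJ; have := mulr_ge0 (ltW d0) (ltW (p2 J)); clear -n; lra.
    rewrite wB; apply: le_trans (ler_normB _ _) _; rewrite [leRHS]splitr; apply: lerD.
      by apply: hdu; exact: lt_le_trans dm1.
    apply: (@le_trans _ _ (M * `|z - p|)); last first.
      apply: (@le_trans _ _ ((M + 1) * dm)); first by rewrite ler_pM// ?(ltW zp)// lerDl.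
      by rewrite mulrC -ler_pdivlMr.
    apply: (@le_trans _ _ (G x0 * `|z - p|)); last by rewrite ler_wpM2r// GM//; exact: KC.
    apply: le_trans (ler_norm_sum _ _ _) _; rewrite mulr_suml; apply: ler_sum => l _.
    by rewrite normrM ler_wpM2l// distrC le_coord_norm.
  have r0 i : i \in [set: 'I_n]%SET -> s 0 i = 4 * d by rewrite mxE.
  have d40 : 0 <= 4 * d by rewrite mulr_ge0// ltW.
  have := @average_telescope _ _ C C1 kernC a s w (fun j z => v j z - L j) _ (4 * d) (e / D) z J s0 r0 pw bz (ltW eD0).
  rewrite /= boxj => /(_ hJ) h; apply: le_trans h _; rewrite -/D mulrCA divff ?gt_eqF// mulr1 addrC lerD2r.
  apply: (@le_trans _ _ (\sum_(j < J) 4 * d * D * kap * 2^-1 ^+ j)); last first.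
    rewrite -mulr_sumr.
    have h2 := @half_sum_le R J.
    have -> : 8 * d * D * kap = 4 * d * D * kap * 2 by ring.
    by rewrite ler_wpM2l// !mulr_ge0// ltW.
  apply: ler_sum => j _; rewrite boxj.
  set Q := dball _; pose rj : R := 2 * d / 2 ^+ j.
  have rj0 : 0 < rj by rewrite !mulr_gt0.
  have volQ : vol Q = ((2 * rj) ^+ n)%:E by rewrite vol_dball// ltW.
  have mQ : lebesgue_measurable Q by apply: dball_measurable; exact: ltW.
  have QN : Q `<=` box a (a + s) by rewrite /Q -boxj; exact: zoom_box.
  (* The zoomed cube is not centred at [z], but [z] lies within half its radius of the centre; as
     [z] is not in the open bad set, the mean of [F] is at most [lam]. *)
  have QF : RI Q F <= lam * (2 * rj) ^+ n.
    rewrite leNgt; apply/negP => hbad; have [_ nB] := Kz; apply: nB.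
    exists (cj j), rj; split=> //; first exact: subset_trans bN'.
    apply: le_lt_trans (cjz j) _; rewrite /rj ltr_pM2r// ltr_pMl// ltr1n //.
  have iL l : Lint Q (fun p => `|v l p - L l|).
    apply: Lint_abs => //; apply: LintB => //; last by apply: Lint_cst => //; rewrite volQ ltry.
    by apply: Lint_sub (iv l) => //; exact: subset_trans bN'.
  have iQF : Lint Q F by apply: Lint_sub iF => //; exact: subset_trans bN'.
  have icQ : Lint Q (fun=> n%:R * th) by apply: Lint_cst => //; rewrite volQ ltry.
  have sumQ : \sum_(i in [set: 'I_n]%SET) RI Q (fun p => `|v i p - L i|) <= kap * (2 * rj) ^+ n.
    rewrite -RI_sum//.
    apply: (@le_trans _ _ (RI Q (fun p => n%:R * th + F p))).
      apply: RI_le => //; [by apply: Lint_sum|exact: LintD|move=> p Qp].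
      rewrite (eq_bigl predT); last by move=> i; rewrite inE.
      have [Cp|nCp] := pselect (C0 p).
        apply: (@le_trans _ _ (n%:R * th)); last by rewrite lerDl.
        rewrite mulr_natl -[n in leRHS]card_ord -sumr_const; apply: ler_sum => l _.
        apply: hdC => //; first exact: KC.
        by rewrite distrC; apply: le_lt_trans (near0 _ (QN p Qp)) _.
      apply: (@le_trans _ _ (F p)); last by rewrite lerDr mulr_ge0// ltW.
      rewrite /F /patch mem_set//; apply: (@le_trans _ _ (G p + G x0)); last by rewrite lerD2l GM//; exact: KC.
      by rewrite -big_split /=; apply: ler_sum => l _; exact: ler_normB.
    rewrite RID// RI_cst// volQ; rewrite /= /kap [leRHS]mulrDl; exact: lerD.
  have Wj : weight C (zoom_side [set: 'I_n]%SET s j) * (2 * rj) ^+ n = D.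
    rewrite /D -(@weight_vol _ _ C (zoom_side [set: 'I_n]%SET s j)); last first.
      by move=> i; rewrite !mxE inE !mulr_gt0.
    congr (_ * _); rewrite (eq_bigr (fun=> 2 * rj)) ?prodr_const ?card_ord//.
    by move=> i _; rewrite !mxE inE /rj; ring.
  have W0 : 0 <= weight C (zoom_side [set: 'I_n]%SET s j).
    by apply: (weight_ge0 C1) => i; rewrite !mxE inE !mulr_gt0.
  apply: (@le_trans _ _ (4 * d / 2 ^+ j * weight C (zoom_side [set: 'I_n]%SET s j) * (kap * (2 * rj) ^+ n))).
    by apply: ler_wpM2l => //; rewrite !mulr_ge0// ltW.
  rewrite [kap * _]mulrC mulrA -[_ * _ * (2 * rj) ^+ n]mulrA Wj exprVn.
  by apply: eqW; ring.
have bx : box a (a + s) x by rewrite boxE /dball /= subrr normr0 mulr_ge0// ltW.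
have by_ : box a (a + s) y by rewrite boxE /dball /= distrC -/d; move: d0; clear -n; lra.
have kx := key x Kx bx; have ky := key y Ky by_ (lexx _).
have {}kx : `|average a s w - w x| <= 8 * d * D * kap by apply: kx; rewrite subrr normr0 ltW.
rewrite -[\sum_l _]/(\sum_l L l * (y - x) 0 l) -wB.
have fin : 16 * d * D * kap <= eta * d.
  have k1 : kap <= 2 * lam.
    rewrite /kap (_ : 2 * lam = lam + lam); last by ring.
    rewrite lerD2r /th mulrA ler_pdivrMr//.
    by rewrite [leLHS]mulrC; apply: ler_wpM2l; rewrite ?(ltW lam0)// ler_nat.
  apply: (@le_trans _ _ (16 * d * D * (2 * lam))); first by rewrite ler_wpM2l// !mulr_ge0// ltW.
  rewrite /lam le_eqVlt; apply/orP; left; apply/eqP; field.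
  by rewrite gt_eqF.
apply: le_trans fin; apply: le_trans (ler_distD (average a s w) _ _) _.
rewrite distrC; move: kx ky; clear -n; lra.
Qed.

End strong_differentiability.

(** * Null images *)

Section strong_differentiability_on.
Context {R : realType} {n : nat}.
Local Notation V := 'rV[R]_n.
Implicit Types (x y z : V) (E K U Z Om : set V) (f Psi : V -> V) (L : V -> 'M[R]_n).

(** Strict differentiability along [K]: the linear part is frozen at [x0] while both [x] and [y]
    vary. This is what later gives two-sided Lipschitz bounds. *)
Definition strongly_diff_on K f L := forall eta : R, 0 < eta -> exists2 rho : R, 0 < rho &
  forall x0 x y, K x0 -> K x -> K y -> `|x0 - x| <= rho -> `|x0 - y| <= rho ->
    forall i, `|f y 0 i - f x 0 i - \sum_l L x0 i l * (y - x) 0 l| <= eta * `|y - x|.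

(** Intersect the compact sets obtained for each component and each precision [m.+1%:R^-1]; the
    errors [ee m] are summable over both. *)
Lemma strong_diff Om E f L (eps : R) : open Om -> {within Om, continuous f} -> weak_jacobian Om f L ->
  lebesgue_measurable E -> bounded_set E -> E `<=` Om -> 0 < eps ->
  exists K, [/\ compact K, K `<=` E, (vol (E `\` K) <= eps%:E)%E,
    exists M : R, forall x i l, K x -> `|L x i l| <= M & strongly_diff_on K f L].
Proof.
move=> oOm cf wf mE bE EO eps0.
have [E0 [cE0 E0E hE0]] := lebesgue_inner_regular mE bE (divr_gt0 eps0 (ltr0n _ 2)).
have E0O : E0 `<=` Om by exact: subset_trans EO.
pose ee (m : nat) : R := eps / 2 / (2 ^ m.+1)%:R / n.+1%:R.
have ee0 m : 0 < ee m by rewrite !divr_gt0// ltr0n expn_gt0.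
have step (p : nat * 'I_n) : exists K, [/\ compact K, K `<=` E0, (vol (E0 `\` K) <= (ee p.1)%:E)%E,
    exists M : R, forall x l, K x -> `|L x p.2 l| <= M &
    exists2 rho : R, 0 < rho & forall x0 x y, K x0 -> K x -> K y -> `|x0 - x| <= rho -> `|x0 - y| <= rho ->
      `|f y 0 p.2 - f x 0 p.2 - \sum_l L x0 p.2 l * (y - x) 0 l| <= p.1.+1%:R^-1 * `|y - x|].
  apply: (strong_diff_step (u := fun x => f x 0 p.2) (v := fun l x => L x p.2 l) oOm cE0 E0O) => //.
  move=> z Ez e e0; have /within_continuousP /(_ z (E0O z Ez) e e0)[d d0 hd] := cf.
  have [d' d'0 hd'] := open_ballP oOm (E0O z Ez).
  exists (Num.min d d'); first by rewrite lt_min d0.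
  move=> x; rewrite lt_min => /andP[zd zd'].
  have -> : f x 0 p.2 - f z 0 p.2 = (f x - f z) 0 p.2 by rewrite !mxE.
  by apply: le_trans (le_coord_norm _ _) _; rewrite distrC ltW// hd//; exact: hd'.
have [K hK] := choice step.
pose K' m := \big[setI/setT]_(i : 'I_n) K (m, i).
have K'E m x : K' m x <-> forall i, K (m, i) x.
  rewrite /K' -bigcap_seq; split=> [h i|h i _]; last exact: h.
  by apply: h => /=; rewrite mem_index_enum.
pose KK := E0 `&` \bigcap_m K' m.
have KKK x m i : KK x -> K (m, i) x by move=> [_ /(_ m Logic.I)/K'E]; exact.
exists KK; split.
- apply: compact_closedI => //; apply: closed_bigI => m _; rewrite /K' -bigcap_seq; apply: closed_bigI => i _.
  by apply: compact_closed_rV; have [] := hK (m, i).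
- by move=> x [/E0E].
- have sub : E `\` KK `<=` (E `\` E0) `|` \bigcup_m (\big[setU/set0]_(i : 'I_n) (E0 `\` K (m, i))).
    move=> x [Ex nK]; have [E0x|nE] := pselect (E0 x); [right|by left; split].
    apply: contrapT => nU; apply: nK; split=> // m _; apply/K'E => i.
    apply: contrapT => nKi; apply: nU; exists m => //; apply/bigsetU_finP; exists i => //.
  apply: le_trans (le_vol sub) _; apply: le_trans (volU2 _ _) _.
  rewrite (splitr eps) EFinD; apply: leeD => //.
  apply: le_trans (vol_bigcup _) _.
  have e20 : 0 <= eps / 2 by rewrite divr_ge0// ltW.
  apply: le_trans (epsilon_trick0 xpredT e20); apply: lee_nneseries => [m _ _|m _]; first exact: vol_ge0.
  apply: le_trans (vol_bigsetU _ _ _) _.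
  apply: (@le_trans _ _ (\sum_(i < n) (ee m)%:E)%E).
    by apply: lee_sum => i _; have [] := hK (m, i).
  rewrite sumEFin lee_fin sumr_const card_ord /ee; set q := eps / 2 / _; have q0 : 0 <= q by rewrite divr_ge0// ler0n.
  rewrite -[leLHS]mulr_natr -mulrA ler_piMr//.
  by rewrite mulrC ler_pdivrMr// mul1r ler_nat.
- have /choice[M hM] i : exists M : R, forall x l, KK x -> `|L x i l| <= M.
    by have [_ _ _ [M hM] _] := hK (0%N, i); exists M => x l Kx; apply: hM; exact: KKK.
  exists (\sum_i `|M i|) => x i l Kx; apply: le_trans (hM i x l Kx) _.
  by rewrite (bigD1 i)//= (le_trans (ler_norm _))// lerDl sumr_ge0.
move=> eta eta0; pose m := Num.truncn eta^-1.
have meta : m.+1%:R^-1 <= eta by rewrite invf_ple ?posrE// ltW// truncnS_gt.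
have /choice[rho hrho] i : exists rho : R, 0 < rho /\ forall x0 x y, KK x0 -> KK x -> KK y -> `|x0 - x| <= rho -> `|x0 - y| <= rho ->
      `|f y 0 i - f x 0 i - \sum_l L x0 i l * (y - x) 0 l| <= eta * `|y - x|.
  have [_ _ _ _ [rho rho0 h]] := hK (m, i); exists rho; split=> // x0 x y K0 Kx Ky h1 h2.
  apply: le_trans (h x0 x y (KKK _ _ _ K0) (KKK _ _ _ Kx) (KKK _ _ _ Ky) h1 h2) _.
  exact: ler_wpM2r.
exists (\big[Num.min/1]_i rho i).
  by elim/big_ind: _ => // [s t s0 t0|i _]; [rewrite lt_min s0|have [] := hrho i].
move=> x0 x y K0 Kx Ky h1 h2 i; have [_ h] := hrho i.
by apply: h => //; [apply: le_trans h1 _|apply: le_trans h2 _]; exact: bigmin_le_cond.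
Qed.

End strong_differentiability_on.

Section null_images.
Context {R : realType} {n : nat}.

(** The slab is a thickened graph over the coordinates other than [i0]. Its base is cut into [N] to
    the [n] cubes of side [h], with [n%:R * h <= tau], so the linear form varies by at most [tau]
    over each and a column of height [4 * tau] suffices. *)
Lemma vol_slab (w z0 : 'rV[R]_n.+1) (i0 : 'I_n.+1) (A tau : R) : 0 < A -> 0 < tau ->
  (forall i, `|w 0 i| <= 1) -> w 0 i0 = 1 ->
  (vol [set z : 'rV[R]_n.+1 | ((forall i, `|z 0 i - z0 0 i| <= A) /\ `|\sum_i w 0 i * (z 0 i - z0 0 i)| <= tau)%R]
    <= (4 * tau * (2 * A) ^+ n)%:E)%E.
Proof.
move=> A0 tau0 w1 wi0; set T := [set z | _].
pose N := (Num.truncn (2 * n%:R * A / tau)).+1; pose h : R := 2 * A / N%:R.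
have N0 : 0 < (N%:R : R) by rewrite ltr0n.
have h0 : 0 < h by rewrite divr_gt0// mulr_gt0.
have nh : n%:R * h <= tau.
  have := truncnS_gt (2 * n%:R * A / tau); rewrite -/N ltr_pdivrMr// => l.
  rewrite /h mulrA ler_pdivrMr// [tau * _]mulrC; apply: le_trans (ltW l).
  by apply: eqW; ring.
have Nh : N%:R * h = 2 * A by rewrite /h mulrCA divff ?mulr1// gt_eqF.
pose base (k : {ffun 'I_n -> 'I_N}) j : R := - A + (k j)%:R * h.
pose ctr k : R := - \sum_j w 0 (lift i0 j) * base k j.
pose lo k : 'rV[R]_n.+1 := \row_i (z0 0 i + oapp (base k) (ctr k - 2 * tau) (unlift i0 i)).
pose sd : 'rV[R]_n.+1 := \row_i (oapp (fun=> h) (4 * tau) (unlift i0 i)).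
have cov : T `<=` \big[setU/set0]_(k : {ffun 'I_n -> 'I_N}) box (lo k) (lo k + sd).
  move=> z [zA zw]; pose d j := z 0 (lift i0 j) - z0 0 (lift i0 j).
  have dA j : 0 <= d j + A /\ d j + A <= 2 * A.
    by have := zA (lift i0 j); rewrite -/(d j) ler_norml; lra.
  pose k : {ffun 'I_n -> 'I_N} := [ffun j => inord (minn (Num.truncn ((d j + A) / h)) N.-1)].
  have kd j : 0 <= d j - base k j /\ d j - base k j <= h.
    rewrite /base ffunE inordK; last by rewrite /N /= ltnS geq_minr.
    have [d1 d2] := dA j; have t0 : 0 <= (d j + A) / h by rewrite divr_ge0// ltW.
    have /andP[t1 t2] := truncn_itv t0; move: t1 t2; rewrite ler_pdivlMr// ltr_pdivrMr// => t1 t2.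
    have e : d j - (- A + (minn (Num.truncn ((d j + A) / h)) N.-1)%:R * h) = (d j + A) - (minn (Num.truncn ((d j + A) / h)) N.-1)%:R * h by ring.
    rewrite e; have [l|l] := leqP (Num.truncn ((d j + A) / h)) N.-1.
      by move: t2; rewrite -natr1; lra.
    have : (N.-1%:R * h <= (Num.truncn ((d j + A) / h))%:R * h) by rewrite ler_pM2r// ler_nat ltnW.
    have : N%:R = N.-1%:R + 1 :> R by rewrite natr1.
    move: Nh => + NE; rewrite NE; lra.
  apply/bigsetU_finP; exists k => // i; rewrite in_itv /= !mxE.
  case: unliftP => [j|] -> /=; first by have := kd j; rewrite /d; lra.
  have zE : \sum_i w 0 i * (z 0 i - z0 0 i) = (z 0 i0 - z0 0 i0) + \sum_j w 0 (lift i0 j) * d j.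
    by rewrite (bigD1_ord i0)//= wi0 mul1r.
  have dk : `|\sum_j w 0 (lift i0 j) * d j + ctr k| <= n%:R * h.
    rewrite /ctr -sumrB; apply: le_trans (ler_norm_sum _ _ _) _.
    rewrite mulr_natl -[n in leRHS]card_ord -sumr_const; apply: ler_sum => j _.
    rewrite -mulrBr normrM -[leRHS]mul1r; apply: ler_pM => //.
    by have [k1 k2] := kd j; rewrite ger0_norm.
  move: zw; rewrite zE; move: dk nh; rewrite !ler_norml => /andP[a1 a2] a3 /andP[a4 a5].
  by apply/andP; split; lra.
apply: le_trans (le_vol cov) _; apply: le_trans (vol_bigsetU _ _ _) _.
have sd0 i : 0 < sd 0 i by rewrite mxE; case: unliftP => [j|] _ //=; rewrite mulr_gt0.
rewrite (eq_bigr (fun=> (h ^+ n * (4 * tau))%:E)); last first.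
  move=> k _; rewrite vol_sbox//; congr EFin; rewrite (bigD1_ord i0)//= mulrC; congr (_ * _).
    rewrite (eq_bigr (fun=> h)) ?prodr_const ?card_ord// => j _.
    by rewrite mxE liftK.
  by rewrite mxE unlift_none.
rewrite sumEFin lee_fin sumr_const card_ffun !card_ord -[leLHS]mulr_natl natrX.
by rewrite [h ^+ n * _]mulrC mulrCA -exprMn Nh.
Qed.

(** A vector [w] annihilating the differential confines the image of a cell of side [r] to a slab of
    thickness proportional to [eta * r]. With [B] bounding the remaining extent, the image has
    volume at most a constant times [eta] times that of the cell, for every small [eta]. *)
Lemma singular_image_null (K : set 'rV[R]_n.+1) Psi (L : 'rV[R]_n.+1 -> 'M[R]_n.+1) (M : R) :
  compact K -> (forall x i l, K x -> `|L x i l| <= M) -> strongly_diff_on K Psi L ->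
  (forall x, K x -> exists2 w : 'rV[R]_n.+1, w != 0 & w *m L x = 0) ->
  vol (Psi @` K) = 0%E.
Proof.
move=> cK LM sdK sing.
pose B : R := n.+1%:R * `|M| + 1; have B0 : 0 < B by rewrite ltr_wpDl// mulr_ge0.
pose U := thicken K 1.
have bK : bounded_set K by exact: compact_bounded.
have bU : bounded_set U by exact: thicken_bounded.
have mU : lebesgue_measurable U by apply: open_lebesgue; exact: thicken_open.
apply: (@null_of_small_cover _ _ Psi K 1 (4 * n.+1%:R * (2 * B) ^+ n) U) => //; first exact: bounded_vol.
  by rewrite !mulr_ge0// exprn_ge0// mulr_ge0// ltW.
move=> eta /andP[eta0 eta1]; have [rho rho0 hrho] := sdK eta eta0.
pose r : R := Num.min rho 2^-1; have r0 : 0 < r by rewrite lt_min rho0 invr_gt0 ltr0n.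
have [r1 r2] : r <= rho /\ r <= 2^-1 by rewrite !ge_min !lexx orbT.
exists (const_mx r); first by move=> i; rewrite mxE.
move=> c x0 Kx0 cx0.
have near x : cell c (c + const_mx r) x -> `|x0 - x| <= r.
  move=> cx; apply/rV_norm_leP; first exact: ltW.
  by move=> i; rewrite !mxE; have := cell_near i (cell_sub_box cx0) (cell_sub_box cx); rewrite mxE.
split.
  move=> x /near h; exists x0 => //; rewrite distrC; apply: le_lt_trans h _; lra.
have [w w0 wL] := sing x0 Kx0.
have [i0 hi0] : exists i0, forall i, `|w 0 i| <= `|w 0 i0|.
  by exists [arg max_(i > ord0) `|w 0 i|]%O; case: arg_maxP => // i _ h j; exact: h.
have wi0 : w 0 i0 != 0.
  apply: contra_neq w0 => wi; apply/rowP => i; rewrite mxE; apply/eqP; rewrite -normr_le0.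
  by have := hi0 i; rewrite wi normr0.
(* Division by the largest coordinate makes the constants independent of [w], hence of the cell. *)
pose w' := (w 0 i0)^-1 *: w.
have w'1 i : `|w' 0 i| <= 1.
  by rewrite mxE normrM normfV mulrC ler_pdivrMr ?normr_gt0// mul1r.
have w'i0 : w' 0 i0 = 1 by rewrite mxE mulVf.
have w'L l : \sum_i w' 0 i * L x0 i l = 0.
  have : (w' *m L x0) 0 l = 0 by rewrite -scalemxAl wL scaler0 mxE.
  by rewrite mxE.
have tau0 : 0 < n.+1%:R * eta * r by rewrite !mulr_gt0.
have A0 : 0 < B * r by rewrite mulr_gt0.
apply: (@le_trans _ _ (4 * (n.+1%:R * eta * r) * (2 * (B * r)) ^+ n)%:E); last first.
  rewrite lee_fin (eq_bigr (fun=> r)); last by move=> i _; rewrite mxE.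
  rewrite prodr_const card_ord exprS mulrA exprMn [leLHS](_ : _ = 4 * n.+1%:R * (2 * B) ^+ n * eta * (r * r ^+ n)) //.
  by rewrite !exprMn; ring.
apply: le_trans (vol_slab (Psi x0) A0 tau0 w'1 w'i0); apply: le_vol.
move=> _ [x [Kx cx] <-].
have xr : `|x - x0| <= r by rewrite distrC near.
pose p i := \sum_l L x0 i l * (x - x0) 0 l.
have err i : `|Psi x 0 i - Psi x0 0 i - p i| <= eta * r.
  apply: le_trans (hrho x0 x0 x Kx0 Kx0 Kx _ _ i) _; rewrite ?subrr ?normr0 ?(ltW rho0)//.
    exact: le_trans (near x cx) r1.
  by rewrite ler_wpM2l// ltW.
split=> [i|].
  have pb : `|p i| <= n.+1%:R * `|M| * r.
    apply: le_trans (ler_norm_sum _ _ _) _.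
    rewrite -mulrA mulr_natl -[n.+1 in leRHS]card_ord -sumr_const; apply: ler_sum => l _.
    rewrite normrM; apply: ler_pM => //; last by apply: le_trans xr; exact: le_coord_norm.
    by apply: le_trans (LM x0 i l Kx0) _; exact: ler_norm.
  have := err i; have er : eta * r <= r by rewrite ler_piMl// ltW.
  rewrite /B mulrDl mul1r => e1; apply: le_trans (_ : `|Psi x 0 i - Psi x0 0 i - p i| + `|p i| <= _).
    by rewrite -[X in `|X| <= _](subrK (p i)); exact: ler_normD.
  by rewrite addrC lerD// (le_trans e1).
have -> : \sum_i w' 0 i * (Psi x 0 i - Psi x0 0 i) = \sum_i w' 0 i * (Psi x 0 i - Psi x0 0 i - p i).
  have p0 : \sum_i w' 0 i * p i = 0.
    rewrite (eq_bigr (fun i => \sum_l w' 0 i * L x0 i l * (x - x0) 0 l)); last first.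
      by move=> i _; rewrite mulr_sumr; apply: eq_bigr => l _; rewrite mulrA.
    rewrite exchange_big /= big1// => l _; by rewrite -mulr_suml w'L mul0r.
  under [RHS]eq_bigr do rewrite mulrBr.
  by rewrite sumrB p0 subr0.
apply: le_trans (ler_norm_sum _ _ _) _.
rewrite -mulrA mulr_natl -[n.+1 in leRHS]card_ord -sumr_const; apply: ler_sum => i _.
by rewrite normrM -[leRHS]mul1r; apply: ler_pM.
Qed.

End null_images.

(** * Null sets and bi-Lipschitz maps *)

Section bilipschitz.
Context {R : realType} {n : nat}.
Local Notation V := 'rV[R]_n.
Implicit Types (K U Z : set V) (Phi : V -> V).

Lemma locally_null K : compact K ->
  (forall x, K x -> exists2 r : R, 0 < r & vol (K `&` [set y | `|x - y| < r]) = 0%E) -> vol K = 0%E.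
Proof.
move=> cK h; have /choice[r hr] x : exists r : R, 0 < r /\ (K x -> vol (K `&` [set y | `|x - y| < r]) = 0%E).
  by have [Kx|nK] := pselect (K x); [have [r r0 hr] := h x Kx; exists r|exists 1].
have := cK; rewrite compact_cover => /(_ V K (fun x => [set y | `|x - y| < r x])).
case.
- move=> x _; apply: ball_openP => y /= xy; exists (r x - `|x - y|); first by rewrite subr_gt0.
  move=> z yz; apply: le_lt_trans (ler_distD y x z) _.
  by rewrite addrC -ltrBrDr.
- by move=> x Kx; exists x => //=; rewrite subrr normr0; have [] := hr x.
move=> D DK Kcov.
have sub : K `<=` \big[setU/set0]_(x <- finmap.enum_fset D) (K `&` [set y | `|x - y| < r x]).
  by move=> y Ky; have [x xD xy] := Kcov y Ky; rewrite -bigcup_seq; exists x.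
apply/le_anti; rewrite vol_ge0 andbT; apply: le_trans (le_vol sub) _.
apply: le_trans (vol_bigsetU _ _ _) _; rewrite big_seq big1// => x xD.
by have [_] := hr x; apply; have := DK x xD; rewrite inE.
Qed.

(** The inverse [G] is Lipschitz with constant [c1^-1], so it sends a cell of side [s] into a cube
    of side [2 * s / c1]; this gives the factor [Q]. *)
Lemma bilipschitz_null K Phi (c1 c2 : R) : compact K -> 0 < c1 -> 0 <= c2 ->
  (forall x y, K x -> K y -> c1 * `|x - y| <= `|Phi x - Phi y| <= c2 * `|x - y|) ->
  vol (Phi @` K) = 0%E -> vol K = 0%E.
Proof.
move=> cK c10 c20 lip PhiK0.
have cPhi : {within K, continuous Phi}.
  apply/within_continuousP => x Kx e e0; exists (e / (c2 + 1)); first by rewrite divr_gt0// ltr_wpDl.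
  move=> y Ky xy; have /andP[_ h] := lip x y Kx Ky; apply: le_lt_trans h _.
  apply: (@le_lt_trans _ _ ((c2 + 1) * `|x - y|)); first by rewrite ler_wpM2r// lerDl.
  by rewrite mulrC -ltr_pdivlMr// ltr_wpDl.
have cZ : compact (Phi @` K) by exact: continuous_compact.
have inj x y : K x -> K y -> Phi x = Phi y -> x = y.
  move=> Kx Ky e; have /andP[h _] := lip x y Kx Ky; move: h; rewrite e subrr normr0 pmulr_rle0//.
  by rewrite normr_le0 subr_eq0 => /eqP.
have /choice[G hG] z : exists x, (Phi @` K) z -> K x /\ Phi x = z.
  by have [[x Kx e]|nz] := pselect ((Phi @` K) z); [exists x|exists 0].
have GK : G @` (Phi @` K) = K.
  apply/seteqP; split => [_ [_ [x Kx <-] <-]|x Kx].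
    by have [] := hG (Phi x) (imageP _ Kx).
  exists (Phi x); first exact: imageP.
  by have [KG e] := hG (Phi x) (imageP _ Kx); exact: inj.
rewrite -GK.
apply/le_anti; rewrite vol_ge0 andbT; apply/lee_addgt0Pr => e e0; rewrite add0e.
pose Q : R := (2 / c1) ^+ n; have Q0 : 0 < Q by rewrite exprn_gt0// divr_gt0.
have [r r0 hr] : exists2 r : R, 0 < r & (vol (thicken (Phi @` K) r) < (e / Q)%:E)%E.
  by apply: compact_outer_regular => //; rewrite PhiK0 lte_fin divr_gt0.
set U := thicken _ r in hr.
have mU : lebesgue_measurable U by apply: open_lebesgue; exact: thicken_open.
have Uoo : (vol U < +oo)%E by apply: lt_trans hr _; rewrite ltry.
have bZ : bounded_set (Phi @` K) by exact: compact_bounded.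
pose s : R := r / 2; have s0 : 0 < s by rewrite divr_gt0.
apply: (@le_trans _ _ (Q * fine (vol U) + RI U (fun=> 0))%:E); last first.
  rewrite RI_cst// mul0r addr0 lee_fin mulrC -ler_pdivlMr// -lee_fin -vol_fine//; exact: ltW.
apply: (@cover_volume _ _ _ _ _ (const_mx s)) => //; first exact: ltW.
- exact: Lint_cst.
- by move=> i; rewrite mxE.
move=> c z0 Zz0 cz0.
have near z : cell c (c + const_mx s) z -> `|z0 - z| <= s.
  move=> cx; apply/rV_norm_leP; first exact: ltW.
  by move=> i; rewrite !mxE; have := cell_near i (cell_sub_box cz0) (cell_sub_box cx); rewrite mxE.
split.
  move=> z /near h; exists z0 => //; rewrite distrC; apply: le_lt_trans h _; rewrite /s; lra.
have sub : G @` (Phi @` K `&` cell c (c + const_mx s)) `<=` dball (G z0, s / c1).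
  move=> _ [z [Zz cz] <-]; rewrite /dball /= ler_pdivlMr// mulrC.
  have [K1 e1] := hG z0 Zz0; have [K2 e2] := hG z Zz.
  by have /andP[h _] := lip _ _ K1 K2; apply: le_trans h _; rewrite e1 e2 near.
apply: le_trans (le_vol sub) _; rewrite vol_dball; last by apply: divr_ge0; exact: ltW.
rewrite RI_cst ?mul0r ?addr0; last exact: cell_lebesgue.
rewrite lee_fin (eq_bigr (fun=> s)) ?prodr_const ?card_ord; last by move=> i _; rewrite mxE.
by rewrite /Q -exprMn le_eqVlt; apply/orP; left; apply/eqP; congr (_ ^+ _); ring.
Qed.

End bilipschitz.

(** * Completing rows to an invertible matrix *)

Section selection.
Context {F : fieldType} {n : nat}.
Implicit Types (X D P : 'M[F]_n) (S Z : {set 'I_n}).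

Lemma singular_kernel X : (\rank X < n)%N -> exists2 w : 'rV[F]_n, w != 0 & w *m X = 0.
Proof.
move=> Xn; have /rowV0Pn[w /sub_kermxP wX w0] : kermx X != 0.
  by rewrite kermx_eq0 /row_free neq_ltn Xn.
by exists w.
Qed.

(** The differential of the map whose i-th component is that of [f] for [i] in [S] and the
    coordinate [sigma i] otherwise. *)
Definition mixed_mx S (sigma : 'I_n -> 'I_n) D : 'M[F]_n :=
  \matrix_(i, l) if i \in S then D i l else (l == sigma i)%:R.

Lemma mxrank_sum_leq (I : Type) (s : seq I) (Q : pred I) (B : I -> 'M[F]_n) :
  (\rank (\sum_(i <- s | Q i) B i)%R <= \sum_(i <- s | Q i) \rank (B i))%N.
Proof.
apply: (big_ind2 (fun (X : 'M[F]_n) k => (\rank X <= k)%N)) => //; first by rewrite mxrank0.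
by move=> X k Y l Xk Yl; apply: leq_trans (mxrank_add _ _) _; exact: leq_add.
Qed.

Lemma mixed_mx_singular S sigma D : (\rank D < #|S|)%N -> (\rank (mixed_mx S sigma D) < n)%N.
Proof.
move=> DS; pose T : 'M[F]_n := diag_mx (\row_i (i \in S)%:R).
have -> : mixed_mx S sigma D = T *m D + \sum_(i | i \notin S) delta_mx i (sigma i).
  apply/matrixP => i l; rewrite mul_diag_mx !mxE summxE; case: (boolP (i \in S)) => iS.
    by rewrite mul1r big1 ?addr0// => j jS; rewrite mxE; case: eqP => // ij; rewrite -ij iS in jS.
  rewrite mul0r add0r (bigD1 i)//= mxE eqxx /= big1 ?addr0// => j /andP[_ ji].
  by rewrite mxE eq_sym (negbTE ji).
apply: leq_ltn_trans (mxrank_add _ _) _.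
have h1 : (\rank (T *m D) <= \rank D)%N by exact: mxrankM_maxr.
have h2 : (\rank (\sum_(i | i \notin S) delta_mx i (sigma i) : 'M[F]_n)%R <= n - #|S|)%N.
  apply: leq_trans (mxrank_sum_leq _ _ _) _.
  rewrite (eq_bigr (fun=> 1%N)); last by move=> i _; rewrite mxrank_delta.
  have <- : #|~: S| = (n - #|S|)%N by rewrite cardsCs card_ord finset.setCK.
  by rewrite -sum1_card leq_eqVlt; apply/orP; left; apply/eqP; apply: eq_bigl => i; rewrite inE.
have Sn : (#|S| <= n)%N by rewrite -[n in leqRHS]card_ord; exact: max_card.
lia.
Qed.

(** While a zero row remains, the row space is not everything and misses some unit vector; placing
    it in that row raises the rank by at least one. *)
Lemma fill_rows X Z : (forall i, i \in Z -> row i X = 0) -> (n <= \rank X + #|Z|)%N ->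
  exists sigma, (X + \sum_(i in Z) delta_mx i (sigma i)) \in unitmx.
Proof.
have [k] := ubnP #|Z|; elim: k Z X => // k IH Z X Zk ZX rX.
have [Z0|[z zZ]] := set_0Vmem Z.
  exists id; rewrite Z0 big_set0 addr0 -row_free_unit /row_free eqn_leq rank_leq_row /=.
  by rewrite Z0 cards0 addn0 in rX.
have [j jX] : exists j, ~~ ((delta_mx 0 j : 'rV[F]_n) <= X)%MS.
  apply: contrapT => nj.
  have h j : ((delta_mx 0 j : 'rV[F]_n) <= X)%MS by apply: contrapT => /negP h; apply: nj; exists j.
  have : (1%:M <= X)%MS by apply/row_subP => j; rewrite row1.
  rewrite sub1mx row_full_unit -row_free_unit => Xf.
  have /(row_free_inj Xf) : delta_mx 0 z *m X = (0 : 'rV_n) *m X by rewrite -rowE ZX// mul0mx.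
  by move=> /matrixP/(_ 0 z)/eqP; rewrite !mxE !eqxx oner_eq0.
pose Y := X + delta_mx z j.
have rowY i : row i Y = row i X + (i == z)%:R *: delta_mx 0 j.
  by apply/rowP => l; rewrite !mxE eqxx /= -natrM mulnb.
have jY : ((delta_mx 0 j : 'rV[F]_n) <= Y)%MS by have := row_sub z Y; rewrite rowY ZX// add0r eqxx scale1r.
have XY : (X <= Y)%MS.
  apply/row_subP => i; have := row_sub i Y; rewrite rowY; case: eqP => [->|_].
    by rewrite ZX// sub0mx.
  by rewrite scale0r addr0.
have rXY : (\rank X < \rank Y)%N.
  by apply: rank_ltmx; rewrite /ltmx XY; apply: contra jX => YX; exact: submx_trans jY YX.
have [|||sigma hs] := IH (Z :\ z) Y.
- by have := cardsD1 z Z; rewrite zZ; lia.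
- move=> i /setD1P[iz iZ]; rewrite rowY (negbTE iz) scale0r addr0; exact: ZX.
- by have := cardsD1 z Z; rewrite zZ; lia.
exists (fun i => if i == z then j else sigma i); rewrite (big_setD1 z)//= eqxx addrA.
rewrite (eq_bigr (fun i => delta_mx i (sigma i)))// => i /setD1P[iz _].
by rewrite (negbTE iz).
Qed.

Lemma complete_rows D : exists S sigma, #|S| = (n - \rank D)%N /\ mixed_mx (~: S) sigma D \in unitmx.
Proof.
pose f := maxrankfun D; pose S := ~: [set f a | a : 'I_(\rank D)].
have cS : #|S| = (n - \rank D)%N.
  rewrite cardsCs finset.setCK card_ord card_imset ?card_ord//; exact: maxrankfun_inj.
pose X : 'M[F]_n := \matrix_(i, l) if i \in S then 0 else D i l.
have [|| sigma hs] := @fill_rows X S.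
- by move=> i iS; apply/rowP => l; rewrite !mxE iS.
- have e : rowsub f X = rowsub f D.
    by apply/matrixP => a l; rewrite !mxE /S inE imset_f.
  have : (\rank (rowsub f X) <= \rank X)%N by apply: mxrankS; exact: rowsub_sub.
  by have /eqP := maxrowsub_free D; rewrite -/f e => ->; rewrite cS; lia.
exists S, sigma; split=> //; rewrite (_ : mixed_mx _ _ _ = X + \sum_(i in S) delta_mx i (sigma i))//.
apply/matrixP => i l; rewrite !mxE summxE inE; case: (boolP (i \in S)) => iS /=.
  rewrite (bigD1 i)//= mxE eqxx /= big1 ?addr0 ?add0r// => j /andP[_ ji].
  by rewrite mxE eq_sym (negbTE ji).
by rewrite big1 ?addr0// => j jS; rewrite mxE; case: eqP => // ij; rewrite ij jS in iS.
Qed.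

End selection.

Lemma unitmx_lower_bound (R : realFieldType) n (P : 'M[R]_n) : P \in unitmx ->
  exists2 c : R, 0 < c & forall (v : 'rV[R]_n) (t : R), 0 <= t ->
    (forall i, `|\sum_l P i l * v 0 l| <= t) -> forall l, `|v 0 l| <= c * t.
Proof.
move=> uP; exists (\sum_l \sum_i `|invmx P l i| + 1).
  by rewrite ltr_wpDl// sumr_ge0// => l _; exact: sumr_ge0.
move=> v t t0 h l.
have -> : v 0 l = \sum_i invmx P l i * (\sum_m P i m * v 0 m).
  have : (invmx P *m (P *m v^T)) l 0 = v 0 l by rewrite mulKmx// mxE.
  move=> <-; rewrite mxE; apply: eq_bigr => i _; congr (_ * _).
  by rewrite mxE; apply: eq_bigr => m _; rewrite mxE.
apply: le_trans (ler_norm_sum _ _ _) _; rewrite mulrDl mul1r.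
apply: (@le_trans _ _ ((\sum_i `|invmx P l i|) * t)).
  by rewrite mulr_suml; apply: ler_sum => i _; rewrite normrM ler_wpM2l.
apply: ler_wpDr => //; apply: ler_wpM2r => //; rewrite [leRHS](bigD1 l)//= lerDl.
by apply: sumr_ge0 => m _; exact: sumr_ge0.
Qed.

(** * Bounds on the exponents *)

Section rank_obstructions.
Context {R : realType} {n : nat}.
Local Notation V := 'rV[R]_n.+1.
Local Notation LT := (lebesgue_type R n.+1).
Implicit Types (x y z : V) (A B E K Z Om : set V) (f g : V -> V) (Df Dg : V -> 'M[R]_n.+1) (S : {set 'I_n.+1}).

Lemma mixed_continuous A S f : {within A, continuous f} -> {within A, continuous (mixed S id f)}.
Proof.
move=> /within_continuousP cf; apply/within_continuousP => x Ax e e0.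
have [d d0 hd] := cf x Ax e e0; exists (Num.min d e); first by rewrite lt_min d0.
move=> y Ay; rewrite lt_min => /andP[xyd xye]; apply/rV_norm_ltP => // i.
rewrite !mxE; case: ifP => _.
  have := hd y Ay xyd; apply: le_lt_trans.
  by have := le_coord_norm (f x - f y) i; rewrite !mxE.
by apply: le_lt_trans xye; have := le_coord_norm (x - y) i; rewrite !mxE.
Qed.

Lemma mixed_boundary Om S f : identity_on_boundary Om f -> identity_on_boundary Om (mixed S id f).
Proof.
move=> [F [cF Ff Fid]]; exists (mixed S id F); split.
- exact: mixed_continuous.
- by move=> x Ox; apply/rowP => i; rewrite !mxE Ff.
- by move=> x bx; apply/rowP => i; rewrite !mxE Fid// if_same.
Qed.

Lemma mixed_strongly_diff K S f Df : strongly_diff_on K f Df ->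
  strongly_diff_on K (mixed S id f) (fun x => mixed_mx S id (Df x)).
Proof.
move=> sd eta eta0; have [rho rho0 h] := sd eta eta0; exists rho => // x0 x y K0 Kx Ky h1 h2 i.
rewrite !mxE; case: (boolP (i \in S)) => iS.
  rewrite (eq_bigr (fun l => Df x0 i l * (y - x) 0 l)); first exact: h.
  by move=> l _; rewrite !mxE iS.
rewrite (bigD1 i)//= big1 ?addr0.
  by rewrite !mxE (negbTE iS) eqxx mul1r subrr normr0 mulr_ge0// ltW.
by move=> l li; rewrite !mxE (negbTE iS) (negbTE li) mul0r.
Qed.

Lemma card_ltn_set k : (k <= n.+1)%N -> #|[set i : 'I_n.+1 | (i < k)%N]%SET| = k.
Proof.
by move=> kn; rewrite -sum1dep_card -(big_ord_widen _ (fun=> 1%N) kn) sum1_card card_ord.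
Qed.

(* Replacing all but [m + 1] of the coordinates of [f] by those of the identity gives a map which
   is onto, by Brouwer, and whose differential is singular, by the rank hypothesis. *)
Lemma integrability_bound_rank (Om : set V) f Df Df' (m : nat) (p : R) :
  bounded_set Om -> open Om -> Om !=set0 -> {within Om, continuous f} -> identity_on_boundary Om f ->
  weak_jacobian Om f Df -> {ae lebesgue R n.+1, forall x, Om x -> (\rank (Df x) <= m)%N} ->
  (m <= n)%N -> weak_jacobian Om f Df' -> (forall i j, Lp Om p (fun x => Df' x i j)) ->
  p <= (m + 1)%:R.
Proof.
move=> bO oO [x0 Ox0] cf idf wf rk mn wf' Lf'; rewrite leNgt; apply/negP; rewrite addn1 => mp.
pose S := [set i : 'I_n.+1 | (i < m.+1)%N]%SET; have cS : #|S| = m.+1 by exact: card_ltn_set.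
pose Psi := mixed S id f.
have cPsi : {within Om, continuous Psi} by exact: mixed_continuous.
have idPsi : identity_on_boundary Om Psi by exact: mixed_boundary.
have oOO : open (Om `\` Om) by rewrite setDv; exact: open0.
pose Pe := extend_id Om Psi.
have cPe : continuous Pe by exact: (extend_id_continuous oO oOO).
have sPe z : exists x, Pe x = z by exact: (extend_id_surjective bO oO oOO).
have [r0 r00 hr0] := open_ballP oO Ox0.
pose r : R := r0 / 2; have rp : 0 < r by rewrite divr_gt0.
pose Bc : set V := dball (x0, r).
have BcO : Bc `<=` Om by move=> x; rewrite /Bc /dball /= => h; apply: hr0; apply: le_lt_trans h _; rewrite /r; lra.
pose v : R := (2 * r) ^+ n.+1; have v0 : 0 < v by rewrite exprn_gt0// mulr_gt0.
have volB : vol Bc = v%:E by rewrite vol_dball// ltW.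
have cB : compact Bc by rewrite /Bc dballE ?(ltW rp)//; exact: box_compact.
pose K0 := Pe @^-1` Bc.
have K0O : K0 `<=` Om.
  move=> x; rewrite /K0 /= /Pe => h; apply: contrapT => nO.
  by rewrite extend_id_out// in h; apply: nO; exact: BcO.
have cloK0 : closed K0 by apply: preimage_closed => //; exact: compact_closed_rV.
have bK0 : bounded_set K0 by exact: bounded_sub bO K0O.
have [MK MK0 K0M] := bounded_cube bK0.
have cK0 : compact K0 by apply: subclosed_compact (@cube_compact _ _ (- const_mx MK) (const_mx MK)) _.
have mK0 : lebesgue_measurable K0 by exact: compact_lebesgue.
have [N [mN N0 rkN]] := rk.
have [d d0 small] := mixed_small_image id oO (ltn0Sn m) mp cS cf wf' Lf' (divr_gt0 v0 (ltr0n _ 2)).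
pose E := K0 `\` N.
have mE : lebesgue_measurable E by apply: measurableD; [exact: mK0|exact: mN].
have EO : E `<=` Om by move=> x [/K0O].
have bE : bounded_set E by exact: bounded_sub bO EO.
have [K [cK KE hK [M hM] sdK]] := strong_diff oO cf wf mE bE EO (divr_gt0 d0 (ltr0n _ 2)).
have PsiK : vol (Psi @` K) = 0%E.
  apply: (@singular_image_null _ _ K Psi (fun x => mixed_mx S id (Df x)) (`|M| + 1)) => //.
  - move=> x i l Kx; rewrite mxE; case: ifP => _.
      by apply: le_trans (hM x i l Kx) _; apply: le_trans (ler_norm _) _; rewrite lerDl.
    by case: eqP => _; rewrite ?normr1 ?normr0 ?lerDr// addr_ge0.
  - exact: mixed_strongly_diff.
  move=> x Kx; apply: singular_kernel; apply: mixed_mx_singular; rewrite cS ltnS.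
  have [K0x nN] := KE x Kx; apply: contrapT => nrk; apply: nN; apply: rkN => h.
  by apply: nrk; apply: h; exact: K0O.
have KO : K `<=` Om by exact: subset_trans KE EO.
have cPK : compact (Psi @` K).
  apply: continuous_compact => //; exact: continuous_subspaceW KO cPsi.
have [r1 r10 hr1] : exists2 r : R, 0 < r & (vol (thicken (Psi @` K) r) < (v / 2)%:E)%E.
  by apply: compact_outer_regular => //; rewrite PsiK lte_fin divr_gt0.
pose V0 := thicken (Psi @` K) r1.
(* What the image of [K] leaves uncovered is produced by this set, of measure less than [d]. It is
   cut out by the open thickening [V0], and not by [K], to be compact as [mixed_small_image]
   demands. *)
pose Z := K0 `&` Pe @^-1` (~` V0).
have PeE x : Om x -> Pe x = Psi x by exact: extend_id_in.
have cZ : compact Z.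
  apply: compact_closedI => //; apply: preimage_closed => //.
  by apply: open_closedC; exact: thicken_open.
have ZO : Z `<=` Om by move=> x [/K0O].
have Zd : (vol Z < d%:E)%E.
  have sub : Z `<=` (E `\` K) `|` N.
    move=> x [K0x nV]; have [Nx|nN] := pselect (N x); [by right|left; split=> // Kx].
    apply: nV; rewrite PeE; last exact: KO.
    by exists (Psi x); [exists x|rewrite subrr normr0].
  apply: le_lt_trans (le_vol sub) _; apply: le_lt_trans (volU2 _ _) _.
  rewrite [X in (_ + X)%E](_ : _ = 0%E); last exact: N0.
  by rewrite adde0; apply: le_lt_trans hK _; rewrite lte_fin; lra.
have BZ : Bc `<=` V0 `|` (Psi @` Z).
  move=> z Bz; have [x xz] := sPe z; have K0x : K0 x by rewrite /K0 /= xz.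
  have [Vz|nV] := pselect (V0 z); [by left|right].
  exists x; last by rewrite -PeE//; exact: K0O.
  by split=> //=; rewrite xz.
have := le_trans (le_vol BZ) (volU2 _ _).
apply/negP; rewrite -ltNge volB (splitr v) EFinD; apply: lte_leD => //.
  have := small Z cZ ZO Zd; case: (vol _) (vol_ge0 (Psi @` Z)) => //.
exact: small.
Qed.

(* The map [x |-> (f_i x, i \notin S; x_(sigma i), i \in S)] is bi-Lipschitz near a point where its
   differential is invertible, but factors as [mixed S sigma g] after [f]. *)
Lemma inverse_integrability_bound_rank (Om : set V) f g Df Dg (A : set V) (m : nat) (q : R) :
  bounded_set Om -> open Om -> {within Om, continuous f} -> {within Om, continuous g} ->
  (forall x, Om x -> Om (f x)) -> {in Om, cancel f g} ->
  weak_jacobian Om f Df -> weak_jacobian Om g Dg -> (forall i j, Lp Om q (fun x => Dg x i j)) ->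
  lebesgue_measurable A -> A `<=` Om -> (0 < vol A)%E -> (forall x, A x -> \rank (Df x) = m) ->
  (m <= n)%N -> q <= (n.+1 - m)%:R.
Proof.
move=> bO oO cf cg fO fg wf wg Lg mA AO A0 rk mn; rewrite leNgt; apply/negP => kq.
pose k := (n.+1 - m)%N; have k0 : (0 < k)%N by rewrite subn_gt0 ltnS.
have bA : bounded_set A by exact: bounded_sub bO AO.
have Aoo := bounded_vol bA.
pose a : R := fine (vol A); have vA : vol A = a%:E by exact: vol_fine.
have a0 : 0 < a by rewrite -lte_fin -vA.
have [K [cK KA hK [M hM] sdK]] := strong_diff oO cf wf mA bA AO (divr_gt0 a0 (ltr0n _ 2)).
have KO : K `<=` Om by exact: subset_trans KA AO.
have volK : vol K <> 0%E.
  move=> K0; have sub : A `<=` K `|` (A `\` K).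
    by move=> x Ax; have [Kx|nK] := pselect (K x); [left|right].
  have := le_trans (le_vol sub) (volU2 _ _); rewrite K0 add0e vA => h.
  have := le_trans h hK; rewrite lee_fin; lra.
have fK0 : vol (f @` K) = 0%E.
  apply: (singular_image_null cK hM sdK) => x Kx.
  by apply: singular_kernel; rewrite rk ?ltnS//; exact: KA.
apply: volK; apply: locally_null => // x0 Kx0.
have [S [sigma [cS uP]]] := complete_rows (Df x0).
rewrite rk -/k in cS; last exact: KA.
set P := mixed_mx _ _ _ in uP.
have [c c0 hc] := unitmx_lower_bound uP.
(* With [eta * c = 1/2], the error of linearisation is absorbed in the lower bound given by the
   inverse of [P]. *)
pose eta : R := (2 * c)^-1; have eta0 : 0 < eta by rewrite invr_gt0 mulr_gt0.
have [rho rho0 hrho] := sdK eta eta0.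
exists rho => //; pose K1 := K `&` dball (x0, rho).
suff K10 : vol K1 = 0%E.
  apply/le_anti; rewrite vol_ge0 andbT -K10; apply: le_vol => x [Kx xx0]; split=> //.
  exact: ltW.
have cK1 : compact K1.
  apply: compact_closedI => //; apply: compact_closed_rV; rewrite dballE ?(ltW rho0)//; exact: box_compact.
(* On [K] the components of [g] after [f] are the coordinates themselves, so the differential of
   this composite at [x0] is the invertible [P]. *)
pose Phi := mixed S sigma g \o f.
have PhiE x i : K x -> Phi x 0 i = if i \in S then x 0 (sigma i) else f x 0 i.
  by move=> Kx; rewrite mxE fg// inE; exact: KO.
have dPhi x y i : K1 x -> K1 y ->
    `|Phi y 0 i - Phi x 0 i - \sum_l P i l * (y - x) 0 l| <= eta * `|y - x|.
  move=> [Kx xr] [Ky yr]; rewrite !PhiE//; case: (boolP (i \in S)) => iS.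
    rewrite (bigD1 (sigma i))//= big1 ?addr0.
      by rewrite !mxE inE iS /= eqxx mul1r subrr normr0 mulr_ge0// ltW.
    by move=> l li; rewrite mxE inE iS /= (negbTE li) mul0r.
  rewrite (eq_bigr (fun l => Df x0 i l * (y - x) 0 l)); first exact: hrho.
  by move=> l _; rewrite [P i l]mxE inE iS.
have vecB (s t : V) i : (s - t) 0 i = s 0 i - t 0 i by rewrite !mxE.
pose Q : R := \sum_i \sum_l `|P i l|.
have Q0 : 0 <= Q by apply: sumr_ge0 => i _; exact: sumr_ge0.
apply: (@bilipschitz_null _ _ K1 Phi eta (Q + eta)) => //; first by rewrite addr_ge0// ltW.
- move=> x y K1x K1y.
  have Pv i : `|\sum_l P i l * (x - y) 0 l| <= Q * `|x - y|.
    apply: le_trans (ler_norm_sum _ _ _) _.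
    apply: (@le_trans _ _ ((\sum_l `|P i l|) * `|x - y|)).
      by rewrite mulr_suml; apply: ler_sum => l _; rewrite normrM ler_wpM2l// le_coord_norm.
    rewrite ler_wpM2r// /Q [leRHS](bigD1 i)//= lerDl; apply: sumr_ge0 => j _; exact: sumr_ge0.
  apply/andP; split.
    pose t := `|Phi x - Phi y| + eta * `|x - y|.
    have t0 : 0 <= t by rewrite addr_ge0// mulr_ge0// ltW.
    have ht i : `|\sum_l P i l * (x - y) 0 l| <= t.
      have h1 := dPhi y x i K1y K1x.
      have h2 : `|Phi x 0 i - Phi y 0 i| <= `|Phi x - Phi y|.
        by rewrite -vecB; exact: le_coord_norm.
      set s := \sum_l _ in h1 *.
      have -> : s = (Phi x 0 i - Phi y 0 i) - (Phi x 0 i - Phi y 0 i - s) by ring.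
      by apply: le_trans (ler_normB _ _) _; exact: lerD.
    have h3 : `|x - y| <= c * t.
      by apply/rV_norm_leP; [rewrite mulr_ge0// ltW|exact: hc].
    have e1 : c * (eta * `|x - y|) = `|x - y| / 2 by rewrite /eta; field; rewrite gt_eqF.
    have e2 : eta * `|x - y| <= eta * (c * t) by rewrite ler_wpM2l// ltW.
    have e3 : eta * (c * t) = t / 2 by rewrite /eta; field; rewrite gt_eqF.
    by move: e2; rewrite e3 /t; lra.
  apply/rV_norm_leP; first by rewrite mulr_ge0// addr_ge0// ltW.
  move=> i; have h1 := dPhi y x i K1y K1x; have h2 := Pv i.
  have -> : (Phi x - Phi y) 0 i = (Phi x 0 i - Phi y 0 i - \sum_l P i l * (x - y) 0 l) + \sum_l P i l * (x - y) 0 l.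
    by rewrite subrK vecB.
  by apply: le_trans (ler_normD _ _) _; rewrite mulrDl addrC; exact: lerD.
have fK1 : compact (f @` K1).
  apply: continuous_compact => //; apply: continuous_subspaceW cf => x [Kx _]; exact: KO.
have fK1O : f @` K1 `<=` Om by move=> _ [x [Kx _] <-]; apply: fO; exact: KO.
rewrite -image_comp; apply/le_anti; rewrite vol_ge0 andbT; apply/lee_addgt0Pr => e e0; rewrite add0e.
have [d d0 small] := mixed_small_image sigma oO k0 kq cS cg wg Lg e0.
apply: small => //; apply: (@le_lt_trans _ _ (vol (f @` K))).
  by apply: le_vol; apply: image_subset => x [].
by rewrite fK0 lte_fin.
Qed.

End rank_obstructions.

Theorem theorem4 (R : realType) (n m1 m2 : nat) (p q : R)
    (Om : set 'rV[R]_n) (f g : 'rV[R]_n -> 'rV[R]_n)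
    (Df Dg : 'rV[R]_n -> 'M[R]_(n, n)) (A B : set 'rV[R]_n) :
  (0 < n)%N -> (m1 <= n.-1)%N -> (m2 <= n.-1)%N -> 1 <= p -> 1 <= q ->
  Om !=set0 -> bounded_set Om -> open Om ->
  bisobolev_homeo Om f g ->
  sobolev Om p f -> sobolev (f @` Om) q g ->
  identity_on_boundary Om f ->
  weak_jacobian Om f Df -> weak_jacobian (f @` Om) g Dg ->
  {ae lebesgue R n, forall x, Om x -> (\rank (Df x) <= m1)%N} ->
  {ae lebesgue R n, forall x, Om x -> (\rank (Dg x) <= m2)%N} ->
  lebesgue_measurable A -> A `<=` Om -> (0 < lebesgue R n A)%E ->
  (forall x, A x -> \rank (Df x) = m1) ->
  lebesgue_measurable B -> B `<=` Om -> (0 < lebesgue R n B)%E ->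
  (forall x, B x -> \rank (Dg x) = m2) ->
  p <= Num.min (m1 + 1)%:R (n - m2)%:R /\
  q <= Num.min (m2 + 1)%:R (n - m1)%:R.
Proof.
case: n => // n in Om f g Df Dg A B *.
(* The integrability bounds concern [Df'] and [Dg'], the rank conditions [Df] and [Dg]; each pair
   enters through its own estimate. *)
move=> _ m1n m2n p1 q1 O0 bO oO [homeo _ _] [_ [Df' wf' Lf']] [_ [Dg' wg' Lg']] idf wf wg rkf rkg.
move=> mA AO A0 rA mB BO B0 rB.
have fOm : f @` Om = Om by exact: (image_homeo bO oO homeo idf).
have homeo' := homeomorphism_inverse bO oO homeo idf.
have idg := identity_on_boundary_inverse bO oO homeo idf.
rewrite fOm in wg wg' Lg'.
have [fg cf _] := homeo; have [gf cg _] := homeo'.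
have fO x : Om x -> Om (f x) by rewrite -[in X in _ -> X]fOm; exact: imageP.
have gO x : Om x -> Om (g x).
  by rewrite -[in X in X -> _]fOm => -[y Oy <-]; rewrite fg ?inE.
split; rewrite le_min; apply/andP; split.
- exact: (integrability_bound_rank bO oO O0 cf idf wf rkf m1n wf' Lf').
- exact: (inverse_integrability_bound_rank bO oO cg cf gO gf wg wf' Lf' mB BO B0 rB m2n).
- exact: (integrability_bound_rank bO oO O0 cg idg wg rkg m2n wg' Lg').
- exact: (inverse_integrability_bound_rank bO oO cf cg fO fg wf wg' Lg' mA AO A0 rA m1n).
Qed.
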